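(* Let $P\subset\mathbb{E}^3$ be a polyhedron along with a simplicial decomposition of $P$ with no vertex except the vertices of $P$, and let $\Lambda(P)$ be the associated $r\times r$ matrix defined in the context, where $r$ is the number of interior edges of the decomposition. Then $P$ is infinitesimally flexible if and only if $\Lambda(P)$ is singular (i.e. its kernel has dimension at least $1$).
   Context: $S_1,\dots,S_q$ are the simplices of the decomposition (with disjoint interiors and union $P$), and $e_1,\dots,e_r$ are its interior edges, i.e. the segments which are edges of the simplicial decomposition but are contained in the interior of $P$ (apart from their endpoints); the remaining edges of the decomposition are contained in the boundary of $P$. Let $E\subset\mathbb{R}^r$ be the set of $(l_1,\dots,l_r)$ such that, for each simplex $S_i$, if each edge of $S_i$ which is an interior edge $e_j$ is given length $l_j$ and every other edge of $S_i$ is given its length in $P$, then the resulting 6 numbers are the edge lengths of a Euclidean simplex. Let $l^0=(l^0_1,\dots,l^0_r)\in E$ be the actual lengths of $e_1,\dots,e_r$ in $P$. For $(l_1,\dots,l_r)\in E$, let $\theta_i$ be the sum, over all simplices of the decomposition containing $e_i$, of the dihedral angle at $e_i$ of the Euclidean simplex with the prescribed edge lengths. This defines a map $\phi:E\to(0,\infty)^r$, $(l_1,\dots,l_r)\mapsto(\theta_1,\dots,\theta_r)$, with $\phi(l^0)=(2\pi,\dots,2\pi)$. Then $\Lambda(P):=\left(\frac{\partial\theta_i}{\partial l_j}\right)_{1\le i,j\le r}$ is the Jacobian matrix of $\phi$ at $l^0$. Infinitesimal rigidity: an infinitesimal flex (isometric first-order deformation) of $P$ assigns to each vertex $\mathbf{v}$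 of $P$ a vector $\mathbf{v}'\in\mathbb{R}^3$ such that $(\mathbf{v}-\mathbf{w})\cdot(\mathbf{v}'-\mathbf{w}')=0$ for every edge $[\mathbf{v},\mathbf{w}]$ of the decomposition contained in the boundary of $P$; that is, all edges of the decomposition other than $e_1,\dots,e_r$ keep fixed length to first order. It is trivial if it is the restriction of the derivative of a family of rigid congruences of $\mathbb{E}^3$. $P$ is infinitesimally rigid if every infinitesimal flex is trivial, and infinitesimally flexible otherwise.
   Formalization: ''Polyhedron'' is taken to be a solid body (not necessarily convex) homeomorphic to a closed ball; without such a condition the claim fails, e.g. for two tetrahedra sharing only an edge, or for some solid tori. *)

(* Defs.v *)
From HB Require Import structures.
From mathcomp Require Import all_boot all_order all_algebra.
From mathcomp Require Import all_classical all_reals all_analysis.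

Set Implicit Arguments.
Unset Strict Implicit.
Unset Printing Implicit Defensive.

Import Order.TTheory GRing.Theory Num.Theory.
Import numFieldNormedType.Exports.

Local Open Scope classical_set_scope.
Local Open Scope ring_scope.

(** Euclidean 3-space is ['rV[R]_3] with the inner product [dot].  The library
    norm of ['rV[R]_3] is the sup norm: it induces the usual topology, which is
    all it is used for here; lengths and angles come from [dot]. *)

Definition dot (R : realType) (u v : 'rV[R]_3) : R :=
  \sum_(k < 3) u 0 k * v 0 k.

Definition enorm (R : realType) (u : 'rV[R]_3) : R := Num.sqrt (dot u u).

Definition edist (R : realType) (x y : 'rV[R]_3) : R := enorm (x - y).

Definition angle (R : realType) (u v : 'rV[R]_3) : R :=
  acos (dot u v / (enorm u * enorm v)).

Definition orth_part (R : realType) (u w : 'rV[R]_3) : 'rV[R]_3 :=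
  w - (dot w u / dot u u) *: u.

(** Interior dihedral angle of the tetrahedron [abcd] at its edge [ab]. *)
Definition dihedral (R : realType) (a b c d : 'rV[R]_3) : R :=
  angle (orth_part (b - a) (c - a)) (orth_part (b - a) (d - a)).

Section Points.

Context (R : realType) (V : finType).
Implicit Types (p q : V -> 'rV[R]_3) (S e : {set V}).

Definition affinely_independent p S : Prop :=
  forall a : V -> R,
    \sum_(i in S) a i = 0 -> \sum_(i in S) a i *: p i = 0 ->
    forall i, i \in S -> a i = 0.

Definition hull p S : set 'rV[R]_3 :=
  [set x | exists a : V -> R,
     [/\ forall i, i \in S -> 0 <= a i,
         \sum_(i in S) a i = 1 &
         x = \sum_(i in S) a i *: p i]].

(** Edges are two-element sets of vertices; the default value is never used. *)
Definition edge_length p e : R :=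
  if enum e is [:: i; j] then edist (p i) (p j) else 0.

(** For [e] a two-element subset of a four-element set [S]; [dihedral] is
    symmetric both in the end points of [e] and in the two other vertices. *)
Definition dihedral_at p S e : R :=
  if (enum e, enum (S :\: e)) is ([:: i; j], [:: k; l])
  then dihedral (p i) (p j) (p k) (p l) else 0.

End Points.

Section Polyhedra.

Context (R : realType).
Implicit Types (P : set 'rV[R]_3) (x u : 'rV[R]_3).

Definition homeomorphic (A B : set 'rV[R]_3) : Prop :=
  exists f g : 'rV[R]_3 -> 'rV[R]_3,
    [/\ {within A, continuous f}, {within B, continuous g},
        f @` A `<=` B, g @` B `<=` A &
        {in A, cancel f g} /\ {in B, cancel g f}].

Definition closed_unit_ball : set 'rV[R]_3 := [set x | enorm x <= 1].

(** A solid polyhedron, not assumed to be convex: the body bounded by an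
    embedded polyhedral sphere. *)
Definition polyhedron P : Prop :=
  (exists (m : nat) (s : 'I_m -> 'I_4 -> 'rV[R]_3),
     (forall i, affinely_independent (s i) [set: 'I_4]%SET) /\
     P = \bigcup_i hull (s i) [set: 'I_4]%SET) /\
  homeomorphic P closed_unit_ball.

(** Near [x], the set [P] is invariant under translations parallel to [u]. *)
Definition locally_invariant P x u : Prop :=
  exists2 eps : R, 0 < eps &
    forall (y : 'rV[R]_3) (t : R),
      edist x y < eps -> edist x (y + t *: u) < eps ->
      (P y <-> P (y + t *: u)).

(** A polyhedron is locally invariant along every direction near its interior
    points, along the directions of a face near the points inside that face,
    and along the direction of an edge near the points inside that edge.  Its
    vertices are the remaining points. *)
Definition vertex_of P x : Prop :=
  P x /\ forall u, locally_invariant P x u -> u = 0.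

End Polyhedra.

Section Decomposition.

Context (R : realType) (n : nat).
Implicit Types (P : set 'rV[R]_3) (p q : 'I_n -> 'rV[R]_3).
Implicit Types (T : {set {set 'I_n}}) (S e : {set 'I_n}).

(** [p] lists the vertices of the decomposition, and [T] its simplices, each
    given by its set of four vertices.  Simplices meet along common faces, so
    distinct ones have disjoint interiors. *)
Definition simplicial_decomposition P p T : Prop :=
  [/\ injective p,
      forall i, exists2 S, S \in T & i \in S,
      forall S, S \in T -> #|S| = 4%N /\ affinely_independent p S,
      forall S1 S2, S1 \in T -> S2 \in T ->
        hull p S1 `&` hull p S2 = hull p (S1 :&: S2) &
      P = \bigcup_(S in [set` T]) hull p S].

Definition no_added_vertex P p : Prop := forall i, vertex_of P (p i).

Definition edges T : {set {set 'I_n}} :=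
  [set e : {set 'I_n} | (#|e| == 2)%N && [exists S in T, e \subset S]]%SET.

Definition open_edge p e : set 'rV[R]_3 :=
  hull p e `\` [set p i | i in [set` e]].

Definition interior_edges P p T : {set {set 'I_n}} :=
  [set e in edges T |
     `[< (open_edge p e `<=` interior P)%classic >]]%SET.

(** The edges that are not interior are those contained in the boundary. *)
Definition infinitesimal_flex P p T (v : 'I_n -> 'rV[R]_3) : Prop :=
  forall i j, i != j ->
    [set i; j]%SET \in edges T ->
    [set i; j]%SET \notin interior_edges P p T ->
    dot (p i - p j) (v i - v j) = 0.

Definition congruence (g : 'rV[R]_3 -> 'rV[R]_3) : Prop :=
  forall x y, edist (g x) (g y) = edist x y.

Definition trivial_flex p (v : 'I_n -> 'rV[R]_3) : Prop :=
  exists (g : R -> 'rV[R]_3 -> 'rV[R]_3) (X : 'rV[R]_3 -> 'rV[R]_3),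
    [/\ forall t, congruence (g t),
        forall x, g 0 x = x,
        forall x, is_derive (0 : R) 1 (fun t : R => g t x) (X x) &
        forall i, v i = X (p i)].

Definition infinitesimally_rigid P p T : Prop :=
  forall v, infinitesimal_flex P p T v -> trivial_flex p v.

Definition infinitesimally_flexible P p T : Prop :=
  ~ infinitesimally_rigid P p T.

Section Angles.

Context (P : set 'rV[R]_3) (p : 'I_n -> 'rV[R]_3) (T : {set {set 'I_n}}).

Definition nb_interior_edges : nat := #|interior_edges P p T|.
Local Notation r := nb_interior_edges.

Definition interior_edge (i : 'I_r) : {set 'I_n} := enum_val i.

Definition actual_lengths : 'rV[R]_r :=
  \row_i edge_length p (interior_edge i).

Definition prescribed_length (l : 'rV[R]_r) e : R :=
  if [pick i | interior_edge i == e] is Some i then l 0 i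
  else edge_length p e.

(** [q] places the vertices of [S] as those of a Euclidean simplex with the
    prescribed edge lengths; its values outside [S] are irrelevant. *)
Definition realizes (l : 'rV[R]_r) S q : Prop :=
  affinely_independent q S /\
  forall e, #|e| = 2%N -> e \subset S -> edge_length q e = prescribed_length l e.

Definition admissible_lengths : set 'rV[R]_r :=
  [set l | forall S, S \in T -> exists q, realizes l S q].

(** For admissible [l] the dihedral angles do not depend on the realization
    that [xget] picks.  [phi] takes irrelevant values outside
    [admissible_lengths], which is a neighbourhood of [actual_lengths]. *)
Definition phi (l : 'rV[R]_r) : 'rV[R]_r :=
  \row_i \sum_(S in T | interior_edge i \subset S)
    dihedral_at (xget p [set q | realizes l S q]) S (interior_edge i).

(** Partial derivatives are taken one variable at a time, so that no case
    distinction is needed when there is no interior edge. *)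
Definition Lambda : 'M[R]_r :=
  \matrix_(i, j)
    derive1 (fun t : R => phi (actual_lengths + t *: delta_mx 0 j) 0 i) 0.

End Angles.

End Decomposition.

(* Main.v *)
Require Import Defs.
From mathcomp Require Import all_boot all_order all_algebra.
From mathcomp Require Import all_classical all_reals all_analysis.
From mathcomp Require Import ring lra.

(** Let [x] be a first-order variation of the lengths of the interior edges.  The
    entries of [Lambda x] are the variations of the total dihedral angles around
    the interior edges when each simplex is deformed accordingly ([Lambda_mul]).
    The theorem holds because the kernel of [Lambda] consists of the variations
    of the interior lengths under flexes, and because a flex under which these
    lengths do not vary is trivial.

    In a moving simplex, the dihedral angle at an edge varies at the difference
    of the rates of rotation of its two sides about the edge
    ([ddihfun_turning]).  Every triangle on an interior edge belongs to exactly
    two simplices, which lie on opposite sides of it ([opposite_sides],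
    [other_side]); so under a flex the variation of the total angle cancels
    ([Lambda_flex]).  If [Lambda] is invertible, a flex therefore preserves all
    lengths to first order and restricts to an infinitesimal congruence on each
    simplex ([killing_exists]).  The congruences of two simplices with a common
    triangle are equal, and any two simplices are connected through triangles,
    so the flex is trivial ([isometric_trivial]).

    Conversely let [x] be in the kernel.  Around one edge there is a motion of
    the vertices with the length variations [x] ([edge_motion]): the rates of
    rotation of the triangles on this edge must have prescribed differences, and
    by the Fredholm alternative the only obstruction is the variation of the
    total angle.  On a common simplex, the motions found for different edges
    differ by infinitesimal congruences.  These discrepancies form a cocycle on
    the polyhedron without its vertices, with values in the abelian group of
    infinitesimal congruences; it is a coboundary, and the motions can be
    corrected so as to agree ([star_cocycle_trivial], [kernel_motion]).

    The only topological fact behind this is that a ball without finitely many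
    points is connected and has no first Alexander-Spanier cohomology, a
    statement that a homeomorphism carries over to the polyhedron
    ([homeomorphic_punctured]).  Removing points is what makes the local
    structure visible: if the simplices around an edge were not connected
    through triangles, there would be a loop around a point of the edge carrying
    a nontrivial cocycle ([edge_star_connected]), and similarly at a vertex
    ([vertex_star_connected]). *)

Set Implicit Arguments.
Unset Strict Implicit.
Unset Printing Implicit Defensive.

Import Order.TTheory GRing.Theory Num.Theory.
Import numFieldNormedType.Exports.

Local Open Scope classical_set_scope.
Local Open Scope ring_scope.

(** * Alexander-Spanier cohomology in degrees 0 and 1 *)

Section AlexanderSpanier.

Definition additive_on (X : Type) (A : zmodType) (N : set X) (c : X -> X -> A) :=
  forall a b d, N a -> N b -> N d -> c a b + c b d = c a d.

Definition primitive_on (X : Type) (A : zmodType) (N : set X) (c : X -> X -> A)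
    (h : X -> A) :=
  forall a b, N a -> N b -> h b - h a = c a b.

(** A 1-cocycle of Alexander and Spanier: an arbitrary function of two points,
    of which only the germ along the diagonal matters.  Nothing is required to
    be continuous, so that cocycles can be read off a triangulation and carried
    through a homeomorphism. *)
Definition local_cocycle (X : topologicalType) (A : zmodType) (Y : set X)
    (c : X -> X -> A) :=
  forall x, Y x -> exists2 U, nbhs x U & additive_on (U `&` Y) c.

Definition local_primitive (X : topologicalType) (A : zmodType) (Y : set X)
    (c : X -> X -> A) (h : X -> A) :=
  forall x, Y x -> exists2 U, nbhs x U & primitive_on (U `&` Y) c h.

Definition locally_constant (X : topologicalType) (A : Type) (Y : set X)
    (h : X -> A) :=
  forall x, Y x -> \forall y \near x, Y y -> h y = h x.

(** Connectedness, phrased like [H1_trivial] below so that both properties are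
    proved and transported together. *)
Definition H0_trivial (X : topologicalType) (Y : set X) :=
  forall (A : Type) (h : X -> A), locally_constant Y h ->
  forall x y, Y x -> Y y -> h x = h y.

Definition H1_trivial (X : topologicalType) (Y : set X) :=
  forall (A : zmodType) (c : X -> X -> A), local_cocycle Y c ->
  exists h, local_primitive Y c h.

Lemma additive_onxx (X : Type) (A : zmodType) (N : set X) (c : X -> X -> A) a :
  additive_on N c -> N a -> c a a = 0.
Proof.
by move=> cN Na; apply: (addrI (c a a)); rewrite addr0; apply: cN.
Qed.

Lemma additive_onC (X : Type) (A : zmodType) (N : set X) (c : X -> X -> A) a b :
  additive_on N c -> N a -> N b -> c b a = - c a b.
Proof.
move=> cN Na Nb; apply: (addrI (c a b)); rewrite subrr cN //.
exact: additive_onxx cN Na.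
Qed.

Lemma locally_constantS (X : topologicalType) (A : Type) (Y Z : set X)
    (h : X -> A) : Z `<=` Y -> locally_constant Y h -> locally_constant Z h.
Proof.
move=> ZY hY x Zx; near do move=> /ZY; exact: hY (ZY _ Zx).
Unshelve. all: by end_near. Qed.

Lemma local_cocycleS (X : topologicalType) (A : zmodType) (Y Z : set X)
    (c : X -> X -> A) : Z `<=` Y -> local_cocycle Y c -> local_cocycle Z c.
Proof.
move=> ZY cY x /ZY Yx; have [U Ux cU] := cY x Yx; exists U => //.
by move=> a b d [Ua /ZY Ya] [Ub /ZY Yb] [Ud /ZY Yd]; apply: cU.
Qed.

Lemma H0_trivialU (X : topologicalType) (U V : set X) x0 :
  U x0 -> V x0 -> H0_trivial U -> H0_trivial V -> H0_trivial (U `|` V).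
Proof.
move=> Ux0 Vx0 cU cV A h hc.
have hU := locally_constantS (@subsetUl _ U V) hc.
have hV := locally_constantS (@subsetUr _ U V) hc.
suff H x : (U `|` V) x -> h x = h x0 by move=> x y /H -> /H ->.
by move=> []; [move=> Ux; exact: cU hU _ _ _ _|move=> Vx; exact: cV hV _ _ _ _].
Qed.

Lemma local_primitiveS (X : topologicalType) (A : zmodType) (Y Z : set X)
    (c : X -> X -> A) h : Z `<=` Y -> local_primitive Y c h -> local_primitive Z c h.
Proof.
move=> ZY cY x /ZY Yx; have [U Ux cU] := cY x Yx; exists U => //.
by move=> a b [Ua /ZY Ya] [Ub /ZY Yb]; apply: cU.
Qed.

(** Mayer-Vietoris for two relatively closed pieces.  The primitives differ by a
    constant on the connected intersection; once this is corrected the glued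
    function is a primitive even across the intersection, because a point [x]
    there mediates between the pieces: [c a b = c a x + c x b]. *)
Lemma local_primitiveU (X : topologicalType) (A : zmodType) (U V : set X)
    (c : X -> X -> A) :
  (forall x, V x -> ~ U x -> \forall y \near x, ~ U y) ->
  (forall x, U x -> ~ V x -> \forall y \near x, ~ V y) ->
  H0_trivial (U `&` V) -> local_cocycle (U `|` V) c ->
  (exists h, local_primitive U c h) -> (exists h, local_primitive V c h) ->
  exists h, local_primitive (U `|` V) c h.
Proof.
move=> Ucl Vcl UVc cc [hU hUP] [hV hVP].
have [k kP] : exists k, forall x, U x -> V x -> hU x = hV x + k.
  have [[x0 [Ux0 Vx0]]|noUV] := pselect (exists x, U x /\ V x); last first.
    by exists 0 => x Ux Vx; case: noUV; exists x.
  exists (hU x0 - hV x0) => x Ux Vx.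
  have : locally_constant (U `&` V) (fun x => hU x - hV x).
    move=> y [Uy Vy]; have [N1 N1y p1] := hUP y Uy; have [N2 N2y p2] := hVP y Vy.
    near=> z => -[Uz Vz].
    have e1 : hU z - hU y = c y z.
      by apply: p1; split => //; [exact: nbhs_singleton|near: z].
    have e2 : hV z - hV y = c y z.
      by apply: p2; split => //; [exact: nbhs_singleton|near: z].
    have -> : hU z = c y z + hU y by rewrite -e1 subrK.
    have -> : hV z = c y z + hV y by rewrite -e2 subrK.
    by rewrite opprD addrACA subrr add0r.
  move=> /UVc /(_ x0 x) /(_ (conj Ux0 Vx0) (conj Ux Vx)) ->.
  by rewrite addrC subrK.
exists (fun x => if `[< U x >] then hU x else hV x + k).
set h := fun x => _.
have hUE x : U x -> h x = hU x by move=> Ux; rewrite /h asboolT.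
have hVE x : V x -> h x = hV x + k.
  by move=> Vx; rewrite /h; case: asboolP => // Ux; exact: kP.
have hU1 x y : U x -> U y -> h y - h x = hU y - hU x.
  by move=> *; rewrite !hUE.
have hV1 x y : V x -> V y -> h y - h x = hV y - hV x.
  by move=> *; rewrite !hVE // opprD addrACA subrr addr0.
move=> x UVx; have [N Nx cN] := cc x UVx.
have Hx (W : set X) hW : W `<=` U `|` V -> local_primitive W c hW ->
   (forall a b, W a -> W b -> h b - h a = hW b - hW a) -> W x ->
   \forall y \near x, W y -> h y - h x = c x y.
  move=> WUV hWP hWh Wx; have [M Mx cM] := hWP x Wx.
  near=> y => Wy; rewrite hWh // cM //; split => //; first exact: nbhs_singleton.
  by near: y.
suff : \forall y \near x, (U `|` V) y -> h y - h x = c x y.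
  move=> H; exists (N `&` [set y | (U `|` V) y -> h y - h x = c x y]).
    exact: filterI.
  move=> a b [[Na ha] UVa] [[Nb hb] UVb].
  have Nxx := nbhs_singleton Nx.
  have <- := cN a x b (conj Na UVa) (conj Nxx UVx) (conj Nb UVb).
  rewrite (additive_onC cN (conj Nxx UVx) (conj Na UVa)) -(ha UVa) -(hb UVb).
  by rewrite opprB [RHS]addrC addrA subrK.
case: UVx => [Ux|Vx].
- have HU := Hx _ _ (@subsetUl _ U V) hUP hU1 Ux.
  have [Vx|nVx] := pselect (V x).
    have HV := Hx _ _ (@subsetUr _ U V) hVP hV1 Vx.
    by near=> y => -[Uy|Vy]; [apply: (near HU y)|apply: (near HV y)].
  have nV := Vcl x Ux nVx.
  near=> y => -[Uy|Vy]; first by apply: (near HU y).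
  by case: (near nV y _ Vy).
- have HV := Hx _ _ (@subsetUr _ U V) hVP hV1 Vx.
  have [Ux|nUx] := pselect (U x).
    have HU := Hx _ _ (@subsetUl _ U V) hUP hU1 Ux.
    by near=> y => -[Uy|Vy]; [apply: (near HU y)|apply: (near HV y)].
  have nU := Ucl x Vx nUx.
  near=> y => -[Uy|Vy]; last by apply: (near HV y).
  by case: (near nU y _ Uy).
Unshelve. all: by end_near. Qed.

Lemma H1_trivialU (X : topologicalType) (U V : set X) :
  (forall x, V x -> ~ U x -> \forall y \near x, ~ U y) ->
  (forall x, U x -> ~ V x -> \forall y \near x, ~ V y) ->
  H0_trivial (U `&` V) -> H1_trivial U -> H1_trivial V -> H1_trivial (U `|` V).
Proof.
move=> Ucl Vcl UVc aU aV A c cc; apply: local_primitiveU => //.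
  exact: aU (local_cocycleS (@subsetUl _ U V) cc).
exact: aV (local_cocycleS (@subsetUr _ U V) cc).
Qed.

Section Retract.
Context (X X' : topologicalType) (Y : set X) (Z : set X') (f : X -> X') (g : X' -> X).
Hypotheses (fc : forall x, Y x -> f @ within Y (nbhs x) --> f x)
  (gc : forall x, Z x -> g @ within Z (nbhs x) --> g x)
  (fYZ : forall x, Y x -> Z (f x)) (gZY : forall x, Z x -> Y (g x))
  (fK : forall x, Y x -> g (f x) = x).

Lemma H0_retract : H0_trivial Z -> H0_trivial Y.
Proof.
move=> Zc A h hY x y Yx Yy; rewrite -(fK Yx) -(fK Yy).
apply: (Zc A (h \o g)); [|exact: fYZ..].
move=> z Zz; have := gc Zz (hY _ (gZY Zz)); rewrite nbhs_filterE /= => H.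
rewrite !near_simpl in H.
near=> w => Zw /=; have : (fun y => Y y -> h y = h (g z)) (g w).
  by move: Zw; near: w; exact: H.
by apply; exact: gZY.
Unshelve. all: by end_near. Qed.

(** The cocycle is pulled back along [g] and its primitive along [f]. *)
Lemma H1_retract : H1_trivial Z -> H1_trivial Y.
Proof.
move=> Za A c cc.
have [h hP] : exists h, local_primitive Z (fun a b => c (g a) (g b)) h.
  apply: Za => z Zz; have [U Uz cU] := cc _ (gZY Zz).
  exists [set w | Z w -> U (g w)]; first exact: gc Zz _ Uz.
  move=> a b d [Ua Za] [Ub Zb] [Ud Zd]; apply: cU;
    by split; [auto|exact: gZY].
exists (h \o f) => x Yx; have [U Uz hU] := hP _ (fYZ Yx).
exists [set w | Y w -> U (f w)]; first exact: fc Yx _ Uz.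
move=> a b [Ua Ya] [Ub Yb] /=; rewrite hU ?fK //; split; auto.
Qed.

End Retract.

End AlexanderSpanier.

(** * Convex sets *)

(** Connectedness of the unit interval as an induction principle: the
    supremum of the initial segment of points satisfying [S] is 1. *)
Lemma real_induction (R : realType) (S : R -> Prop) : S 0 ->
  (forall t, 0 <= t <= 1 -> exists2 d, 0 < d & forall s s',
     0 <= s <= 1 -> 0 <= s' <= 1 -> `|t - s| < d -> `|t - s'| < d -> S s -> S s') ->
  S 1.
Proof.
move=> S0 Sloc; pose A := [set t : R | 0 <= t <= 1 /\ S t].
have A0 : A 0 by split; rewrite // lexx ler01.
have Aub : ubound A 1 by move=> t [/andP[]].
have supA : has_sup A by split; [exists 0|exists 1].
have m01 : 0 <= sup A <= 1.
  by rewrite (ub_le_sup (proj2 supA)) //= (ge_sup (proj1 supA)).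
have [d d0 dP] := Sloc _ m01.
have [s [s01 Ss] ms] := sup_adherent d0 supA.
have sm : s <= sup A by apply: (ub_le_sup (proj2 supA)); split.
pose u := Num.min (sup A + d / 2) 1.
have u01 : 0 <= u <= 1.
  by move: m01 => /andP[? ?]; rewrite /u le_min ge_min lexx orbT ler01 !andbT; lra.
have mu : sup A <= u by rewrite /u le_min; move: m01 => /andP[? ->]; rewrite andbT; lra.
have Su : S u.
  apply: dP Ss => //; first by rewrite ger0_norm; lra.
  have : u <= sup A + d / 2 by rewrite /u ge_min lexx.
  by rewrite ler0_norm ?subr_le0 //; lra.
have : u <= sup A by apply: (ub_le_sup (proj2 supA)); split.
rewrite {1}/u ge_min => /orP[|m1]; first by lra.
by have -> : 1 = u by move: m01 u01 => /andP[? ?] /andP[? ?]; lra.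
Qed.

Lemma seg_minmax (R : realType) (x y s : R) : 0 <= s <= 1 ->
  Num.min x y <= x + s * (y - x) <= Num.max x y.
Proof.
move=> /andP[s0 s1]; have [xy|yx] := leP x y; apply/andP; split; nra.
Qed.

Section Convex.
Context (R : realType).

Definition convexS (V : lmodType R) (C : set V) :=
  forall x y (t : R), C x -> C y -> 0 <= t <= 1 -> C (x + t *: (y - x)).

Context (X : normedModType R).
Implicit Types (C : set X).

Lemma nbhs_norm_lt (x : X) (r : R) : 0 < r -> nbhs x [set y | `|x - y| < r].
Proof. by move=> r0; apply/nbhs_normP; exists r. Qed.

Lemma near_seg (x0 x : X) (t : R) :
  (fun p : R * X => x0 + p.1 *: (p.2 - x0)) @ (t, x) --> x0 + t *: (x - x0).
Proof.
apply: cvgD; first exact: cvg_cst.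
apply: cvgZ; first exact: cvg_fst.
by apply: cvgB; [exact: cvg_snd|exact: cvg_cst].
Qed.

Lemma near_seg1 (x0 x : X) (t : R) :
  (fun s : R => x0 + s *: (x - x0)) @ t --> x0 + t *: (x - x0).
Proof.
apply: cvgD; first exact: cvg_cst.
by apply: cvgZr_tmp; exact: cvg_id.
Qed.

Lemma convex_H0_trivial C : convexS C -> H0_trivial C.
Proof.
move=> Cc A h hC x y Cx Cy.
suff : h (x + 1 *: (y - x)) = h x by rewrite scale1r addrC subrK => ->.
apply: (real_induction (S := fun t => h (x + t *: (y - x)) = h x)).
  by rewrite scale0r addr0.
move=> t t01; have Ct : C (x + t *: (y - x)) by exact: Cc.
have := near_seg1 (hC _ Ct) => /nbhs_normP[d /= d0 dP]; exists d => //.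
move=> s s' s01 s'01 ts ts' <-.
by rewrite (dP s) ?(dP s') //; apply: Cc.
Qed.

Definition unit_interval : set R := [set t : R | 0 <= t <= 1].

Lemma interval_H0_trivial (t d : R) :
  H0_trivial ([set s : R | 0 <= s <= 1] `&` [set s : R | `|t - s| < d]).
Proof.
move=> A h hI x y [/= x01 xt] [/= y01 yt].
suff : h (x + 1 * (y - x)) = h x by rewrite mul1r addrC subrK => ->.
have I s : 0 <= s <= 1 -> ([set s : R | 0 <= s <= 1] `&` [set s : R | `|t - s| < d]) (x + s * (y - x)).
  move=> s01; have /andP[m M] := seg_minmax x y s01; split => /=.
    move: x01 y01 => /andP[x0 x1] /andP[y0 y1]; apply/andP; split.
      by apply: le_trans m; rewrite le_min x0.
    by apply: le_trans M _; rewrite ge_max x1.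
  rewrite ltr_distlC; move: xt yt; rewrite !ltr_distlC => /andP[x0 x1] /andP[y0 y1]; apply/andP; split.
    by apply: lt_le_trans m; rewrite lt_min x0.
  by apply: le_lt_trans M _; rewrite gt_max x1.
apply: (real_induction (S := fun t => h (x + t * (y - x)) = h x)).
  by rewrite mul0r addr0.
move=> u u01.
have : (fun s : R => x + s * (y - x)) @ u --> x + u * (y - x).
  by apply: cvgD; [exact: cvg_cst|apply: cvgM; [exact: cvg_id|exact: cvg_cst]].
move=> /(_ _ (hI _ (I _ u01))) /nbhs_normP[e /= e0 eP]; exists e => //.
by move=> s s' s01 s'01 us us' <-; rewrite (eP s) ?(eP s') //; apply: I.
Qed.

Lemma interval_primitive (A : zmodType) (c : R -> R -> A) :
  local_cocycle unit_interval c -> exists h, local_primitive unit_interval c h.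
Proof.
move=> cc.
apply: (real_induction (S := fun t : R =>
  exists h, local_primitive [set s : R | 0 <= s <= t] c h)).
  exists (fun=> 0) => x /= x0; exists setT; first exact: filterT.
  move=> a b [_ /= a0] [_ /= b0].
  have -> : a = 0 by apply/eqP; rewrite eq_le andbC.
  have -> : b = 0 by apply/eqP; rewrite eq_le andbC.
  have I0 : unit_interval 0 by rewrite /unit_interval /= lexx ler01.
  have [U U0 cU] := cc 0 I0.
  rewrite subr0 (additive_onxx cU) //; split=> //; exact: nbhs_singleton.
move=> t t01; have [N /nbhs_normP[d /= d0 dN] cN] := cc t t01; exists d => //.
move=> s s' s01 s'01 ts ts' [h hP].
have [s's|ss'] := leP s' s.
  exists h; apply: local_primitiveS hP => x /= /andP[-> xs'] /=.
  exact: le_trans s's.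
have -> : [set x : R | 0 <= x <= s'] = [set x | 0 <= x <= s] `|` [set x | s <= x <= s'].
  move: s01 s'01 => /andP[s0 s1] /andP[s'0 s'1].
  apply/seteqP; split => x /=; last by case=> /andP[? ?]; apply/andP; split; lra.
  by move=> /andP[x0 xs']; have [?|?] := leP x s; [left|right]; apply/andP; split; lra.
apply: local_primitiveU.
- move=> x /= /andP[sx xs'] /negP; rewrite negb_and -!ltNge => /orP[x0|{}sx].
    by move: s01 => /andP[? ?]; lra.
  near=> y; apply/negP; rewrite negb_and -!ltNge; apply/orP; right.
  by near: y; exact: lt_nbhsr.
- move=> x /= /andP[sx xs'] /negP; rewrite negb_and -!ltNge => /orP[x0|{}sx].
    near=> y; apply/negP; rewrite negb_and -!ltNge; apply/orP; left.
    by near: y; exact: lt_nbhsl.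
  by lra.
- move=> B f _ x y /= [/andP[? ?] /andP[? ?]] [/andP[? ?] /andP[? ?]].
  by have -> : x = y by lra.
- apply: local_cocycleS cc => x /=; rewrite /unit_interval /=.
  by move: s01 s'01 => /andP[? ?] /andP[? ?] [] /andP[? ?]; apply/andP; split; lra.
- by exists h.
- exists (c t) => x /= xs; exists setT; first exact: filterT.
  have H y : s <= y <= s' -> (N `&` unit_interval) y.
    move: s01 s'01 => /andP[? ?] /andP[? ?] /andP[? ?].
    split; last by rewrite /unit_interval /=; apply/andP; split; lra.
    apply: dN => /=; move: ts ts'; rewrite !ltr_norml => /andP[? ?] /andP[? ?].
    by apply/andP; split; lra.
  have Ht : (N `&` unit_interval) t by split=> //; apply: dN; rewrite /= subrr normr0.
  move=> a b [_ /= /H Ha] [_ /= /H Hb].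
  by rewrite -(cN t a b) // addrC addKr.
Unshelve. all: by end_near. Qed.

(** The value of the primitive at [y] is the integral of the cocycle along the
    segment from a base point [x0] to [y].  That the integrals along two
    neighbouring segments differ by the cocycle is proved by real induction
    along the segments. *)
Lemma convex_H1_trivial C : convexS C -> H1_trivial C.
Proof.
move=> Cc A c cc; have [[x0 Cx0]|C0] := pselect (C !=set0); last first.
  by exists (fun=> 0) => x Cx; case: C0; exists x.
pose g y (t : R) := x0 + t *: (y - x0).
have gC y t : C y -> 0 <= t <= 1 -> C (g y t) by move=> *; exact: Cc.
have [k kP] : exists k, forall y, C y ->
    local_primitive unit_interval (fun s t => c (g y s) (g y t)) (k y).
  suff H y : exists ky, C y -> local_primitive unit_interval (fun s t => c (g y s) (g y t)) ky.
    by have [k kP] := choice H; exists k.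
  have [Cy|nCy] := pselect (C y); last by exists (fun=> 0).
  have [|ky kyP] := interval_primitive (c := fun s t => c (g y s) (g y t)); last by exists ky.
  move=> t t01; have [U Ut cU] := cc _ (gC _ _ Cy t01).
  exists [set s | U (g y s)]; first exact: (near_seg1 Ut).
  by move=> a b d [Ua a01] [Ub b01] [Ud d01]; apply: cU; split=> //; exact: gC.
exists (fun y => k y 1 - k y 0) => x Cx.
suff [r r0 rP] : exists2 r : R, 0 < r & forall y y', C y -> C y' ->
    `|x - y| < r -> `|x - y'| < r ->
    (k y' 1 - k y' 0) - (k y 1 - k y 0) = c (g y 1) (g y' 1).
  exists [set y | `|x - y| < r]; first by apply/nbhs_normP; exists r.
  move=> y y' [/= xy Cy] [/= xy' Cy']; rewrite rP //.
  by rewrite /g !scale1r ![x0 + _]addrC !subrK.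
apply: (real_induction (S := fun t : R => exists2 r : R, 0 < r & forall y y', C y -> C y' ->
    `|x - y| < r -> `|x - y'| < r ->
    (k y' t - k y' 0) - (k y t - k y 0) = c (g y t) (g y' t))).
  exists 1 => // y y' _ _ _ _; rewrite !subrr /g !scale0r addr0.
  have [U Ux cU] := cc x0 Cx0; rewrite (additive_onxx cU) //; split=> //.
  exact: nbhs_singleton.
move=> t t01; have [N Nt cN] := cc _ (gC _ _ Cx t01).
have [d d0 dP] : exists2 d : R, 0 < d & forall s y, `|t - s| < d -> `|x - y| < d -> N (g y s).
  have /nbhs_normP[d /= d0 dP] := near_seg Nt.
  exists d => // s y ts xy; apply: (dP (s, y)) => /=.
  by rewrite prod_normE /= gt_max ts.
exists d => // s s' s01 s'01 ts ts' [r r0 rP]; exists (Num.min r d).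
  by rewrite lt_min r0.
move=> y y' Cy Cy'; rewrite !lt_min => /andP[yr yd] /andP[y'r y'd].
have along z : C z -> `|x - z| < d -> k z s' - k z s = c (g z s) (g z s').
  move=> Cz xz.
  have H u : 0 <= u <= 1 -> `|t - u| < d -> (N `&` C) (g z u).
    by move=> u01 tu; split; [exact: dP|exact: gC].
  have /(_ A (fun u => k z u - c (g z s) (g z u))) := @interval_H0_trivial t d.
  move=> /(_ _ s' s (conj s'01 ts') (conj s01 ts)) E.
  have Hs := H _ s01 ts.
  apply/eqP; rewrite subr_eq addrC -subr_eq E ?(additive_onxx cN Hs) ?subr0 //.
  move=> u [/= u01 tu]; have [U Uu kU] := kP _ Cz u u01.
  near=> w => -[/= w01 tw].
  have <- := cN (g z s) (g z u) (g z w) Hs (H _ u01 tu) (H _ w01 tw).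
  have <- : k z w - k z u = c (g z u) (g z w).
    by apply: kU; split=> //; [exact: nbhs_singleton|near: w].
  by rewrite opprD [- c _ _ + _]addrC addrA opprB [k z w + _]addrC subrK.
have Hs z : C z -> `|x - z| < d -> (N `&` C) (g z s).
  by move=> Cz xz; split; [exact: dP|exact: gC].
have Hs' z : C z -> `|x - z| < d -> (N `&` C) (g z s').
  by move=> Cz xz; split; [exact: dP|exact: gC].
have E1 := along _ Cy yd; have E2 := along _ Cy' y'd.
have E3 := rP _ _ Cy Cy' yr y'r.
rewrite -(cN _ _ _ (Hs' _ Cy yd) (Hs _ Cy yd) (Hs' _ Cy' y'd)).
rewrite -(cN _ _ _ (Hs _ Cy yd) (Hs _ Cy' y'd) (Hs' _ Cy' y'd)).
rewrite (additive_onC cN (Hs _ Cy yd) (Hs' _ Cy yd)) -E1 -E2 -E3.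
rewrite -[k y' s'](subrK (k y' s)) -[k y s'](subrK (k y s)) !addrK.
rewrite -(addrA _ (k y' s)) -(addrA _ (k y s)) opprD addrACA [RHS]addrCA [RHS]addrC.
by rewrite [- (k y s' - k y s) + _]addrC.
Unshelve. all: by end_near. Qed.
End Convex.

(** * Removing finitely many points *)

Section Punctured.
Context (R : realType).
Notation X := 'rV[R]_3.
Implicit Types (C D K Y : set X) (q x y : X).

Definition half (k : 'I_3) (s : R) (b : bool) : set X :=
  [set x | if b then s <= x 0 k else x 0 k <= s].

Definition plane (k : 'I_3) (s : R) : set X := [set x | x 0 k = s].

Lemma ord3 (k : 'I_3) : [\/ k = 0, k = 1 | k = 2].
Proof. by case: k => -[|[|[|]]] // i; [constructor 1|constructor 2|constructor 3]; apply/val_inj. Qed.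

Lemma coord_cvg (k : 'I_3) x : (fun y : X => y 0 k) @ x --> x 0 k.
Proof. exact: coord_continuous. Qed.

Lemma halfC_open k s b x : ~ half k s b x -> \forall y \near x, ~ half k s b y.
Proof.
case: b => /= /negP; rewrite -ltNge => xs.
  have : nbhs x [set y : X | y 0 k < s] by exact: (@coord_cvg k x _ (lt_nbhsl xs)).
  by apply: filterS => y ys; apply/negP; rewrite -ltNge.
have : nbhs x [set y : X | s < y 0 k] by exact: (@coord_cvg k x _ (lt_nbhsr xs)).
by apply: filterS => y ys; apply/negP; rewrite -ltNge.
Qed.

Lemma segE x y t k : (x + t *: (y - x)) 0 k = x 0 k + t * (y 0 k - x 0 k).
Proof. by rewrite !mxE. Qed.

Lemma convex_half k s b : convexS (half k s b).
Proof.
move=> x y t; rewrite /half /= segE => xs ys /(seg_minmax (x 0 k) (y 0 k)) /andP[m M].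
by case: b xs ys => xs ys; [apply: le_trans m; rewrite le_min xs|apply: le_trans M _; rewrite ge_max xs].
Qed.

Lemma convex_plane k s : convexS (plane k s).
Proof. by move=> x y t /= xs ys _; rewrite /plane /= segE xs ys subrr mulr0 addr0. Qed.

Lemma convexI (V : lmodType R) (C D : set V) : convexS C -> convexS D -> convexS (C `&` D).
Proof. by move=> cC cD x y t [? ?] [? ?] t01; split; [exact: cC|exact: cD]. Qed.

Lemma half_cover Y k s : Y = (Y `&` half k s true) `|` (Y `&` half k s false).
Proof.
rewrite -setIUr; apply/seteqP; split => x; last by case.
by move=> Yx; split=> //=; have [xs|/ltW xs] := leP s (x 0 k); [left|right].
Qed.

Lemma half_meet Y k s :
  (Y `&` half k s true) `&` (Y `&` half k s false) = Y `&` plane k s.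
Proof.
apply/seteqP; split => x /=.
  move=> [[Yx s1] [_ s2]]; split=> //; rewrite /plane /=; apply/eqP; rewrite eq_le.
  by apply/andP; split.
by move=> [Yx xs]; rewrite /half /= xs.
Qed.

Lemma H1_split Y k s : H1_trivial (Y `&` half k s true) ->
  H1_trivial (Y `&` half k s false) -> H0_trivial (Y `&` plane k s) -> H1_trivial Y.
Proof.
move=> Ht Hf H0; rewrite (half_cover Y k s); apply: H1_trivialU => //.
- move=> x [Yx _] nx; have : ~ half k s true x by move=> ?; apply: nx.
  by move=> /halfC_open; apply: filterS => y ny [].
- move=> x [Yx _] nx; have : ~ half k s false x by move=> ?; apply: nx.
  by move=> /halfC_open; apply: filterS => y ny [].
- by rewrite half_meet.
Qed.

Lemma H0_split Y k s x0 : Y x0 -> plane k s x0 -> H0_trivial (Y `&` half k s true) ->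
  H0_trivial (Y `&` half k s false) -> H0_trivial Y.
Proof.
move=> Yx px Ht Hf; rewrite (half_cover Y k s).
by apply: (H0_trivialU (x0 := x0)) => //; split=> //; rewrite /half /= px.
Qed.

(** Under the hypothesis on the coordinates [q] is an extreme point. *)
Lemma pointed_convex C q : convexS C ->
  (forall k, C `<=` half k (q 0 k) true \/ C `<=` half k (q 0 k) false) ->
  convexS (C `&` [set x | x <> q]).
Proof.
move=> Cc Cq x y t [Cx /= xq] [Cy /= yq] t01; split=> /=; first exact: Cc.
move=> E; have [t0|t0] := eqVneq t 0; first by rewrite t0 scale0r addr0 in E.
apply: xq; apply/rowP => k; have := congr1 (fun z : X => z 0 k) E; rewrite segE => Ek.
have [t1|t1] := eqVneq t 1.
  by case: yq; rewrite -E t1 scale1r addrC subrK.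
have {}t0 : 0 < t by move: t01 => /andP[? _]; rewrite lt_def t0.
have {}t1 : t < 1 by move: t01 => /andP[_ ?]; rewrite lt_def eq_sym t1.
move: Ek; set a := x 0 k; set b := y 0 k; set d := q 0 k => Ek.
by case: (Cq k) => Cqk; have := Cqk _ Cx; have := Cqk _ Cy; rewrite /half /= -/a -/b -/d; nra.
Qed.

Section OnePoint.
Context (C : set X) (q : X).
Hypotheses (Cc : convexS C) (Cq : nbhs q C).

Let D := C `&` [set x | x <> q].
Let h k b := half k (q 0 k) b.
Let pl k := plane k (q 0 k).

Let onesided K := convexS K /\ forall k, K `<=` h k true \/ K `<=` h k false.

Let onesidedD K : onesided K -> convexS (D `&` K).
Proof.
move=> [Kc Ko]; rewrite /D -setIA [X in C `&` X]setIC setIA.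
apply: pointed_convex; first exact: convexI.
by move=> k; case: (Ko k) => S; [left|right] => x [_ /S].
Qed.

Let onesidedD3 K0 K1 K2 : onesided (K0 `&` K1 `&` K2) -> convexS (D `&` K0 `&` K1 `&` K2).
Proof. by rewrite -(setIA D K0) -(setIA D); exact: onesidedD. Qed.

Let hK k b K : K `<=` h k b -> K `<=` h k true \/ K `<=` h k false.
Proof. by case: b; [left|right]. Qed.

Let plh k : pl k `<=` h k true.
Proof. by move=> x; rewrite /pl /h /plane /half /= => ->. Qed.

Let axis : exists a : 'I_3 -> bool -> X, forall k b,
  [/\ D (a k b), h k b (a k b) & forall j, j != k -> pl j (a k b)].
Proof.
move/nbhs_normP: Cq => [e /= e0 eC].
exists (fun k b => q + (if b then e / 2 else - (e / 2)) *: delta_mx 0 k) => k b.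
have co j : (q + (if b then e / 2 else - (e / 2)) *: delta_mx 0 k) 0 j =
    q 0 j + (if b then e / 2 else - (e / 2)) * (j == k)%:R by rewrite !mxE.
split.
- split; first last.
    move=> /(congr1 (fun z : X => z 0 k)); rewrite co eqxx mulr1.
    by case: b {co} => ?; lra.
  apply: eC => /=; rewrite opprD addNKr normrN normrZ.
  have -> : `|delta_mx 0 k : X| = 1.
    apply/eqP; rewrite eq_le; apply/andP; split.
      rewrite [leLHS]mx_normrE; apply/bigmax_leP; split=> // -[i j] _ /=.
      by rewrite mxE; case: (_ && _); rewrite ?normr1 ?normr0.
    rewrite [leRHS]mx_normrE; apply: le_trans (le_bigmax _ _ (0, k)) => /=.
    by rewrite mxE !eqxx normr1.
  by rewrite mulr1; case: b {co}; rewrite ?normrN ger0_norm; lra.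
- by rewrite /h /half /= co eqxx mulr1; case: b {co}; lra.
- by move=> j /negbTE jk; rewrite /pl /plane /= co jk mulr0 addr0.
Qed.

Let k0 : 'I_3 := 0.
Let k1 : 'I_3 := 1.
Let k2 : 'I_3 := 2.

Let onesided_octant K b0 b1 b2 : convexS K -> K `<=` h k0 b0 -> K `<=` h k1 b1 -> K `<=` h k2 b2 -> onesided K.
Proof.
move=> Kc K0 K1 K2; split=> // k.
by case: (ord3 k) => ->; [exact: hK K0|exact: hK K1|exact: hK K2].
Qed.

(** The eight closed octants with apex [q] are convex and stay so without their
    apex.  They are glued one coordinate at a time; the pieces meet along
    quadrants and rays, which are not empty since [q] is an interior point. *)
Lemma punctured1 : H0_trivial D /\ H1_trivial D.
Proof.
have [a aP] := axis.
have cH k b : convexS (h k b) by exact: convex_half.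
have cP k : convexS (pl k) by exact: convex_plane.
have l3 b0 b1 b2 : convexS (D `&` h k0 b0 `&` h k1 b1 `&` h k2 b2).
  apply: onesidedD3; apply: (@onesided_octant _ b0 b1 b2); last by move=> x [_].
  - by do !apply: convexI.
  - by move=> x [[]].
  - by move=> x [[]].
have l3p b0 b1 : convexS (D `&` h k0 b0 `&` h k1 b1 `&` pl k2).
  apply: onesidedD3; apply: (@onesided_octant _ b0 b1 true); last by move=> x [_ /plh].
  - by do !apply: convexI.
  - by move=> x [[]].
  - by move=> x [[]].
have l3q b0 b2 : convexS (D `&` h k0 b0 `&` pl k1 `&` h k2 b2).
  apply: onesidedD3; apply: (@onesided_octant _ b0 true b2); last by move=> x [_].
  - by do !apply: convexI.
  - by move=> x [[]].
  - by move=> x [[_ /plh]].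
have l3r b1 b2 : convexS (D `&` pl k0 `&` h k1 b1 `&` h k2 b2).
  apply: onesidedD3; apply: (@onesided_octant _ true b1 b2); last by move=> x [_].
  - by do !apply: convexI.
  - by move=> x [[/plh]].
  - by move=> x [[]].
have a0 b : [/\ D (a k0 b), h k0 b (a k0 b), pl k1 (a k0 b) & pl k2 (a k0 b)].
  by have [? ? p] := aP k0 b; split=> //; apply: p.
have a1 b : [/\ D (a k1 b), h k1 b (a k1 b), pl k0 (a k1 b) & pl k2 (a k1 b)].
  by have [? ? p] := aP k1 b; split=> //; apply: p.
have a2 b : [/\ D (a k2 b), h k2 b (a k2 b), pl k0 (a k2 b) & pl k1 (a k2 b)].
  by have [? ? p] := aP k2 b; split=> //; apply: p.
have plhb k b x : pl k x -> h k b x by rewrite /pl /h /plane /half /= => ->; case: b.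
have l2 b0 b1 : H0_trivial (D `&` h k0 b0 `&` h k1 b1) /\ H1_trivial (D `&` h k0 b0 `&` h k1 b1).
  split.
    have [? ? p1 p2] := a0 b0.
    apply: (@H0_split _ k2 (q 0 k2) (a k0 b0)) => //; last 2 first.
      + exact: convex_H0_trivial (l3 _ _ true).
      + exact: convex_H0_trivial (l3 _ _ false).
    by split; [split|apply: plhb p1].
  apply: (@H1_split _ k2 (q 0 k2)).
  - exact: convex_H1_trivial (l3 _ _ true).
  - exact: convex_H1_trivial (l3 _ _ false).
  - exact: convex_H0_trivial (l3p _ _).
have l1 b0 : H0_trivial (D `&` h k0 b0) /\ H1_trivial (D `&` h k0 b0).
  have [? ? p1 p2] := a0 b0.
  split.
    by apply: (@H0_split _ k1 (q 0 k1) (a k0 b0)) => //; [exact: (l2 _ true).1|exact: (l2 _ false).1].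
  apply: (@H1_split _ k1 (q 0 k1)); [exact: (l2 _ true).2|exact: (l2 _ false).2|].
  apply: (@H0_split _ k2 (q 0 k2) (a k0 b0)) => //.
  - exact: convex_H0_trivial (l3q _ true).
  - exact: convex_H0_trivial (l3q _ false).
split.
  have [? ? p0 p2] := a1 true.
  by apply: (@H0_split _ k0 (q 0 k0) (a k1 true)) => //; [exact: (l1 true).1|exact: (l1 false).1].
apply: (@H1_split _ k0 (q 0 k0)); [exact: (l1 true).2|exact: (l1 false).2|].
have l1p b1 : H0_trivial (D `&` pl k0 `&` h k1 b1).
  have [? ? p0 p2] := a1 b1.
  apply: (@H0_split _ k2 (q 0 k2) (a k1 b1)) => //.
  - exact: convex_H0_trivial (l3r _ true).
  - exact: convex_H0_trivial (l3r _ false).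
have [? ? p0 p1] := a2 true.
by apply: (@H0_split _ k1 (q 0 k1) (a k2 true)) => //; exact: l1p.
Qed.

End OnePoint.

Lemma avoid (a b : R) (s : seq R) : a < b -> exists2 v, a < v < b & v \notin s.
Proof.
suff H : a < b -> exists c, a < c <= b /\ forall v, a < v < c -> v \notin s.
  move=> /H [c [/andP[ac cb] cP]]; exists ((a + c) / 2); last by apply: cP; lra.
  by lra.
elim: s => [|u s IH] ab; first by exists b; rewrite ab lexx.
have [c [/andP[ac cb] cP]] := IH ab.
have [/andP[au uc]|nu] := boolP (a < u < c).
  exists u; split; first by rewrite au /=; lra.
  by move=> v /andP[av vu]; rewrite inE negb_or cP ?andbT ?lt_eqF // av (lt_trans vu).
exists c; split; first by rewrite ac.
move=> v vac; rewrite inE negb_or cP // andbT.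
by apply: contraNneq nu => <-.
Qed.

(** A plane that separates two of the points and contains none cuts the set into
    two convex sets with fewer points to remove. *)
Lemma punctured_convex (s : seq X) C : convexS C -> (forall q, q \in s -> nbhs q C) ->
  H0_trivial (C `&` [set x | x \notin s]) /\ H1_trivial (C `&` [set x | x \notin s]).
Proof.
move: {-1}(size s) (leqnn (size s)) => m; elim: m s C => [|m IH] s C sm Cc Cs.
  have -> : C `&` [set x | x \notin s] = C.
    by move: sm; rewrite leqn0 => /eqP/size0nil ->; apply/seteqP; split => x; [case|split].
  by split; [exact: convex_H0_trivial|exact: convex_H1_trivial].
case: s sm Cs => [|q s] sm Cs; first by apply: IH.
have [/allP sq|] := boolP (all (pred1 q) s).
  have -> : [set x | x \notin q :: s] = [set x | x <> q].
    apply/seteqP; split => x /=; first by rewrite inE negb_or => /andP[/eqP].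
    move=> xq; rewrite inE negb_or; apply/andP; split; first exact/eqP.
    by apply/negP => /sq /eqP.
  by apply: punctured1 => //; apply: Cs; rewrite mem_head.
rewrite -has_predC => /hasP[q' q's /= q'q].
have q'in : q' \in q :: s by rewrite inE q's orbT.
have qin : q \in q :: s by rewrite mem_head.
have [k kq] : exists k, q' 0 k != q 0 k.
  by apply/existsP; apply: contra_neqT q'q => /existsPn H; apply/rowP => k; exact/eqP/negPn/H.
move: q q' {s sm q's q'q} (q :: s) sm Cs q'in qin kq => q q' s sm Cs q'in qin.
wlog: q q' q'in qin / q' 0 k < q 0 k.
  move=> W kq; move: (kq); rewrite neq_lt => /orP[lt|lt]; first exact: W lt kq.
  by apply: (W q' q) => //; rewrite eq_sym.
move=> lt _; have [v /andP[q'v vq] vs] := avoid [seq x 0 k | x : X <- s] lt.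
pose sb b := [seq x : X <- s | if b then v <= x 0 k else x 0 k <= v].
have sbE : forall b', (C `&` [set x | x \notin s]) `&` half k v b' =
     (C `&` half k v b') `&` [set x | x \notin sb b'].
  move=> b'; apply/seteqP; split => x [[Cx /= xs] xh].
    by split; [split|rewrite /= mem_filter negb_and xs orbT].
  split=> //; split=> //=; apply: contra xh => xin.
  by rewrite /sb mem_filter xin andbT.
have good : forall b', H0_trivial ((C `&` [set x | x \notin s]) `&` half k v b') /\
   H1_trivial ((C `&` [set x | x \notin s]) `&` half k v b').
  move=> b'; rewrite sbE; apply: IH.
  - rewrite -ltnS; apply: leq_trans sm; rewrite /sb size_filter -(count_predC (fun x : X => if b' then v <= x 0 k else x 0 k <= v)).
    rewrite -[X in (X < _)%N]addn0 ltn_add2l -has_count; apply/hasP.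
    by case: b'; [exists q'|exists q] => //=; rewrite -ltNge.
  - by apply: convexI => //; exact: convex_half.
  - move=> x; rewrite mem_filter => /andP[xb xs]; apply: filterI; first exact: Cs.
    have xv : x 0 k != v by apply: contraNneq vs => <-; apply/mapP; exists x.
    case: b' xb => xb.
      have {}xb : v < x 0 k by rewrite lt_def xv.
      have : nbhs x [set y : X | v < y 0 k] by exact: (@coord_cvg k x _ (lt_nbhsr xb)).
      by apply: filterS => y /ltW.
    have {}xb : x 0 k < v by rewrite lt_def eq_sym xv.
    have : nbhs x [set y : X | y 0 k < v] by exact: (@coord_cvg k x _ (lt_nbhsl xb)).
    by apply: filterS => y /ltW.
have plE : (C `&` [set x | x \notin s]) `&` plane k v = C `&` plane k v.
  apply/seteqP; split => x; first by move=> [[]].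
  move=> [Cx xv]; split=> //; split=> //=; apply: contra vs => xs.
  by apply/mapP; exists x.
have [x0 [Cx0 vx0]] : (C `&` plane k v) !=set0.
  exists (q' + ((v - q' 0 k) / (q 0 k - q' 0 k)) *: (q - q')).
  have d0 : 0 < q 0 k - q' 0 k by lra.
  split; last by rewrite /plane /= segE divfK ?gt_eqF // addrC subrK.
  apply: Cc; [exact: nbhs_singleton (Cs _ _)..|].
  by rewrite divr_ge0 ?ler_pdivrMr //; lra.
have [[x0s _] _] : ((C `&` [set x | x \notin s]) `&` plane k v) x0 by rewrite plE.
split.
  apply: (@H0_split _ k v x0) => //; [|exact: (good true).1|exact: (good false).1].
  by have : ((C `&` [set x | x \notin s]) `&` plane k v) x0; [rewrite plE|case].
apply: (@H1_split _ k v); [exact: (good true).2|exact: (good false).2|].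
by rewrite plE; apply: convex_H0_trivial; apply: convexI => //; exact: convex_plane.
Qed.

End Punctured.

(** * Euclidean space and the punctured ball *)

(* The bare name [edist] would denote an extended-real distance. *)
Local Notation edist := Defs.edist.

Section Dot.
Context (R : realType).
Notation X := 'rV[R]_3.
Implicit Types (u v w x y : X).

Lemma dotE u v : dot u v = u 0 0 * v 0 0 + u 0 1 * v 0 1 + u 0 2 * v 0 2.
Proof.
rewrite /dot !big_ord_recl big_ord0 addr0 addrA.
by congr (_ + _ + _); congr (u 0 _ * v 0 _); apply/val_inj.
Qed.

Lemma dotC u v : dot u v = dot v u.
Proof. by rewrite !dotE; ring. Qed.
Lemma dotDl u v w : dot (u + v) w = dot u w + dot v w.
Proof. by rewrite !dotE !mxE; ring. Qed.
Lemma dotDr u v w : dot w (u + v) = dot w u + dot w v.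
Proof. by rewrite !dotE !mxE; ring. Qed.
Lemma dotBl u v w : dot (u - v) w = dot u w - dot v w.
Proof. by rewrite !dotE !mxE; ring. Qed.
Lemma dotBr u v w : dot w (u - v) = dot w u - dot w v.
Proof. by rewrite !dotE !mxE; ring. Qed.
Lemma dotZl a u v : dot (a *: u) v = a * dot u v.
Proof. by rewrite !dotE !mxE; ring. Qed.
Lemma dotZr a u v : dot u (a *: v) = a * dot u v.
Proof. by rewrite !dotE !mxE; ring. Qed.
Lemma dot0l u : dot 0 u = 0.
Proof. by rewrite !dotE !mxE; ring. Qed.
Lemma dot0r u : dot u 0 = 0.
Proof. by rewrite !dotE !mxE; ring. Qed.
Lemma dot_ge0 u : 0 <= dot u u.
Proof. by rewrite dotE !addr_ge0 // -expr2 sqr_ge0. Qed.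

Lemma rV3P u v : u 0 0 = v 0 0 -> u 0 1 = v 0 1 -> u 0 2 = v 0 2 -> u = v.
Proof. by move=> *; apply/rowP => k; case: (ord3 k) => ->. Qed.

Lemma dot_eq0 u : (dot u u == 0) = (u == 0).
Proof.
apply/eqP/eqP => [|->]; last by rewrite dot0l.
rewrite dotE => E; apply: rV3P; rewrite mxE; nra.
Qed.

Lemma dot_gt0 u : (0 < dot u u) = (u != 0).
Proof. by rewrite lt_def dot_ge0 andbT dot_eq0. Qed.

Lemma edist2 x y : edist x y ^+ 2 = dot (x - y) (x - y).
Proof. by rewrite /edist /enorm sqr_sqrtr // dot_ge0. Qed.

Lemma dot_cvg (T : Type) (F : set_system T) (FF : Filter F) (f g : T -> X) u v :
  f @ F --> u -> g @ F --> v -> (fun t => dot (f t) (g t)) @ F --> dot u v.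
Proof.
move=> fu gv; under eq_fun do rewrite dotE; rewrite dotE.
have co (h : T -> X) w k : h @ F --> w -> (fun t => h t 0 k) @ F --> w 0 k.
  by move=> hw; exact: (@cvg_comp _ _ _ h (fun y : X => y 0 k) _ _ _ hw (@coord_cvg R k w)).
by apply: cvgD; [apply: cvgD|]; apply: cvgM; apply: co.
Qed.

Lemma unit_ballE x : @closed_unit_ball R x <-> dot x x <= 1.
Proof.
rewrite /closed_unit_ball /enorm /= -{1}[1]sqrtr1 ler_sqrt //.
Qed.

Lemma dot_seg x y t : dot (x + t *: (y - x)) (x + t *: (y - x)) =
  (1 - t) * dot x x + t * dot y y - t * (1 - t) * dot (x - y) (x - y).
Proof. by rewrite !dotE !mxE; ring. Qed.

(** A point of the sphere is extreme, so the ball stays convex without it; the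
    other points are interior. *)
Lemma ball_punctured (s : seq X) :
  H0_trivial (@closed_unit_ball R `&` [set x | x \notin s]) /\
  H1_trivial (@closed_unit_ball R `&` [set x | x \notin s]).
Proof.
pose s1 := [seq x : X <- s | dot x x == 1]; pose s2 := [seq x : X <- s | dot x x < 1].
pose C := @closed_unit_ball R `&` [set x | x \notin s1].
have -> : @closed_unit_ball R `&` [set x | x \notin s] = C `&` [set x | x \notin s2].
  apply/seteqP; split => x [].
    by move=> Bx /= xs; split; [split=> //=|rewrite /=]; rewrite mem_filter (negbTE xs) andbF.
  move=> [/[dup] Bx /unit_ballE dx /=]; rewrite !mem_filter => x1 x2; split=> //=.
  apply/negP => xs; move: x1 x2; rewrite xs !andbT -leNgt => x1 x2.
  by move/eqP: x1; apply; lra.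
apply: punctured_convex.
  move=> x y t [/unit_ballE Bx /= xs] [/unit_ballE By /= ys] /andP[t0 t1].
  have d0 := dot_ge0 (x - y).
  have n0 : 0 <= t * (1 - t) * dot (x - y) (x - y) by rewrite !mulr_ge0 //; lra.
  split; first by apply/unit_ballE; rewrite dot_seg; nra.
  apply: contra xs; rewrite mem_filter => /andP[/eqP]; rewrite {1}dot_seg => d1 zs.
  have /eqP : t * (1 - t) * dot (x - y) (x - y) = 0 by nra.
  rewrite !mulf_eq0 -orbA => /or3P[/eqP t_0|/eqP t_1|].
  - move: d1 zs; rewrite t_0 scale0r addr0 => d1 zs; rewrite mem_filter zs andbT; apply/eqP; lra.
  - have {}t_1 : t = 1 by lra.
    move: d1 zs; rewrite t_1 scale1r [x + _]addrC subrK => d1 zs.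
    by case/negP: ys; rewrite mem_filter zs andbT; apply/eqP; lra.
  - rewrite dot_eq0 subr_eq0 => /eqP xy; move: d1 zs.
    rewrite xy subrr scaler0 addr0 => d1 zs; rewrite mem_filter zs andbT.
    by apply/eqP; move: d1; rewrite dot0l; lra.
move=> q; rewrite mem_filter => /andP[q1 qs].
have nb : nbhs q [set x : X | dot x x < 1].
  have dc : (fun x : X => dot x x) @ q --> dot q q by exact: (@dot_cvg _ (nbhs q) _ id id q q (@cvg_id _ _) (@cvg_id _ _)).
  exact: (dc _ (lt_nbhsl q1)).
apply: filterS nb => x /= x1; split; first by apply/unit_ballE/ltW.
by rewrite /= mem_filter lt_eqF.
Qed.

Lemma homeomorphic_punctured (P : set X) (s : seq X) :
  homeomorphic P (@closed_unit_ball R) -> (forall q, q \in s -> P q) ->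
  H0_trivial (P `&` [set x | x \notin s]) /\ H1_trivial (P `&` [set x | x \notin s]).
Proof.
move=> [f [g [/subspace_continuousP fc /subspace_continuousP gc fP gB [fK gK]]]] sP.
pose Z := @closed_unit_ball R `&` [set x | x \notin [seq f q | q <- s]].
have {}fK x : P x -> g (f x) = x by move=> Px; apply: fK; exact/mem_set.
have {}gK x : @closed_unit_ball R x -> f (g x) = x by move=> Px; apply: gK; exact/mem_set.
have fZ x : (P `&` [set x | x \notin s]) x -> Z (f x).
  move=> [Px /= xs]; split; first by apply: fP; exists x.
  apply: contra xs => /mapP[q qs E]; have -> // : x = q.
  by rewrite -(fK x) // E fK //; exact: sP.
have gZ z : Z z -> (P `&` [set x | x \notin s]) (g z).
  move=> [Bz /= zs]; split; first by apply: gB; exists z.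
  by apply: contra zs => gs; apply/mapP; exists (g z); rewrite ?gK.
have [H0 H1] := ball_punctured [seq f q | q <- s].
have wi (h : X -> X) (A B : set X) x : B `<=` A -> h @ within A (nbhs x) --> h x ->
    h @ within B (nbhs x) --> h x.
  by move=> BA; apply: cvg_trans; apply: cvg_app; apply: within_subset.
split; [apply: (H0_retract (Z := Z) (f := f) (g := g)) => //|apply: (H1_retract (Z := Z) (f := f) (g := g)) => //].
all: move=> x []; try by [move=> Px _; exact: fK].
all: move=> ? ?.
all: try by [apply: wi (fc _ _) => // ? []|apply: wi (gc _ _) => // ? []].
Qed.

End Dot.

(** * Barycentric coordinates *)

Section Cross.
Context (R : realType).
Notation X := 'rV[R]_3.
Implicit Types (u v w x y : X).

(** Locked, so that the coordinates of a vector are only computed by [coordE]. *)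
Definition cross : X -> X -> X := locked (fun u v : X => \row_k
  (if k == 0 then u 0 1 * v 0 2 - u 0 2 * v 0 1
   else if k == 1 then u 0 2 * v 0 0 - u 0 0 * v 0 2
   else u 0 0 * v 0 1 - u 0 1 * v 0 0)).

Lemma cross0 u v : cross u v 0 0 = u 0 1 * v 0 2 - u 0 2 * v 0 1.
Proof. by rewrite /cross -lock mxE. Qed.
Lemma cross1 u v : cross u v 0 1 = u 0 2 * v 0 0 - u 0 0 * v 0 2.
Proof. by rewrite /cross -lock mxE. Qed.
Lemma cross2 u v : cross u v 0 2 = u 0 0 * v 0 1 - u 0 1 * v 0 0.
Proof. by rewrite /cross -lock mxE. Qed.
Lemma coordD u v k : (u + v) 0 k = u 0 k + v 0 k. Proof. by rewrite mxE. Qed.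
Lemma coordN u k : (- u) 0 k = - u 0 k. Proof. by rewrite mxE. Qed.
Lemma coordZ a u k : (a *: u) 0 k = a * u 0 k. Proof. by rewrite mxE. Qed.
Lemma coord0 k : (0 : X) 0 k = 0. Proof. by rewrite mxE. Qed.
Definition coordE := (coordD, coordN, coordZ, coord0, cross0, cross1, cross2).

Definition det3 u v w : R := dot u (cross v w).

Lemma det3E u v w : det3 u v w =
  u 0 0 * (v 0 1 * w 0 2 - v 0 2 * w 0 1) + u 0 1 * (v 0 2 * w 0 0 - v 0 0 * w 0 2)
  + u 0 2 * (v 0 0 * w 0 1 - v 0 1 * w 0 0).
Proof. by rewrite /det3 dotE !coordE. Qed.

Lemma cramer3 u v w x : det3 u v w *: x =
  det3 x v w *: u + det3 u x w *: v + det3 u v x *: w.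
Proof. by apply: rV3P; rewrite !det3E !coordE; ring. Qed.

(** If the determinant vanishes, Cramer's rule is a linear relation with
    coefficients depending on an arbitrary [x], which must all vanish. *)
Lemma det3_neq0 u v w :
  (forall a b c : R, a *: u + b *: v + c *: w = 0 -> [/\ a = 0, b = 0 & c = 0]) ->
  det3 u v w != 0.
Proof.
move=> indep; apply/eqP => D0.
have H x : det3 x v w = 0.
  by have /esym := cramer3 u v w x; rewrite D0 scale0r => /indep[].
have vw : cross v w = 0 by apply/eqP; rewrite -dot_eq0; apply/eqP/H.
have : 0 *: u + dot w w *: v + (- dot v w) *: w = 0.
  have -> : 0 *: u + dot w w *: v + (- dot v w) *: w = cross w (cross v w).
    by apply: rV3P; rewrite !dotE ?coordE; ring.
  by rewrite vw; apply: rV3P; rewrite !coordE; ring.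
move=> /indep[_ /eqP + _]; rewrite dot_eq0 => /eqP w0.
have : 0 *: u + 0 *: v + 1 *: w = 0 by rewrite !scale0r !add0r scale1r.
by move=> /indep[_ _ /eqP]; rewrite oner_eq0.
Qed.

Lemma dual3 u v w (a b c : R) : det3 u v w != 0 ->
  exists x, [/\ dot x u = a, dot x v = b & dot x w = c].
Proof.
move=> D0; exists ((det3 u v w)^-1 *: (a *: cross v w + b *: cross w u + c *: cross u v)).
by split; apply: (mulfI D0); rewrite dotZl mulrA divff // mul1r !dotDl !dotZl det3E !dotE ?coordE; ring.
Qed.

Lemma dual3_uniq u v w x : det3 u v w != 0 ->
  dot x u = 0 -> dot x v = 0 -> dot x w = 0 -> x = 0.
Proof.
move=> D0 xu xv xw.
have E : det3 u v w *: x = dot x u *: cross v w + dot x v *: cross w u + dot x w *: cross u v.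
  by apply: rV3P; rewrite !det3E !dotE ?coordE; ring.
by apply/eqP; move/eqP: E; rewrite xu xv xw !scale0r !addr0 scaler_eq0 (negbTE D0).
Qed.

Lemma gram_det3 u v w x y z : det3 u v w * det3 x y z =
  dot u x * (dot v y * dot w z - dot v z * dot w y)
  - dot u y * (dot v x * dot w z - dot v z * dot w x)
  + dot u z * (dot v x * dot w y - dot v y * dot w x).
Proof. by rewrite !det3E !dotE; ring. Qed.

End Cross.

Section Simplex.
Context (R : realType) (n : nat).
Notation X := 'rV[R]_3.
Implicit Types (p : 'I_n -> X) (S : {set 'I_n}) (x y : X).

(** An enumeration of a set of four vertices, by membership so that it can be
    permuted freely. *)
Definition quad S i j k l := uniq [:: i; j; k; l] /\ S =i [:: i; j; k; l].

Lemma sum_seq_set (V : nmodType) (S : {set 'I_n}) (s : seq 'I_n) (F : 'I_n -> V) :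
  uniq s -> S =i s -> \sum_(m in S) F m = \sum_(m <- s) F m.
Proof.
move=> us Ss; rewrite -big_enum /=; apply: perm_big.
by apply: uniq_perm; rewrite ?enum_uniq // => m; rewrite mem_enum Ss.
Qed.

Lemma sum_quad (V : nmodType) S i j k l (F : 'I_n -> V) : quad S i j k l ->
  \sum_(m in S) F m = F i + F j + F k + F l.
Proof.
move=> [us Ss]; rewrite (sum_seq_set F us Ss) !big_cons big_nil addr0.
by rewrite !addrA.
Qed.

Lemma card_quad S : #|S| = 4%N -> exists i j k l, quad S i j k l.
Proof.
move=> S4; have es := enum_uniq S; have em := mem_enum S; rewrite cardE in S4.
case: (enum S) S4 es em => [|i [|j [|k [|l [|]]]]] // _ es em.
by exists i, j, k, l; split=> // m; rewrite -em.
Qed.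

Lemma quad_indep p S i j k l : quad S i j k l -> affinely_independent p S ->
  det3 (p j - p i) (p k - p i) (p l - p i) != 0.
Proof.
move=> q ai; apply: det3_neq0 => a b c E.
pose al m : R := if m == j then a else if m == k then b else if m == l then c else - (a + b + c).
have [] := q; rewrite /= !inE !negb_or => /and4P[/and3P[ij ik il] /andP[jk jl] kl _] Ss.
have ali : al i = - (a + b + c) by rewrite /al (negbTE ij) (negbTE ik) (negbTE il).
have alj : al j = a by rewrite /al eqxx.
have alk : al k = b by rewrite /al eq_sym (negbTE jk) eqxx.
have all : al l = c by rewrite /al eq_sym (negbTE jl) eq_sym (negbTE kl) eqxx.
have al0 : forall m, m \in S -> al m = 0.
  apply: ai; first by rewrite (sum_quad _ q) ali alj alk all; ring.
  rewrite (sum_quad _ q) ali alj alk all -[RHS]E.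
  by apply: rV3P; rewrite !coordE; ring.
by split; [rewrite -alj|rewrite -alk|rewrite -all]; apply: al0; rewrite Ss !inE eqxx ?orbT.
Qed.

(** Barycentric coordinates, extended to the whole space as affine functions;
    hence they are continuous, and signs outside the simplex make sense. *)
Definition bary p S (b : 'I_n -> X -> R) : Prop :=
  [/\ forall x, \sum_(m in S) b m x = 1,
      forall x, \sum_(m in S) b m x *: p m = x &
      forall m, exists nv c, forall x, b m x = dot nv x + c].

Lemma bary_exists p S : #|S| = 4%N -> affinely_independent p S -> exists b, bary p S b.
Proof.
move=> /card_quad[i [j [k [l q]]]] /(quad_indep q).
set u := p j - p i; set v := p k - p i; set w := p l - p i => D0.
pose bj x := dot ((det3 u v w)^-1 *: cross v w) x + - dot ((det3 u v w)^-1 *: cross v w) (p i).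
pose bk x := dot ((det3 u v w)^-1 *: cross w u) x + - dot ((det3 u v w)^-1 *: cross w u) (p i).
pose bl x := dot ((det3 u v w)^-1 *: cross u v) x + - dot ((det3 u v w)^-1 *: cross u v) (p i).
pose b m x : R := if m == j then bj x else if m == k then bk x else if m == l then bl x
  else 1 - bj x - bk x - bl x.
have [] := q; rewrite /= !inE !negb_or => /and4P[/and3P[ij ik il] /andP[jk jl] kl _] Ss.
have bi x : b i x = 1 - bj x - bk x - bl x by rewrite /b (negbTE ij) (negbTE ik) (negbTE il).
have bjE x : b j x = bj x by rewrite /b eqxx.
have bkE x : b k x = bk x by rewrite /b eq_sym (negbTE jk) eqxx.
have blE x : b l x = bl x by rewrite /b eq_sym (negbTE jl) eq_sym (negbTE kl) eqxx.
exists b; split => [x|x|m].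
- by rewrite (sum_quad _ q) bi bjE bkE blE; ring.
- rewrite (sum_quad _ q) bi bjE bkE blE.
  have Ej : (det3 u v w)^-1 * det3 (x - p i) v w = bj x.
    by rewrite /bj !dotZl -mulrN -mulrDr; congr (_ * _); rewrite det3E !dotE ?coordE; ring.
  have Ek : (det3 u v w)^-1 * det3 u (x - p i) w = bk x.
    by rewrite /bk !dotZl -mulrN -mulrDr; congr (_ * _); rewrite det3E !dotE ?coordE; ring.
  have El : (det3 u v w)^-1 * det3 u v (x - p i) = bl x.
    by rewrite /bl !dotZl -mulrN -mulrDr; congr (_ * _); rewrite det3E !dotE ?coordE; ring.
  have Ex : x = p i + (bj x *: u + bk x *: v + bl x *: w).
    rewrite -Ej -Ek -El -!(scalerA (_^-1)) -!scalerDr -cramer3.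
    by rewrite scalerA mulVf // scale1r addrC subrK.
  by rewrite [RHS]Ex /u /v /w; apply: rV3P; rewrite !coordE; ring.
- rewrite /b; case: (m == j); first by do 2 eexists.
  case: (m == k); first by do 2 eexists.
  case: (m == l); first by do 2 eexists.
  exists (- ((det3 u v w)^-1 *: cross v w) - ((det3 u v w)^-1 *: cross w u) - ((det3 u v w)^-1 *: cross u v)).
  exists (1 + dot ((det3 u v w)^-1 *: cross v w) (p i) + dot ((det3 u v w)^-1 *: cross w u) (p i)
    + dot ((det3 u v w)^-1 *: cross u v) (p i)) => x.
  rewrite /bj /bk /bl; move: (_ *: cross v w) (_ *: cross w u) (_ *: cross u v) => A B C.
  by rewrite !dotBl -(scaleN1r A) dotZl; ring.
Qed.

Section Bary.
Context (p : 'I_n -> X) (S : {set 'I_n}) (b : 'I_n -> X -> R).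
Hypotheses (ai : affinely_independent p S) (bP : bary p S b).

Lemma bary_uniq (a : 'I_n -> R) : \sum_(m in S) a m = 1 ->
  forall m, m \in S -> b m (\sum_(m in S) a m *: p m) = a m.
Proof.
move=> a1 m mS; have [b1 bx _] := bP.
set x := \sum_(m in S) _; apply/eqP; rewrite -subr_eq0; apply/eqP.
apply: (ai (a := fun m => b m x - a m)) mS.
  by rewrite sumrB b1 a1 subrr.
under eq_bigr do rewrite scalerBl.
by rewrite sumrB bx subrr.
Qed.

Lemma bary_seg m x y t : b m (x + t *: (y - x)) = b m x + t * (b m y - b m x).
Proof.
have [_ _ /(_ m)[nv [c E]]] := bP.
by rewrite !E dotDr dotZr dotBr; ring.
Qed.

Lemma bary_cvg m x : b m @ x --> b m x.
Proof.
have [_ _ /(_ m)[nv [c E]]] := bP.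
have -> : b m = (fun x => dot nv x + c) by apply/funext.
apply: (@cvgD _ _ _ (nbhs x) _ (dot nv) (fun=> c) (dot nv x) c); last exact: cvg_cst.
exact: (@dot_cvg _ _ (nbhs x) _ (fun=> nv) id nv x (cvg_cst _) (@cvg_id _ _)).
Qed.

Lemma bary_gt0_near m x : 0 < b m x -> \forall y \near x, 0 < b m y.
Proof. by move=> bx; exact: (@bary_cvg m x _ (lt_nbhsr bx)). Qed.

Lemma bary_lt0_near m x : b m x < 0 -> \forall y \near x, b m y < 0.
Proof. by move=> bx; exact: (@bary_cvg m x _ (lt_nbhsl bx)). Qed.

Lemma hullP (s : {set 'I_n}) (sS : s \subset S) x :
  hull p s x <-> forall m, m \in S -> 0 <= b m x /\ (m \notin s -> b m x = 0).
Proof.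
split.
  move=> [a [a0 a1 xE]] m mS.
  pose a' k := if k \in s then a k else 0.
  have sE (V : nmodType) (F : 'I_n -> V) : (forall k, k \notin s -> F k = 0) ->
      \sum_(k in S) F k = \sum_(k in s) F k.
    move=> F0; rewrite (big_setID s) /= (finset.setIidPr sS) [X in _ + X]big1 ?addr0 //.
    by move=> k; rewrite !inE => /andP[/F0].
  have E1 : \sum_(k in S) a' k = 1.
    rewrite sE => [|k /negbTE ks]; last by rewrite /a' ks.
    by rewrite -a1; apply: eq_bigr => k ks; rewrite /a' ks.
  have Ex : \sum_(k in S) a' k *: p k = x.
    rewrite sE => [|k /negbTE ks]; last by rewrite /a' ks scale0r.
    by rewrite xE; apply: eq_bigr => k ks; rewrite /a' ks.
  have := bary_uniq E1 mS; rewrite Ex /a' => ->.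
  by case: ifP => // /a0.
move=> H; have [b1 bx _] := bP.
have sE (V : nmodType) (F : 'I_n -> V) : (forall k, k \in S -> k \notin s -> F k = 0) ->
    \sum_(k in s) F k = \sum_(k in S) F k.
  move=> F0; rewrite [RHS](big_setID s) /= (finset.setIidPr sS) [X in _ = _ + X]big1 ?addr0 //.
  by move=> k; rewrite !inE => /andP[ks kS]; exact: F0.
exists (b^~ x); split => [m ms||].
- by have [] := H m (fintype.subsetP sS _ ms).
- by rewrite sE // => k kS ks; have [_ ->] := H k kS.
- by rewrite sE // => k kS ks; have [_ ->] := H k kS; rewrite ?scale0r.
Qed.

Lemma hull_fullP x : hull p S x <-> forall m, m \in S -> 0 <= b m x.
Proof.
split; first by move=> /(hullP (subxx _)) H m /H[].
by move=> H; apply/(hullP (subxx _)) => m mS; split; [exact: H|rewrite mS].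
Qed.

Lemma bary_vertex k m : k \in S -> m \in S -> b m (p k) = (m == k)%:R.
Proof.
move=> kS mS.
have E1 : \sum_(m in S) (m == k)%:R = 1 :> R.
  by rewrite (bigD1 k) //= eqxx big1 ?addr0 // => j /andP[_ /negbTE ->].
have := bary_uniq E1 mS; rewrite (bigD1 k) //= eqxx scale1r big1 ?addr0 // => j.
by move=> /andP[_ /negbTE ->]; rewrite scale0r.
Qed.

Lemma hullC_near (s : {set 'I_n}) x : s \subset S ->
  ~ hull p s x -> \forall y \near x, ~ hull p s y.
Proof.
move=> sS nx; have [m mS bm] : exists2 m, m \in S & b m x < 0 \/ (m \notin s /\ b m x != 0).
  apply: contrapT => nex; apply: nx; apply/(hullP sS) => m mS.
  have [b0|b0] := ltP (b m x) 0; first by case: nex; exists m => //; left.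
  split=> // ms; apply/eqP; apply: contrapT => /negP bm.
  by case: nex; exists m => //; right.
case: bm => [bm|[ms]].
  near=> y => /(hullP sS)/(_ m mS)[+ _].
  by apply/negP; rewrite -ltNge; near: y; exact: bary_lt0_near.
rewrite neq_lt => /orP[bm|bm].
  near=> y => /(hullP sS)/(_ m mS)[_ /(_ ms)]; apply/eqP; rewrite lt_eqF //.
  by near: y; exact: bary_lt0_near.
near=> y => /(hullP sS)/(_ m mS)[_ /(_ ms)]; apply/eqP; rewrite gt_eqF //.
by near: y; exact: bary_gt0_near.
Unshelve. all: by end_near. Qed.

End Bary.

Lemma hull_convex p S : convexS (hull p S).
Proof.
move=> x y t [a [a0 a1 ->]] [c [c0 c1 ->]] /andP[t0 t1].
exists (fun m => a m + t * (c m - a m)); split.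
- move=> m mS; have := a0 m mS; have := c0 m mS.
  by move=> ? ?; rewrite (_ : _ + _ = (1 - t) * a m + t * c m); [rewrite addr_ge0 // mulr_ge0 //; lra|ring].
- by rewrite big_split /= -mulr_sumr sumrB a1 c1 subrr mulr0 addr0.
- under [RHS]eq_bigr do rewrite scalerDl -scalerA scalerBl.
  by rewrite big_split /= -scaler_sumr sumrB.
Qed.

End Simplex.

(** * Simplicial decompositions *)

Section Complex.
Context (R : realType) (n : nat).
Notation X := 'rV[R]_3.
Context (P : set X) (p : 'I_n -> X) (T : {set {set 'I_n}}).
Hypothesis decP : simplicial_decomposition P p T.
Implicit Types (S : {set 'I_n}) (x y w : X).

Lemma dec_card S : S \in T -> #|S| = 4%N.
Proof. by case: decP => _ _ H _ _ /H[]. Qed.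

Lemma dec_indep S : S \in T -> affinely_independent p S.
Proof. by case: decP => _ _ H _ _ /H[]. Qed.

Lemma dec_bary S : S \in T -> exists b, bary p S b.
Proof. by move=> ST; apply: bary_exists; [exact: dec_card|exact: dec_indep]. Qed.

Lemma dec_meet S S' x : S \in T -> S' \in T -> hull p S x -> hull p S' x ->
  hull p (S :&: S') x.
Proof. by move=> ST S'T Sx S'x; case: decP => _ _ _ /(_ S S' ST S'T) <- _. Qed.

Lemma dec_cover x : P x -> exists2 S, S \in T & hull p S x.
Proof. by case: decP => _ _ _ _ -> [S ST Sx]; exists S. Qed.

Lemma dec_sub S x : S \in T -> hull p S x -> P x.
Proof. by case: decP => _ _ _ _ -> ST Sx; exists S. Qed.

Lemma dec_vertex i : exists2 S, S \in T & i \in S.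
Proof. by case: decP. Qed.

(** Simplices meet along common faces, so the smallest face of [S] that contains
    [x] is a face of every simplex that contains [x]. *)
Lemma carrier_sub S S' b x m : S \in T -> S' \in T -> bary p S b ->
  hull p S x -> hull p S' x -> m \in S -> b m x != 0 -> m \in S'.
Proof.
move=> ST S'T bP Sx S'x mS; apply: contra_neqT => mS'.
have /(hullP (dec_indep ST) bP (finset.subsetIl _ _))/(_ m mS)[_] := dec_meet ST S'T Sx S'x.
by apply; rewrite inE negb_and mS' orbT.
Qed.

Lemma hull_vertex S i : i \in S -> hull p S (p i).
Proof.
move=> iS; exists (fun m => (m == i)%:R); split => [m _||].
- by rewrite ler0n.
- by rewrite (bigD1 i) //= eqxx big1 ?addr0 // => m /andP[_ /negbTE ->].
- by rewrite (bigD1 i) //= eqxx scale1r big1 ?addr0 // => m /andP[_ /negbTE ->]; rewrite scale0r.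
Qed.

Lemma vertex_in_hull S i : S \in T -> hull p S (p i) -> i \in S.
Proof.
move=> ST Si; have [S0 S0T iS0] := dec_vertex i; have [b bP] := dec_bary S0T.
apply: (carrier_sub S0T ST bP (hull_vertex iS0) Si iS0).
by rewrite (bary_vertex (dec_indep S0T) bP) // eqxx oner_eq0.
Qed.

Lemma hull_subset (s S : {set 'I_n}) : s \subset S -> hull p s `<=` hull p S.
Proof.
move=> sS x [a [a0 a1 xE]]; exists (fun k => if k \in s then a k else 0); split.
- by move=> k _; case: ifP => // /a0.
- rewrite -[RHS]a1 (big_setID s) /= (finset.setIidPr sS) [X in _ + X]big1 ?addr0.
    by apply: eq_bigr => k ->.
  by move=> k; rewrite inE => /andP[/negbTE ->].
- rewrite xE [RHS](big_setID s) /= (finset.setIidPr sS) [X in _ = _ + X]big1 ?addr0.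
    by apply: eq_bigr => k ->.
  by move=> k; rewrite inE => /andP[/negbTE -> _]; rewrite scale0r.
Qed.

Lemma near_star x : \forall y \near x, forall S (s : {set 'I_n}), S \in T -> s \subset S ->
  hull p s y -> hull p s x.
Proof.
suff H (S s : {set 'I_n}) : \forall y \near x, S \in T -> s \subset S -> hull p s y -> hull p s x.
  exact: (filter_forall _ (fun S => filter_forall _ (H S))).
have [ST|/negP nST] := boolP (S \in T); last by near=> y.
have [sS|/negP nsS] := boolP (s \subset S); last by near=> y.
have [b bP] := dec_bary ST.
have [sx|nsx] := pselect (hull p s x); first by near=> y.
have := hullC_near (dec_indep ST) bP sS nsx.
by apply: filterS => y ny _ _ /ny.
Unshelve. all: by end_near. Qed.

Lemma near_star1 x : \forall y \near x, forall S, S \in T -> hull p S y -> hull p S x.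
Proof. by apply: filterS (near_star x) => y H S ST; exact: (H S S ST (subxx _)). Qed.

Definition not_vertex x := x \notin codom p.

(** A point that is not a vertex lies inside a face of dimension at least one;
    all simplices that contain it therefore share an edge. *)
Lemma bary_neq0_two S b x : S \in T -> bary p S b -> not_vertex x ->
  exists i j, [/\ i \in S, j \in S, i != j, b i x != 0 & b j x != 0].
Proof.
move=> ST bP nv; have [b1 bx _] := bP.
have [i iS bi] : exists2 i, i \in S & b i x != 0.
  apply: contrapT => H; have := b1 x; rewrite big1 => [/eqP|m mS].
    by rewrite eq_sym oner_eq0.
  by apply/eqP; apply: contrapT => /negP bm; apply: H; exists m.
have [j /andP[jS ji] bj] : exists2 j, (j \in S) && (j != i) & b j x != 0.
  apply: contrapT => H; case/negP: nv.
  have Z m : m \in S -> m != i -> b m x = 0.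
    move=> mS mi; apply/eqP; apply: contrapT => /negP bm; apply: H; exists m => //.
    exact/andP.
  have bi1 : b i x = 1.
    rewrite -(b1 x) (bigD1 i) //= [X in _ + X]big1 ?addr0 // => m /andP[]; exact: Z.
  have <- : p i = x.
    rewrite -[RHS](bx x) (bigD1 i) //= bi1 scale1r [X in _ + X]big1 ?addr0 // => m /andP[mS mi].
    by rewrite Z ?scale0r.
  exact: codom_f.
by exists i, j; rewrite eq_sym.
Qed.

Lemma not_vertex_meet S S' x : S \in T -> S' \in T -> hull p S x -> hull p S' x ->
  not_vertex x -> (2 <= #|S :&: S'|)%N.
Proof.
move=> ST S'T Sx S'x nv; have [b bP] := dec_bary ST.
have [i [j [iS jS ij bi bj]]] := bary_neq0_two ST bP nv.
have iS' := carrier_sub ST S'T bP Sx S'x iS bi.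
have jS' := carrier_sub ST S'T bP Sx S'x jS bj.
have : [set i; j]%SET \subset S :&: S'.
  by apply/fintype.subsetP => k; rewrite !inE => /orP[] /eqP ->; rewrite ?iS ?iS' ?jS ?jS'.
by move/subset_leq_card; rewrite cards2 ij.
Qed.

Definition on_edge i j (t : R) : X := p i + t *: (p j - p i).

Lemma on_edge_hull S i j t : i \in S -> j \in S -> 0 <= t <= 1 -> hull p S (on_edge i j t).
Proof. by move=> iS jS; apply: hull_convex; exact: hull_vertex. Qed.

Lemma hull2P i j x : i != j -> hull p [set i; j]%SET x -> exists2 t, 0 <= t <= 1 & x = on_edge i j t.
Proof.
move=> ij [a [a0 a1 ->]]; have ai := a0 i (set21 i j); have aj := a0 j (set22 i j).
rewrite big_setU1 ?inE //= big_set1 in a1.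
exists (a j); first by lra.
rewrite big_setU1 ?inE //= big_set1 /on_edge.
have -> : a i = 1 - a j by rewrite -a1 addrK.
by apply: rV3P; rewrite !coordE; ring.
Qed.

Lemma bary_on_edge S b i j t : S \in T -> bary p S b -> i \in S -> j \in S -> i != j ->
  b i (on_edge i j t) = 1 - t /\ b j (on_edge i j t) = t.
Proof.
move=> ST bP iS jS ij; have bv := bary_vertex (dec_indep ST) bP.
have ji : (j == i) = false by rewrite eq_sym (negbTE ij).
by split; rewrite /on_edge (bary_seg bP) !bv // !eqxx ?(negbTE ij) ?ji /=; ring.
Qed.

Lemma on_edge_star S i j t : (exists S0, [/\ S0 \in T, i \in S0 & j \in S0]) -> i != j ->
  0 < t < 1 -> S \in T -> hull p S (on_edge i j t) -> (i \in S) && (j \in S).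
Proof.
move=> [S0 [S0T iS jS]] ij /andP[t0 t1] ST Sx; have [b bP] := dec_bary S0T.
have [bi bj] := bary_on_edge t S0T bP iS jS ij.
have t01 : 0 <= t <= 1 by rewrite !ltW.
have S0x := on_edge_hull iS jS t01.
apply/andP; split.
  by apply: (carrier_sub S0T ST bP S0x Sx iS); rewrite bi; apply/eqP; lra.
by apply: (carrier_sub S0T ST bP S0x Sx jS); rewrite bj; apply/eqP; lra.
Qed.

Lemma on_edge_not_vertex i j t : (exists S0, [/\ S0 \in T, i \in S0 & j \in S0]) -> i != j ->
  0 < t < 1 -> not_vertex (on_edge i j t).
Proof.
move=> [S0 [S0T iS jS]] ij /andP[t0 t1]; have [b bP] := dec_bary S0T.
have [bi bj] := bary_on_edge t S0T bP iS jS ij.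
have t01 : 0 <= t <= 1 by rewrite !ltW.
apply/negP => /codomP[m E]; have S0x := on_edge_hull iS jS t01.
rewrite E in S0x bi bj; have mS := vertex_in_hull S0T S0x.
by move: bi; rewrite (bary_vertex (dec_indep S0T) bP) //; case: (i == m) => /=; lra.
Qed.

Lemma small_step w v U : nbhs w U -> exists2 s : R, 0 < s < 1 & U (w + s *: (v - w)).
Proof.
move=> Uw; have : nbhs (w + 0 *: (v - w)) U by rewrite scale0r addr0.
move/near_seg1 => /nbhs_normP[d /= d0 dU].
exists (Num.min (d / 2) (1/2)); first by rewrite lt_min gt_min; apply/andP; split; [lra|apply/orP; right; lra].
have m0 : 0 <= Num.min (d / 2) (1/2) by rewrite le_min; apply/andP; split; lra.
apply: dU => /=; rewrite sub0r normrN ger0_norm //.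
by rewrite gt_min; apply/orP; left; lra.
Qed.

Lemma third_vertex S i j : S \in T -> exists2 k, k \in S & (k != i) && (k != j).
Proof.
move=> ST; have /set0Pn[k] : S :\: [set i; j]%SET != finset.set0.
  rewrite -card_gt0 cardsD (dec_card ST) subn_gt0.
  apply: leq_ltn_trans (subset_leq_card (finset.subsetIr _ _)) _.
  by rewrite cards2; case: (i != j).
by rewrite !inE negb_or => /andP[/andP[? ?] ?]; exists k => //; apply/andP.
Qed.

Lemma hullD_convex S (s : {set 'I_n}) : S \in T -> s \subset S ->
  convexS (hull p S `&` [set x | ~ hull p s x]).
Proof.
move=> ST sS x y t [Sx /= nx] [Sy /= ny] t01; split=> /=; first exact: hull_convex.
have [b bP] := dec_bary ST; have ai := dec_indep ST.
move/(hullP ai bP sS) => H; apply: ny; apply/(hullP ai bP sS) => m mS.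
have [b0 bm] := H m mS.
have bx : 0 <= b m x by move/(hull_fullP ai bP): Sx => /(_ m mS).
have by0 : 0 <= b m y by move/(hull_fullP ai bP): Sy => /(_ m mS).
split=> // ms; move: (bm ms); rewrite (bary_seg bP).
have [t0 E|t0 E] := eqVneq t 0.
  case: nx; apply/(hullP ai bP sS) => k kS; have [_] := H k kS.
  rewrite t0 scale0r addr0 => Z; split=> //.
  by move/(hull_fullP ai bP): Sx => /(_ k kS).
have {}t0 : 0 < t by move: t01 => /andP[? _]; rewrite lt_def t0.
by move: t01 => /andP[? ?]; nra.
Qed.

Hypothesis ballP : homeomorphic P (@closed_unit_ball R).

(** If some simplices around the edge had the label of [S0] and others not, two
    simplices of different classes would meet along the edge only.  Let [m] be
    the indicator of the first class.  Remove from the polyhedron the midpoint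
    [x] of the edge and its end [p j].  The function [c] that records the jumps
    of [m] across the half of the edge next to [p j], and nothing else, is then
    a cocycle.  It has no primitive: a loop around [x] that leaves along one
    class of simplices and returns along the other picks up a jump of 1. *)
Lemma edge_star_connected (A : Type) (f : {set 'I_n} -> A) i j : i != j ->
  (forall S S', S \in T -> S' \in T -> [set i; j]%SET \subset S -> [set i; j]%SET \subset S' ->
     (3 <= #|S :&: S'|)%N -> f S = f S') ->
  forall S S', S \in T -> S' \in T -> [set i; j]%SET \subset S -> [set i; j]%SET \subset S' ->
  f S = f S'.
Proof.
move=> ij fadj S0 S1 S0T S1T e0 e1; apply: contrapT => f01.
have sub2 S : ([set i; j]%SET \subset S) = (i \in S) && (j \in S).
  by rewrite finset.subUset !finset.sub1set.
have ex0 : exists S0, [/\ S0 \in T, i \in S0 & j \in S0].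
  by exists S0; move: e0; rewrite sub2 => /andP[].
pose x := on_edge i j (1/2); pose pos y := 0 < dot (y - x) (p j - p i).
pose star S := S \in T /\ [set i; j]%SET \subset S.
pose Q y := (exists2 S, star S & hull p S y) /\ pos y.
pose m y : R := if `[< exists S, [/\ star S, hull p S y & f S = f S0] >] then 1 else 0.
pose c y z : R := if `[< Q y /\ Q z >] then m z - m y else 0.
have pji : 0 < dot (p j - p i) (p j - p i).
  rewrite dot_gt0 subr_eq0; apply: contraNneq ij => E.
  by case: decP => inj _ _ _ _; rewrite (inj _ _ E).
have posE t : dot (on_edge i j t - x) (p j - p i) = (t - 1/2) * dot (p j - p i) (p j - p i).
  by rewrite /x /on_edge !dotE !coordE; ring.
have pos_cvg w : (fun y => dot (y - x) (p j - p i)) @ w --> dot (w - x) (p j - p i).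
  apply: (@dot_cvg _ _ (nbhs w) _ (fun y => y - x) (fun=> p j - p i)); last exact: cvg_cst.
  by apply: cvgB; [exact: cvg_id|exact: cvg_cst].
have [_ /(_ _ c)] : H0_trivial (P `&` [set y | y \notin [:: x; p j]]) /\
    H1_trivial (P `&` [set y | y \notin [:: x; p j]]).
  apply: homeomorphic_punctured => // q; move: ex0 => [S [ST iS jS]].
  rewrite !inE => /orP[] /eqP ->; apply: (dec_sub ST); last exact: hull_vertex.
  by apply: on_edge_hull => //; lra.
have meet_edge S S' w : star S -> star S' -> f S <> f S' -> hull p S w -> hull p S' w ->
    exists2 t, 0 <= t <= 1 & w = on_edge i j t.
  move=> [ST eS] [S'T eS'] ne Sw S'w; apply: hull2P => //.
  suff <- : S :&: S' = [set i; j]%SET by exact: dec_meet.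
  apply/eqP; rewrite eq_sym eqEcard finset.subsetI eS eS' cards2 ij /= leqNgt.
  by apply/negP => /(fadj _ _ ST S'T eS eS').
have mid_star t : 0 < t < 1 -> forall S, S \in T -> hull p S (on_edge i j t) -> star S.
  by move=> t01 S ST Sx; split=> //; rewrite sub2; exact: on_edge_star Sx.
have nearQ t : 1/2 < t < 1 -> \forall y \near on_edge i j t, P y -> Q y.
  move=> /andP[t2 t1]; near=> y => Py; have [S ST Sy] := dec_cover Py; split.
    exists S => //; apply: (@mid_star t); first lra.
    - exact: ST.
    - by move: S ST Sy; near: y; exact: near_star1.
  rewrite /pos; near: y; apply: (@pos_cvg (on_edge i j t) _ (lt_nbhsr _)).
  by rewrite posE mulr_gt0 //; lra.
have c_cocycle : local_cocycle (P `&` [set y | y \notin [:: x; p j]]) c.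
  move=> w [Pw /=]; rewrite !inE negb_or => /andP[wx wj].
  have [[t t01 wt]|nb] := pselect (exists2 t, 1/2 < t < 1 & w = on_edge i j t).
    exists [set y | P y -> Q y]; first by rewrite wt; exact: nearQ.
    move=> a b d [Qa [/Qa{}Qa _]] [Qb [/Qb{}Qb _]] [Qd [/Qd{}Qd _]].
    by rewrite /c !asboolT //; ring.
  have key : \forall y \near w, forall S, S \in T -> hull p S y -> hull p S w /\
     (pos y -> 0 <= dot (w - x) (p j - p i)).
    have [w0|w0] := leP 0 (dot (w - x) (p j - p i)).
      near=> y => S ST Sy; split=> //.
      by move: S ST Sy; near: y; exact: near_star1.
    near=> y => S ST Sy; split; first by move: S ST Sy; near: y; exact: near_star1.
    rewrite /pos => y0; have : dot (y - x) (p j - p i) < 0.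
      by near: y; exact: (@pos_cvg w _ (lt_nbhsl w0)).
    by lra.
  exists [set y | forall S, S \in T -> hull p S y -> hull p S w /\
     (pos y -> 0 <= dot (w - x) (p j - p i))] => //.
  suff c0 a b : (forall S, S \in T -> hull p S a -> hull p S w /\
      (pos a -> 0 <= dot (w - x) (p j - p i))) ->
      (forall S, S \in T -> hull p S b -> hull p S w /\
      (pos b -> 0 <= dot (w - x) (p j - p i))) -> c a b = 0.
    by move=> a b d [Ha _] [Hb _] [Hd _]; rewrite !c0 // addr0.
  move=> Ha Hb; rewrite /c; case: asboolP => // -[[[S sS Sa] pa] [[S' sS' S'b] pb]].
  have half S1' S2' : star S1' -> star S2' -> hull p S1' w -> hull p S2' w -> f S1' = f S2'.
    move=> st1 st2 w1 w2; apply: contrapT => ne; have [t t01 wt] := meet_edge _ _ _ st1 st2 ne w1 w2.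
    have := (Ha S sS.1 Sa).2 pa; rewrite wt posE pmulr_lge0 // => t2.
    apply: nb; exists t => //; have t2' : t != 1/2 by apply: contraNneq wx; rewrite wt => ->.
    have t1 : t != 1.
      by apply: contraNneq wj; rewrite wt => ->; rewrite /on_edge scale1r addrC subrK.
    move: t01 => /andP[t0 tle]; apply/andP; split; first by rewrite lt_def t2' /=; lra.
    by rewrite lt_def eq_sym t1.
  suff -> : m b = m a by rewrite subrr.
  rewrite /m; congr (if _ then _ else _); apply: asbool_equiv_eq.
  split=> -[S2 [st2 h2 f2]].
    by exists S; split=> //; rewrite -f2; apply: half => //; [exact: (Ha S sS.1 Sa).1|exact: (Hb S2 st2.1 h2).1].
  by exists S'; split=> //; rewrite -f2; apply: half => //; [exact: (Hb S' sS'.1 S'b).1|exact: (Ha S2 st2.1 h2).1].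
move=> /(_ c_cocycle)[h hP].
(* A primitive is constant on a simplex of the star without the edge. *)
pose K S := hull p S `&` [set y | ~ hull p [set i; j]%SET y].
have KY S : star S -> K S `<=` P `&` [set y | y \notin [:: x; p j]].
  move=> [ST _] y [Sy /= ny]; split; first exact: dec_sub Sy.
  rewrite /= !inE negb_or; apply/andP; split; apply: contra_not_neq ny => ->.
    by apply: on_edge_hull; rewrite ?set21 ?set22 //; lra.
  by apply: hull_vertex; rewrite set22.
have mK S y : star S -> K S y -> m y = if `[< f S = f S0 >] then 1 else 0.
  move=> st [Sy /= ny]; rewrite /m; congr (if _ then _ else _); apply: asbool_equiv_eq.
  split=> [[S' [st' S'y <-]]|fS]; last by exists S.
  apply: contrapT => ne; have [t t01 yt] := meet_edge _ _ _ st st' ne Sy S'y.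
  by apply: ny; rewrite yt; apply: on_edge_hull; rewrite ?set21 ?set22.
have hK S : star S -> forall y z, K S y -> K S z -> h y = h z.
  move=> st y z Ky Kz; have Kc : H0_trivial (K S).
    by apply: convex_H0_trivial; apply: hullD_convex; [exact: st.1|exact: st.2].
  apply: Kc Ky Kz => w Kw; have [U Uw hU] := hP _ (KY _ st _ Kw).
  near=> v => Kv; apply/eqP; rewrite -subr_eq0 (hU w v).
  - by rewrite /c; case: asboolP => // _; rewrite (mK S w) ?(mK S v) // subrr.
  - by split; [exact: nbhs_singleton|exact: KY Kw].
  - by split; [near: v|exact: KY Kv].
have Kpt S t U : star S -> 0 < t < 1 -> nbhs (on_edge i j t) U -> exists2 y, U y & K S y.
  move=> [ST eS] t01 Ut; have [k kS /andP[ki kj]] := third_vertex i j ST.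
  have [s /andP[s0 s1] Us] := small_step (p k) Ut.
  exists (on_edge i j t + s *: (p k - on_edge i j t)) => //.
  move: (eS); rewrite sub2 => /andP[iS jS].
  split; first by apply: hull_convex; [apply: on_edge_hull; rewrite ?iS ?jS //; lra|exact: hull_vertex|lra].
  have [b bP] := dec_bary ST; move=> /(hullP (dec_indep ST) bP eS)/(_ k kS)[_].
  rewrite !inE negb_or ki kj (bary_seg bP) /on_edge (bary_seg bP).
  rewrite !(bary_vertex (dec_indep ST) bP) // eqxx (negbTE ki) (negbTE kj) => /(_ isT).
  by rewrite /= subrr mulr0 addr0 add0r subr0 mulr1; lra.
have st0 : star S0 by []; have st1 : star S1 by [].
have val S t : star S -> 0 < t < 1 -> t != 1/2 -> forall y, K S y ->
   h y - h (on_edge i j t) = if 1/2 < t then m y - m (on_edge i j t) else 0.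
  move=> st t01 t2 y Ky.
  have Yt : (P `&` [set y | y \notin [:: x; p j]]) (on_edge i j t).
    split; first by apply: (dec_sub st.1); move: st.2; rewrite sub2 => /andP[iS jS]; apply: on_edge_hull => //; lra.
    rewrite /= !inE negb_or; apply/andP; split.
      apply: contraNneq t2 => E; have := posE t; rewrite E subrr dot0l => /esym/eqP.
      by rewrite mulf_eq0 (gt_eqF pji) orbF subr_eq0.
    apply/eqP => E; have /negP := on_edge_not_vertex ex0 ij t01; apply.
    by rewrite E; exact: codom_f.
  have [U Ut hU] := hP _ Yt.
  have [t2'|t2'] := ltP (1/2) t.
    have t2'' : 1/2 < t < 1 by move: t01 => /andP[_ ->]; rewrite t2'.
    have [z [Uz PQ] Kz] := Kpt _ _ _ st t01 (filterI Ut (nearQ _ t2'')).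
    have Qz : Q z by apply: PQ; exact: (KY _ st _ Kz).1.
    rewrite (hK _ st _ _ Ky Kz) hU; last 2 first.
    - by split=> //; exact: nbhs_singleton.
    - by split=> //; exact: KY Kz.
    rewrite /c asboolT; first by rewrite (mK _ _ st Ky) (mK _ _ st Kz).
    by split=> //; apply: (nbhs_singleton (nearQ _ t2'')); exact: Yt.1.
  have [z Uz Kz] := Kpt _ _ _ st t01 Ut.
  rewrite (hK _ st _ _ Ky Kz) hU; last 2 first.
  - by split=> //; exact: nbhs_singleton.
  - by split=> //; exact: KY Kz.
  rewrite /c asboolF // => -[[_]]; rewrite /pos posE pmulr_lgt0 // subr_gt0 => lt _.
  by move: t2'; rewrite leNgt lt.
(* The loop crosses the edge at 1/4, where [c] vanishes, and at 3/4. *)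
have n1 : 0 < (1/4 : R) < 1 by lra.
have n3 : 0 < (3/4 : R) < 1 by lra.
have n1' : (1/4 : R) != 1/2 by apply/eqP; lra.
have n3' : (3/4 : R) != 1/2 by apply/eqP; lra.
have l1 : (1/2 < 1/4 :> R) = false by apply/negbTE; rewrite -leNgt; lra.
have l3 : (1/2 < 3/4 :> R) by lra.
have [y0 _ K0] := Kpt S0 _ setT st0 n1 filterT.
have [y1 _ K1] := Kpt S1 _ setT st1 n1 filterT.
have := val S0 _ st0 n1 n1' _ K0; have := val S1 _ st1 n1 n1' _ K1.
have := val S0 _ st0 n3 n3' _ K0; have := val S1 _ st1 n3 n3' _ K1.
rewrite (mK _ _ st0 K0) (mK _ _ st1 K1) (asboolT (erefl (f S0))) asboolF; last by move/esym.
rewrite l1 l3 => E1 E2 E3 E4; suff : (1 : R) = 0 by apply/eqP; rewrite oner_eq0.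
by clear -E1 E2 E3 E4; lra.
Unshelve. all: by end_near. Qed.

End Complex.

(** * Connectedness through faces *)

Section Connected.
Context (R : realType) (n : nat).
Notation X := 'rV[R]_3.
Context (P : set X) (p : 'I_n -> X) (T : {set {set 'I_n}}).
Hypothesis decP : simplicial_decomposition P p T.
Implicit Types (S : {set 'I_n}) (x y w : X).
Hypothesis ballP : homeomorphic P (@closed_unit_ball R).

Lemma P_vertex i : P (p i).
Proof. by have [S ST iS] := dec_vertex decP i; exact: dec_sub ST (hull_vertex p iS). Qed.

Lemma set2_sub i j S : ([set i; j]%SET \subset S) = (i \in S) && (j \in S).
Proof. by rewrite finset.subUset !finset.sub1set. Qed.

Lemma two_of_card (A : {set 'I_n}) : (2 <= #|A|)%N -> exists i j, i != j /\ [set i; j]%SET \subset A.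
Proof.
by move=> /card_gt1P[i [j [iA jA ij]]]; exists i, j; rewrite set2_sub iA jA.
Qed.

(** Away from the vertices the label of a simplex that contains a given point is
    a locally constant function of this point, because all these simplices
    contain a common edge.  The polyhedron without its vertices is connected. *)
Lemma faces_connected (A : Type) (f : {set 'I_n} -> A) :
  (forall S S', S \in T -> S' \in T -> (3 <= #|S :&: S'|)%N -> f S = f S') ->
  forall S S', S \in T -> S' \in T -> f S = f S'.
Proof.
move=> fadj S0 S1 S0T S1T; apply: contrapT => f01.
have f2 S S' : S \in T -> S' \in T -> (2 <= #|S :&: S'|)%N -> f S = f S'.
  move=> ST S'T /two_of_card[i [j [ij]]]; rewrite finset.subsetI => /andP[eS eS'].
  by apply: (edge_star_connected decP ballP ij _ ST S'T eS eS') => *; exact: fadj.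
pose m y : bool := `[< exists S, [/\ S \in T, hull p S y & f S = f S0] >].
have [H0 _] := homeomorphic_punctured (s := codom p) ballP
  ltac:(by move=> q /codomP[i ->]; exact: P_vertex).
have pick S : S \in T -> exists2 y, hull p S y & not_vertex p y.
  move=> ST; have [i [j [ij]]] : exists i j, i != j /\ [set i; j]%SET \subset S.
    by apply: two_of_card; rewrite (dec_card decP).
  rewrite set2_sub => /andP[iS jS]; exists (on_edge p i j (1/2)).
    by apply: on_edge_hull => //; lra.
  by apply: (on_edge_not_vertex decP _ ij); [exists S|lra].
have mE S y : S \in T -> hull p S y -> not_vertex p y -> m y = `[< f S = f S0 >].
  move=> ST Sy ny; apply: asbool_equiv_eq; split=> [[S' [S'T S'y <-]]|fS]; last by exists S.
  by apply: f2 => //; exact: (not_vertex_meet decP ST S'T Sy S'y).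
have mc : locally_constant (P `&` [set x | x \notin codom p]) m.
  move=> w [Pw wn]; near=> y => -[Py yn].
  have [S ST Sy] := dec_cover decP Py; rewrite (mE S) // (mE S w) //.
  by move: S ST Sy; near: y; exact: near_star1 decP w.
have [y0 S0y n0] := pick S0 S0T; have [y1 S1y n1] := pick S1 S1T.
have := H0 _ m mc y0 y1 (conj (dec_sub decP S0T S0y) n0) (conj (dec_sub decP S1T S1y) n1).
rewrite (mE S0) // (mE S1) // (asboolT (erefl (f S0))) asboolF //.
by move/esym.
Unshelve. all: by end_near. Qed.

(** The same argument as around an edge: if the simplices at [p i] fell into two
    classes meeting at [p i] only, the jump at [p i] of the indicator [m] of one
    class would be a cocycle [c], without primitive because the polyhedron
    stays connected when [p i] is removed. *)
Lemma vertex_star_connected (A : Type) (f : {set 'I_n} -> A) i :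
  (forall S S', S \in T -> S' \in T -> i \in S -> i \in S' -> (2 <= #|S :&: S'|)%N -> f S = f S') ->
  forall S S', S \in T -> S' \in T -> i \in S -> i \in S' -> f S = f S'.
Proof.
move=> fadj S0 S1 S0T S1T i0 i1; apply: contrapT => f01.
pose star S := S \in T /\ i \in S.
pose Q y := exists2 S : {set 'I_n}, star S & hull p S y.
pose m y : R := if `[< exists S, [/\ star S, hull p S y & f S = f S0] >] then 1 else 0.
pose c y z : R := if `[< Q y /\ Q z >] then m z - m y else 0.
have meet S S' w : star S -> star S' -> f S <> f S' -> hull p S w -> hull p S' w -> w = p i.
  move=> [ST iS] [S'T iS'] ne Sw S'w.
  have SS : S :&: S' = [set i]%SET.
    apply/eqP; rewrite eq_sym eqEcard finset.sub1set inE iS iS' cards1 /= leqNgt.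
    by apply/negP => /(fadj _ _ ST S'T iS iS').
  have := dec_meet decP ST S'T Sw S'w; rewrite SS => -[a [_]].
  by rewrite !big_set1 => -> ->; rewrite scale1r.
have nearQ : \forall y \near p i, P y -> Q y.
  near=> y => Py; have [S ST Sy] := dec_cover decP Py; exists S => //; split=> //.
  apply: (vertex_in_hull decP ST).
  by move: S ST Sy; near: y; exact: (near_star1 decP).
have [_ /(_ _ c)] := homeomorphic_punctured (s := [::]) ballP ltac:(by []).
have -> : P `&` [set x | x \notin [::]] = P.
  by apply/seteqP; split=> y; [case|split].
have c0 w : w <> p i -> nbhs w [set y | forall z, (forall S, S \in T -> hull p S z -> hull p S w) ->
     c y z = 0].
  move=> wi; apply: filterS (near_star1 decP w) => a Ha b Hb.
  rewrite /c; case: asboolP => // -[[S sS Sa] [S' sS' S'b]].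
  have half S1' S2' : star S1' -> star S2' -> hull p S1' w -> hull p S2' w -> f S1' = f S2'.
    by move=> st1 st2 w1 w2; apply: contrapT => ne; apply: wi; exact: (meet S1' S2').
  suff -> : m b = m a by rewrite subrr.
  rewrite /m; congr (if _ then _ else _); apply: asbool_equiv_eq.
  split=> -[S2 [st2 h2 f2]].
    by exists S; split=> //; rewrite -f2; apply: half => //; [exact: Ha sS.1 Sa|exact: Hb st2.1 h2].
  by exists S'; split=> //; rewrite -f2; apply: half => //; [exact: Hb sS'.1 S'b|exact: Ha st2.1 h2].
have cc : local_cocycle P c.
  move=> w Pw; have [->|wi] := pselect (w = p i).
    exists [set y | P y -> Q y] => // a b d [Qa /Qa{}Qa] [Qb /Qb{}Qb] [Qd /Qd{}Qd].
    by rewrite /c !asboolT //; ring.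
  exists ([set y | forall S, S \in T -> hull p S y -> hull p S w] `&`
    [set y | forall z, (forall S, S \in T -> hull p S z -> hull p S w) -> c y z = 0]).
    by apply: filterI; [exact: (near_star1 decP)|exact: c0].
  move=> a b d [[_ Ha] _] [[Hb Hb'] _] [[Hd _] _].
  by rewrite Ha // Ha // Hb' // addr0.
move=> /(_ cc)[h hP].
have [H0 _] := homeomorphic_punctured (s := [:: p i]) ballP
  ltac:(by move=> q; rewrite inE => /eqP ->; exact: P_vertex).
have hc : locally_constant (P `&` [set x | x \notin [:: p i]]) h.
  move=> w [Pw /=]; rewrite inE => /eqP wi; have [U Uw hU] := hP w Pw.
  near=> y => -[Py _]; apply/eqP; rewrite -subr_eq0 (hU w y).
  - apply/eqP; have := nbhs_singleton (c0 w wi); apply.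
    by near: y; exact: (near_star1 decP).
  - by split=> //; exact: nbhs_singleton.
  - by split=> //; near: y.
have [U Ui hU] := hP _ (P_vertex i).
have val S : star S -> exists y, [/\ P y, y <> p i & h y - h (p i) =
    (if `[< f S = f S0 >] then 1 else 0) - m (p i)].
  move=> [ST iS]; have [k kS /andP[ki _]] := third_vertex decP i i ST.
  have [s /andP[s0 s1] [Us PQ]] := small_step (p k) (filterI Ui nearQ).
  set y := p i + _ in Us PQ.
  have Sy : hull p S y by apply: hull_convex; [exact: hull_vertex|exact: hull_vertex|lra].
  have Py : P y := dec_sub decP ST Sy.
  have yi : y <> p i.
    move=> /eqP; rewrite -subr_eq0 addrAC subrr add0r scaler_eq0 gt_eqF //= subr_eq0.
    by move=> /eqP E; case/eqP: ki; case: decP => inj _ _ _ _; exact: inj.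
  exists y; split=> //; rewrite hU; last 2 first.
  - by split; [exact: nbhs_singleton|exact: P_vertex].
  - by [].
  rewrite /c asboolT; last by split; [apply: (nbhs_singleton nearQ); exact: P_vertex|exact: PQ].
  congr (_ - _); rewrite /m; congr (if _ then _ else _); apply: asbool_equiv_eq.
  split=> [[S' [st' S'y <-]]|fS]; last by exists S.
  by apply: contrapT => ne; apply: yi; exact: (meet S S').
have [y0 [Py0 ny0]] := val S0 (conj S0T i0); have [y1 [Py1 ny1]] := val S1 (conj S1T i1).
rewrite (H0 _ h hc y0 y1); last 2 first.
- by split=> //=; rewrite inE; exact/eqP.
- by split=> //=; rewrite inE; exact/eqP.
rewrite (asboolT (erefl (f S0))) => ->.
rewrite asboolF; last by move/esym.
move=> E; have : (1 : R) = 0 by clear -E; lra.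
by apply/eqP; rewrite oner_eq0.
Unshelve. all: by end_near. Qed.

End Connected.

(** * Simplices on both sides of a triangle *)

Section Sides.
Context (R : realType) (n : nat).
Notation X := 'rV[R]_3.
Context (P : set X) (p : 'I_n -> X) (T : {set {set 'I_n}}).
Hypothesis decP : simplicial_decomposition P p T.
Implicit Types (S : {set 'I_n}) (x y z w : X).

(** Six times the signed volume. *)
Definition vol (i j k l : 'I_n) : R := det3 (p j - p i) (p k - p i) (p l - p i).

Lemma sub_segment x y z (u : R) :
  x - (y + u *: (z - y)) = (1 - u) *: (x - y) + u *: (x - z).
Proof. by apply: rV3P; rewrite !coordE; ring. Qed.

Lemma quad_mem S i j k l : quad S i j k l -> [/\ i \in S, j \in S, k \in S & l \in S].
Proof. by move=> [_ E]; rewrite !E !inE !eqxx ?orbT. Qed.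

Lemma quad_neq S i j k l : quad S i j k l ->
  [/\ i != j, i != k & i != l] /\ [/\ j != k, j != l & k != l].
Proof.
by move=> [/= + _]; rewrite !inE !negb_or => /and4P[/and3P[-> -> ->] /andP[-> ->] ->].
Qed.

Lemma quadC S i j k l : quad S i j k l -> quad S i j l k.
Proof.
move=> q; have [[ij ik il] [jk jl kl]] := quad_neq q; have [_ E] := q; split.
  by rewrite /= !inE !negb_or ij ik il jk jl eq_sym kl.
by move=> m; rewrite E !inE [(m == k) || _]orbC.
Qed.

Lemma quad_of3 S i j k : S \in T -> i != j -> i != k -> j != k ->
  i \in S -> j \in S -> k \in S -> exists l, quad S i j k l.
Proof.
move=> ST ij ik jk iS jS kS.
have u3 : uniq [:: i; j; k] by rewrite /= !inE negb_or ij ik jk.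
have s3 : [set m in [:: i; j; k]] \subset S.
  by apply/fintype.subsetP => m; rewrite !inE => /or3P[] /eqP ->.
have c3 : #|[set m in [:: i; j; k]]| = 3%N by rewrite cardsE (card_uniqP u3).
have /cards1P[l E] : #|S :\: [set m in [:: i; j; k]]| == 1%N.
  by rewrite cardsD (finset.setIidPr s3) c3 (dec_card decP ST).
exists l; have : l \in [set l]%SET by rewrite inE.
rewrite -E !inE !negb_or => /andP[/and3P[li lj lk] lS]; split.
  by rewrite /= !inE !negb_or ij ik jk ![_ == l]eq_sym li lj lk.
move=> m; apply/idP/idP => [mS|]; last by rewrite !inE => /or4P[] /eqP ->.
rewrite !inE; case: eqP => //= /eqP mi; case: eqP => //= /eqP mj; case: eqP => //= /eqP mk.
have : m \in S :\: [set m in [:: i; j; k]] by rewrite !inE !negb_or mi mj mk.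
by rewrite E inE.
Qed.

Lemma quad_of2 S i j : S \in T -> i != j -> i \in S -> j \in S -> exists k l, quad S i j k l.
Proof.
move=> ST ij iS jS; have [k kS /andP[ki kj]] := third_vertex decP i j ST.
have [l q] := @quad_of3 S i j k ST ij ltac:(by rewrite eq_sym) ltac:(by rewrite eq_sym) iS jS kS.
by exists k, l.
Qed.

Lemma vol_neq0 S i j k l : S \in T -> quad S i j k l -> vol i j k l != 0.
Proof. by move=> ST q; exact: (quad_indep q (dec_indep decP ST)). Qed.

Lemma bary_last S b i j k l z : quad S i j k l -> bary p S b ->
  b l z * vol i j k l = det3 (p j - p i) (p k - p i) (z - p i).
Proof.
move=> q [b1 bx _].
have -> : z - p i = b j z *: (p j - p i) + b k z *: (p k - p i) + b l z *: (p l - p i).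
  rewrite -{1}(bx z) (sum_quad _ q).
  have -> : b i z = 1 - b j z - b k z - b l z by rewrite -(b1 z) (sum_quad _ q); ring.
  by apply: rV3P; rewrite !coordE; ring.
by rewrite /vol !det3E !coordE; ring.
Qed.

Lemma bary_eq_edge S b i j k l z : quad S i j k l -> bary p S b ->
  b k z = 0 -> b l z = 0 -> z - p i = b j z *: (p j - p i).
Proof.
move=> q [b1 bx _] bk bl.
rewrite -{1}(bx z) (sum_quad _ q) bk bl.
have -> : b i z = 1 - b j z by rewrite -(b1 z) (sum_quad _ q) bk bl; ring.
by apply: rV3P; rewrite !coordE; ring.
Qed.

(** Otherwise the two simplices would overlap just beside the barycentre of
    their common face. *)
Lemma opposite_sides S S' i j k l l' : S \in T -> S' \in T -> quad S i j k l ->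
  quad S' i j k l' -> S != S' -> vol i j k l * vol i j k l' < 0.
Proof.
move=> ST S'T q q' SS'; have [b bP] := dec_bary decP ST.
have ai := dec_indep decP ST.
have E := bary_last (p l') q bP; rewrite -/(vol i j k l') in E.
have v0 := vol_neq0 ST q; have v0' := vol_neq0 S'T q'.
have [iS jS kS lS] := quad_mem q; have [iS' jS' kS' lS'] := quad_mem q'.
have [[ij ik il] [jk jl kl]] := quad_neq q.
have [b0|b0] := ltP (b l (p l')) 0.
  by rewrite -E mulrCA nmulr_rlt0 // -expr2 exprn_even_gt0.
have {}b0 : 0 < b l (p l').
  by rewrite lt_def b0 andbT; apply: contraNneq v0' => b0'; rewrite -E b0' mul0r.
have [b1 bx _] := bP; have bv := bary_vertex ai bP.
pose a m : R := if m == l then 0 else 1/3.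
have a1 : \sum_(m in S) a m = 1.
  by rewrite (sum_quad _ q) /a (negbTE il) (negbTE jl) (negbTE kl) eqxx; lra.
pose x := \sum_(m in S) a m *: p m.
have bxm m : m \in S -> b m x = a m := bary_uniq ai bP a1 (m := m).
have pos m : m \in S -> m != l -> nbhs x [set y | 0 < b m y].
  by move=> mS ml; apply: (bary_gt0_near bP); rewrite bxm // /a (negbTE ml) divr_gt0.
have Ux : nbhs x ([set y | 0 < b i y] `&` ([set y | 0 < b j y] `&` [set y | 0 < b k y])).
  by apply: filterI; [exact: pos|apply: filterI; exact: pos].
have [s /andP[s0 s1] [yi [yj yk]]] := small_step (p l') Ux.
set y := x + _ in yi yj yk.
have S'x : hull p S' x.
  exists (fun m => if m == l' then 0 else 1/3); have [[_ _ il'] [_ jl' kl']] := quad_neq q'; split.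
  - by move=> m _; case: ifP => // _; lra.
  - by rewrite (sum_quad _ q') (negbTE il') (negbTE jl') (negbTE kl') eqxx; lra.
  - rewrite /x (sum_quad _ q) (sum_quad _ q') /a (negbTE il) (negbTE jl) (negbTE kl) eqxx.
    by rewrite (negbTE il') (negbTE jl') (negbTE kl') eqxx !scale0r.
have S'y : hull p S' y by apply: hull_convex => //; [exact: hull_vertex|lra].
have yl : 0 < b l y.
  by rewrite /y (bary_seg bP) bxm // /a eqxx add0r subr0 mulr_gt0.
have Sy : hull p S y.
  apply/(hull_fullP ai bP) => m; have [_ ->] := q; rewrite !inE.
  by move=> /or4P[] /eqP ->; exact: ltW.
have := carrier_sub decP ST S'T bP Sy S'y lS; rewrite (gt_eqF yl) => /(_ isT) l_S'.
suff SS : S = S' by rewrite SS eqxx in SS'.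
apply/eqP; rewrite eqEcard (dec_card decP ST) (dec_card decP S'T) leqnn andbT.
apply/fintype.subsetP => m; have [_ ->] := q; rewrite !inE.
by move=> /or4P[] /eqP ->.
Qed.

Lemma on_edge_open i j t : (exists S0, [/\ S0 \in T, i \in S0 & j \in S0]) -> i != j ->
  0 < t < 1 -> open_edge p [set i; j]%SET (on_edge p i j t).
Proof.
move=> ex ij t01; split; first by apply: on_edge_hull; rewrite ?set21 ?set22 //; lra.
move=> [m _ E]; have /negP := on_edge_not_vertex decP ex ij t01; apply.
by rewrite -E; exact: codom_f.
Qed.

Lemma open_edgeP i j x : i != j -> open_edge p [set i; j]%SET x ->
  exists2 t, 0 < t < 1 & x = on_edge p i j t.
Proof.
move=> ij [/(hull2P ij)[t t01 ->] nv]; exists t => //.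
have t0 : t != 0.
  by apply: contra_not_neq nv => ->; exists i => /=; rewrite ?set21 // /on_edge scale0r addr0.
have t1 : t != 1.
  by apply: contra_not_neq nv => ->; exists j => /=; rewrite ?set22 // /on_edge scale1r addrC subrK.
by move: t01; rewrite !le_eqVlt eq_sym (negbTE t0) (negbTE t1).
Qed.

(** Just beyond a face through an interior edge there are points of [P], and
    they belong to a second simplex with the same face. *)
Lemma other_side S i j k l : S \in T -> quad S i j k l ->
  (open_edge p [set i; j]%SET `<=` interior P)%classic ->
  exists2 S', S' \in T & S' != S /\ [/\ i \in S', j \in S' & k \in S'].
Proof.
move=> ST q eP; have [b bP] := dec_bary decP ST; have ai := dec_indep decP ST.
have [iS jS kS lS] := quad_mem q; have [[ij ik il] [jk jl kl]] := quad_neq q.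
have ex : exists S0, [/\ S0 \in T, i \in S0 & j \in S0] by exists S.
have n2 : 0 < (1/2 : R) < 1 by lra.
have [Bi Bj] := bary_on_edge decP (1/2) ST bP iS jS ij.
have bv := bary_vertex ai bP.
have Bk : b k (on_edge p i j (1/2)) = 0.
  by rewrite /on_edge (bary_seg bP) !bv // ![k == _]eq_sym (negbTE ik) (negbTE jk) /=; ring.
have Bl : b l (on_edge p i j (1/2)) = 0.
  by rewrite /on_edge (bary_seg bP) !bv // ![l == _]eq_sym (negbTE il) (negbTE jl) /=; ring.
have Pe : nbhs (on_edge p i j (1/2)) (interior P).
  by apply: open_nbhs_nbhs; split; [exact: open_interior|apply: eP; exact: on_edge_open].
have [s /andP[s0 s1] Py] := small_step (p k) Pe.
set y := _ + _ in Py.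
have yi : b i y = (1 - s) / 2 by rewrite /y (bary_seg bP) Bi bv // (negbTE ik) /=; lra.
have yj : b j y = (1 - s) / 2 by rewrite /y (bary_seg bP) Bj bv // (negbTE jk) /=; lra.
have yk : b k y = s by rewrite /y (bary_seg bP) Bk bv // eqxx /=; lra.
have yl : b l y = 0 by rewrite /y (bary_seg bP) Bl bv // eq_sym (negbTE kl) /=; lra.
clearbody y.
have Sy : hull p S y.
  apply/(hull_fullP ai bP) => m; have [_ ->] := q; rewrite !inE.
  by move=> /or4P[] /eqP ->; rewrite ?yi ?yj ?yk ?yl //; lra.
have U : nbhs y (P `&` [set z | forall S, S \in T -> hull p S z -> hull p S y]).
  by apply: filterI => //; exact: (near_star1 decP).
have [s' /andP[s'0 s'1] [Pz zs]] := small_step (p l + 2 *: (y - p l)) U.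
set z := y + _ in Pz zs.
have zl : b l z = - s'.
  by rewrite /z !(bary_seg bP) yl bv // eqxx /=; lra.
have [S' S'T S'z] := dec_cover decP Pz.
have S'y := zs S' S'T S'z.
exists S' => //; split.
  apply/eqP => E; rewrite E in S'z; move/(hull_fullP ai bP): S'z => /(_ l lS).
  by rewrite zl; lra.
by split; apply: (carrier_sub decP ST S'T bP Sy S'y) => //; rewrite ?yi ?yj ?yk; apply/eqP; lra.
Qed.

(** If every triangle through an edge is shared by two simplices, the simplices
    around the edge close up.  A segment avoiding the line of the edge cannot
    leave them, since its points lie inside a simplex or inside a shared
    triangle. *)
Lemma edge_interior i j : i != j ->
  (exists S0, [/\ S0 \in T, i \in S0 & j \in S0]) ->
  (forall S k l, S \in T -> quad S i j k l ->
     exists2 S', S' \in T & S' != S /\ [/\ i \in S', j \in S' & k \in S']) ->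
  (open_edge p [set i; j]%SET `<=` interior P)%classic.
Proof.
move=> ij ex two x0 /(open_edgeP ij)[t t01 ->] {x0}; set x := on_edge p i j t.
rewrite /interior /=.
have [S0 [S0T i0 j0]] := ex.
have /nbhs_normP[r /= r0 rN] := near_star decP x.
pose N := [set y | `|x - y| < r].
have NS y S : N y -> S \in T -> hull p S y -> (i \in S) && (j \in S).
  move=> Ny ST Sy; apply: (on_edge_star decP ex ij t01 ST).
  exact: (rN y Ny S S ST (subxx _) Sy).
have Npos y S b k : N y -> S \in T -> bary p S b -> hull p S y -> k \in [set i; j]%SET -> 0 < b k y.
  move=> Ny ST bP Sy kij; have /andP[iS jS] := NS _ _ Ny ST Sy.
  have ai := dec_indep decP ST.
  have kS : k \in S by move: kij; rewrite !inE => /orP[] /eqP ->.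
  have b0 : 0 <= b k y by move/(hull_fullP ai bP): Sy => /(_ k kS).
  rewrite lt_def b0 andbT; apply/eqP => bk.
  have sub : S :\ k \subset S by exact: subD1set.
  have : hull p (S :\ k) y.
    apply/(hullP ai bP sub) => m mS; split.
      by move/(hull_fullP ai bP): Sy => /(_ m mS).
    by rewrite !inE negb_and mS orbF negbK => /eqP ->.
  move=> /(rN y Ny S _ ST sub) /(hullP ai bP sub)/(_ k kS)[_].
  rewrite !inE eqxx /= => /(_ isT).
  have [Bi Bj] := bary_on_edge decP t ST bP iS jS ij.
  by move: kij; rewrite !inE => /orP[] /eqP ->; rewrite ?Bi ?Bj; lra.
have [k0 [l0 q0]] := quad_of2 S0T ij i0 j0.
have [b0 b0P] := dec_bary decP S0T; have ai0 := dec_indep decP S0T.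
have [_ _ k0S l0S] := quad_mem q0.
have Nx : nbhs x N by exact: nbhs_norm_lt.
pose g := \sum_(m in S0) (1/4 : R) *: p m.
have g1 : \sum_(m in S0) (1/4 : R) = 1 by rewrite (sum_quad _ q0); lra.
have [s /andP[s0 s1] Ny0] := small_step g Nx; set y0 := x + _ in Ny0.
have y0pos m : m \in S0 -> 0 < b0 m y0.
  move=> mS; rewrite /y0 (bary_seg b0P) (bary_uniq ai0 b0P g1 mS).
  have : 0 <= b0 m x.
    have : hull p S0 x by apply: on_edge_hull => //; lra.
    by move/(hull_fullP ai0 b0P) => /(_ m mS).
  by nra.
pose W z := det3 (p j - p i) (y0 - p i) (z - p i).
have Wlin y z u : W (y + u *: (z - y)) = W y + u * (W z - W y).
  by rewrite /W; move: (p j - p i) (y0 - p i) => A B; rewrite !det3E !coordE; ring.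
have Wy0 : W y0 = 0.
  by rewrite /W; move: (p j - p i) (y0 - p i) => A B; rewrite det3E; ring.
have Wl : W (p l0) != 0.
  have -> : W (p l0) = b0 k0 y0 * vol i j k0 l0.
    rewrite /W /vol; have := bary_last y0 (quadC q0) b0P; rewrite /vol.
    set A := det3 _ _ _ => E1; set B := det3 _ _ _.
    have -> : B = - det3 (p j - p i) (p l0 - p i) (y0 - p i) by rewrite /B !det3E; ring.
    by rewrite -E1 -mulrN; congr (_ * _); rewrite /A !det3E; ring.
  by rewrite mulf_neq0 ?(gt_eqF (y0pos _ k0S)) // (vol_neq0 S0T q0).
have Pclosed z : ~ P z -> \forall y \near z, ~ P y.
  move=> nz; near=> y => Py; apply: nz; have [S ST Sy] := dec_cover decP Py.
  apply: (dec_sub decP ST).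
  by move: S ST Sy; near: y; exact: (near_star1 decP).
have hullnear S b y : S \in T -> bary p S b -> (forall m, m \in S -> 0 < b m y) -> nbhs y P.
  move=> ST bP bpos.
  have H m : \forall z \near y, m \in S -> 0 < b m z.
    have [mS|/negP nmS] := boolP (m \in S); last by near=> z.
    by apply: filterS (bary_gt0_near bP (bpos m mS)) => z ? _.
  apply: filterS (filter_forall _ H) => z Hz; apply: (dec_sub decP ST).
  by apply/(hull_fullP (dec_indep decP ST) bP) => m mS; apply: ltW; exact: Hz.
have inside y : N y -> W y != 0 -> P y -> nbhs y P.
  move=> Ny Wy Py; have [S ST Sy] := dec_cover decP Py.
  have /andP[iS jS] := NS _ _ Ny ST Sy.
  have [k [l q]] := quad_of2 ST ij iS jS.
  have offline S1 b k1 l1 : bary p S1 b -> quad S1 i j k1 l1 -> b k1 y = 0 -> b l1 y = 0 -> False.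
    move=> bP q1 bk bl; case/eqP: Wy; rewrite /W (bary_eq_edge q1 bP bk bl).
    by rewrite !det3E !coordE; ring.
  have [b bP] := dec_bary decP ST; have ai := dec_indep decP ST.
  have bi := Npos _ _ _ _ Ny ST bP Sy (set21 i j).
  have bj := Npos _ _ _ _ Ny ST bP Sy (set22 i j).
  have onface k' l' : quad S i j k' l' -> b l' y = 0 -> nbhs y P.
    move=> q' bl; have [_ _ k'S l'S] := quad_mem q'.
    have bk : 0 < b k' y.
      rewrite lt_def; move/(hull_fullP ai bP): (Sy) => /(_ k' k'S) ->; rewrite andbT.
      by apply/eqP => bk; exact: offline bP q' bk bl.
    have [S' S'T [S'S [iS' jS' kS']]] := two S k' l' ST q'.
    have [[_ ik _] [jk _ _]] := quad_neq q'.
    have [m qm] := quad_of3 S'T ij ik jk iS' jS' kS'.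
    have SS' : S != S' by rewrite eq_sym.
    have op := opposite_sides ST S'T q' qm SS'.
    have [b' bP'] := dec_bary decP S'T; have ai' := dec_indep decP S'T.
    have same z : b l' z * vol i j k' l' = b' m z * vol i j k' m.
      by rewrite (bary_last z q' bP) (bary_last z qm bP').
    have S'y : hull p S' y.
      apply: (@hull_subset _ _ p [set m in [:: i; j; k']]).
        by apply/fintype.subsetP => m'; rewrite !inE => /or3P[] /eqP ->.
      have s3 : [set m in [:: i; j; k']] \subset S.
        by apply/fintype.subsetP => m'; rewrite !inE => /or3P[] /eqP ->.
      apply/(hullP ai bP s3) => m' m'S.
      split; first by move/(hull_fullP ai bP): Sy => /(_ m' m'S).
      have [_ Em] := q'; move: m'S; rewrite Em !inE => /or4P[] /eqP -> //; by rewrite eqxx ?orbT.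
    have b'i := Npos _ _ _ _ Ny S'T bP' S'y (set21 i j).
    have b'j := Npos _ _ _ _ Ny S'T bP' S'y (set22 i j).
    have b'm : b' m y = 0.
      by have /esym/eqP := same y; rewrite bl mul0r mulf_eq0 (negbTE (vol_neq0 S'T qm)) orbF => /eqP.
    have b'k : 0 < b' k' y.
      rewrite lt_def; move/(hull_fullP ai' bP'): (S'y) => /(_ k' kS') ->; rewrite andbT.
      by apply/eqP => bk'; exact: offline bP' qm bk' b'm.
    near=> z.
    have [zl|zl] := leP 0 (b l' z).
      apply: (dec_sub decP ST); apply/(hull_fullP ai bP) => m'; have [_ ->] := q'; rewrite !inE.
      move=> /or4P[] /eqP -> //; apply: ltW; near: z; exact: (bary_gt0_near bP).
    have zm : 0 <= b' m z.
      have := same z; move: op zl; set v1 := vol _ _ _ _; set v2 := vol _ _ _ _ => op zl E.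
      rewrite leNgt; apply/negP => bm.
      have E' : b l' z * (v1 * v1) = b' m z * (v1 * v2) by rewrite mulrA E; ring.
      have h1 : 0 < b' m z * (v1 * v2) by rewrite nmulr_rgt0.
      have sq : 0 <= v1 * v1 by rewrite -expr2 sqr_ge0.
      have h2 : b l' z * (v1 * v1) <= 0 by rewrite mulr_le0_ge0 // ltW.
      by rewrite E' in h2; move: (lt_le_trans h1 h2); rewrite ltxx.
    apply: (dec_sub decP S'T); apply/(hull_fullP ai' bP') => m'; have [_ ->] := qm; rewrite !inE.
    move=> /or4P[] /eqP -> //; apply: ltW; near: z; exact: (bary_gt0_near bP').
  have [bl|bl] := eqVneq (b l y) 0; first exact: onface q bl.
  have [bk|bk] := eqVneq (b k y) 0; first exact: onface (quadC q) bk.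
  apply: (hullnear S b y ST bP) => m; have [_ Em] := q; have [_ _ kS lS] := quad_mem q.
  rewrite Em !inE => /or4P[] /eqP -> //; rewrite lt_def ?bl ?bk /=.
    by move/(hull_fullP ai bP): Sy => /(_ k kS).
  by move/(hull_fullP ai bP): Sy => /(_ l lS).
have generic z : N z -> W z != 0 -> P z.
  move=> Nz Wz; have gN u : 0 <= u <= 1 -> N (y0 + u *: (z - y0)).
    move=> /andP[u0 u1]; rewrite /N /=.
    rewrite sub_segment.
    have u1' : 0 <= 1 - u by lra.
    apply: le_lt_trans (ler_normD _ _) _; rewrite !normrZ !ger0_norm //.
    have -> : (1 - u) * `|x - y0| + u * `|x - z| = `|x - y0| + u * (`|x - z| - `|x - y0|) by ring.
    have /andP[_ M] := seg_minmax `|x - y0| `|x - z| (introT andP (conj u0 u1)).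
    by apply: le_lt_trans M _; rewrite gt_max; apply/andP.
  have -> : z = y0 + (1 : R) *: (z - y0) by rewrite scale1r addrC subrK.
  apply: (real_induction (S := fun u => P (y0 + u *: (z - y0)))).
    rewrite scale0r addr0; apply: (dec_sub decP S0T); apply/(hull_fullP ai0 b0P) => m mS.
    exact: ltW (y0pos _ mS).
  move=> u u01; set w := y0 + u *: (z - y0).
  have dich : nbhs w P \/ nbhs w (~` P).
    have [Pw|nPw] := pselect (P w); last by right; exact: Pclosed.
    left; have [u0|u0] := eqVneq u 0.
      by rewrite /w u0 scale0r addr0; exact: (hullnear S0 b0 y0 S0T b0P y0pos).
    have Ww : W w != 0 by rewrite /w Wlin Wy0 subr0 add0r mulf_neq0.
    exact: (inside w (gN u u01) Ww Pw).
  case: dich => /near_seg1 /nbhs_normP[d /= d0 dP]; exists d => // v v' _ _ uv uv'.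
    by move=> _; exact: dP.
  by have := dP v uv.
apply: filterS Nx => z Nz; apply: contrapT => nPz.
have [Wz|Wz] := eqVneq (W z) 0; last by apply: nPz; exact: generic.
have Nz' : nbhs z N.
  have d0 : 0 < r - `|x - z| by rewrite subr_gt0.
  apply: filterS (nbhs_norm_lt z d0) => v /= zv; rewrite /N /=.
  have -> : x - v = (x - z) + (z - v) by rewrite addrA subrK.
  by apply: le_lt_trans (ler_normD _ _) _; rewrite -ltrBrDl.
have [v /andP[v0 v1] [Nv nPv]] := small_step (z + (p l0 - p i)) (filterI Nz' (Pclosed _ nPz)).
apply: nPv; apply: generic Nv _.
have E : W (z + (p l0 - p i)) = W z + W (p l0).
  by rewrite /W; move: (p j - p i) (y0 - p i) => A B; rewrite !det3E !coordE; ring.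
by rewrite Wlin E Wz !add0r subr0 mulf_neq0 // gt_eqF.
Unshelve. all: by end_near. Qed.

End Sides.

(** * Infinitesimal congruences *)

Section Killing.
Context (R : realType).
Notation X := 'rV[R]_3.
Implicit Types (a : X * X) (u v w x y : X).

(** In dimension three the antisymmetric matrices are the cross products with a
    vector, so a pair of vectors stands for an infinitesimal congruence; the
    pairs form an abelian group, the coefficients of the cohomology below. *)
Definition killing (a : X * X) (x : X) : X := cross a.1 x + a.2.

Lemma killingB a b x : killing (a - b) x = killing a x - killing b x.
Proof. by rewrite /killing; apply: rV3P; rewrite !coordE; ring. Qed.

Lemma killing_sub a x y : killing a x - killing a y = cross a.1 (x - y).
Proof. by rewrite /killing; apply: rV3P; rewrite !coordE; ring. Qed.

Lemma dot_killing a x y : dot (x - y) (killing a x - killing a y) = 0.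
Proof. by rewrite killing_sub dotE !coordE; ring. Qed.

(** The fourth point [w] only expresses that the triangle [xyz] is not
    degenerate. *)
Lemma killing0 a x y z w : det3 (y - x) (z - x) (w - x) != 0 ->
  killing a x = 0 -> killing a y = 0 -> killing a z = 0 -> a = 0.
Proof.
move=> D0 ax ay az.
have cy : cross a.1 (y - x) = 0 by rewrite -killing_sub ax ay subrr.
have cz : cross a.1 (z - x) = 0 by rewrite -killing_sub ax az subrr.
have a1 : a.1 = 0.
  apply/eqP; have /eqP := cramer3 (y - x) (z - x) (w - x) a.1.
  have -> : det3 a.1 (z - x) (w - x) = dot (cross a.1 (z - x)) (w - x).
    by rewrite det3E dotE !coordE; ring.
  have -> : det3 (y - x) a.1 (w - x) = - dot (cross a.1 (y - x)) (w - x).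
    by rewrite det3E dotE !coordE; ring.
  have -> : det3 (y - x) (z - x) a.1 = dot (cross a.1 (y - x)) (z - x).
    by rewrite det3E dotE !coordE; ring.
  by rewrite cy cz !dot0l oppr0 !scale0r !addr0 scaler_eq0 (negbTE D0).
case: a ax a1 {ay az cy cz} => a1 a2; rewrite /killing /= => + a10.
rewrite a10 => a20; congr (_, _); rewrite -[RHS]a20.
by apply: rV3P; rewrite !coordE; ring.
Qed.

(** The products of the relative velocities and the relative positions form an
    antisymmetric matrix, which determines the axis of rotation. *)
Lemma killing_exists (x0 x1 x2 x3 v0 v1 v2 v3 : X) :
  det3 (x1 - x0) (x2 - x0) (x3 - x0) != 0 ->
  dot (x1 - x0) (v1 - v0) = 0 -> dot (x2 - x0) (v2 - v0) = 0 ->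
  dot (x3 - x0) (v3 - v0) = 0 -> dot (x1 - x2) (v1 - v2) = 0 ->
  dot (x1 - x3) (v1 - v3) = 0 -> dot (x2 - x3) (v2 - v3) = 0 ->
  exists a, [/\ killing a x0 = v0, killing a x1 = v1, killing a x2 = v2 & killing a x3 = v3].
Proof.
move=> D0 e1 e2 e3 e12 e13 e23.
pose u1 := x1 - x0; pose u2 := x2 - x0; pose u3 := x3 - x0.
pose y1 := v1 - v0; pose y2 := v2 - v0; pose y3 := v3 - v0.
have s12 : dot u1 y2 = - dot u2 y1.
  apply/eqP; rewrite -subr_eq0 opprK; apply/eqP.
  have -> : dot u1 y2 + dot u2 y1 = dot (x1 - x0) (v1 - v0) + dot (x2 - x0) (v2 - v0)
      - dot (x1 - x2) (v1 - v2) by rewrite /u1 /u2 /y1 /y2 !dotE !coordE; ring.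
  by rewrite e1 e2 e12; ring.
have s13 : dot u1 y3 = - dot u3 y1.
  apply/eqP; rewrite -subr_eq0 opprK; apply/eqP.
  have -> : dot u1 y3 + dot u3 y1 = dot (x1 - x0) (v1 - v0) + dot (x3 - x0) (v3 - v0)
      - dot (x1 - x3) (v1 - v3) by rewrite /u1 /u3 /y1 /y3 !dotE !coordE; ring.
  by rewrite e1 e3 e13; ring.
have s23 : dot u2 y3 = - dot u3 y2.
  apply/eqP; rewrite -subr_eq0 opprK; apply/eqP.
  have -> : dot u2 y3 + dot u3 y2 = dot (x2 - x0) (v2 - v0) + dot (x3 - x0) (v3 - v0)
      - dot (x2 - x3) (v2 - v3) by rewrite /u2 /u3 /y2 /y3 !dotE !coordE; ring.
  by rewrite e2 e3 e23; ring.
rewrite -/u1 -/u2 -/u3 -/y1 -/y2 -/y3 in D0 e1 e2 e3.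
have [w [w23 w31 w12]] : exists w, [/\ dot w (cross u2 u3) = dot u3 y2,
     dot w (cross u3 u1) = dot u1 y3 & dot w (cross u1 u2) = dot u2 y1].
  apply: dual3.
  have -> : det3 (cross u2 u3) (cross u3 u1) (cross u1 u2) = det3 u1 u2 u3 ^+ 2.
    by rewrite !det3E !coordE; ring.
  by rewrite expf_neq0.
have tri (c d : X) : dot (cross w c) d = dot w (cross c d) by rewrite !dotE !coordE; ring.
have self (c : X) : dot (cross w c) c = 0 by rewrite !dotE !coordE; ring.
have anti (c d : X) : dot (cross w c) d = - dot w (cross d c) by rewrite !dotE !coordE; ring.
have c1 : cross w u1 = y1.
  apply/eqP; rewrite -subr_eq0; apply/eqP; apply: (dual3_uniq D0); rewrite dotBl.
  - by rewrite self (dotC y1) e1 subrr.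
  - by rewrite tri w12 (dotC y1) subrr.
  - by rewrite anti w31 s13 opprK (dotC y1) subrr.
have c2 : cross w u2 = y2.
  apply/eqP; rewrite -subr_eq0; apply/eqP; apply: (dual3_uniq D0); rewrite dotBl.
  - by rewrite anti w12 (dotC y2) s12 subrr.
  - by rewrite self (dotC y2) e2 subrr.
  - by rewrite tri w23 (dotC y2) subrr.
have c3 : cross w u3 = y3.
  apply/eqP; rewrite -subr_eq0; apply/eqP; apply: (dual3_uniq D0); rewrite dotBl.
  - by rewrite tri w31 (dotC y3) subrr.
  - by rewrite anti w23 (dotC y3) s23 subrr.
  - by rewrite self (dotC y3) e3 subrr.
have K x : killing (w, v0 - cross w x0) x = cross w (x - x0) + v0.
  by rewrite /killing /=; apply: rV3P; rewrite !coordE; ring.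
exists (w, v0 - cross w x0); split; rewrite K.
- by apply: rV3P; rewrite !coordE; ring.
- by rewrite -/u1 c1 /y1 subrK.
- by rewrite -/u2 c2 /y2 subrK.
- by rewrite -/u3 c3 /y3 subrK.
Qed.

Lemma is_derive0P (g : R -> X) D :
  is_derive (0 : R) 1 g D <-> (fun h : R => h^-1 *: (g h - g 0)) @ 0^' --> D.
Proof.
have E : (fun h : R => h^-1 *: ((g \o shift 0) (h *: 1) - g 0)) =
         (fun h : R => h^-1 *: (g h - g 0)).
  by apply/funext => h /=; rewrite addr0 [h *: 1]mulr1.
split=> [[dg <-]|gD].
  by rewrite /derive -E; exact: dg.
split; first by rewrite /derivable E; apply/cvg_ex; exists D.
by rewrite /derive E; exact: cvg_lim.
Qed.

(** The Cayley transform of an infinitesimal rotation is a rational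
    one-parameter family of rotations. *)
Lemma killing_trivial n (p v : 'I_n -> X) a :
  (forall i, v i = killing a (p i)) -> trivial_flex p v.
Proof.
move=> va; set w := a.1; set s := dot w w.
pose k (t : R) := 1 + t ^+ 2 * s / 4.
have s0 : 0 <= s by exact: dot_ge0.
have k0 t : k t != 0.
  have h : 0 <= t ^+ 2 * s by rewrite mulr_ge0 ?sqr_ge0.
  by rewrite gt_eqF // /k ltr_pwDl // divr_ge0.
pose g (t : R) (x : X) : X :=
  x + ((t / k t) *: cross w x + (t ^+ 2 / 2 / k t) *: cross w (cross w x)) + t *: a.2.
exists g, (killing a); split; [move=> t x y|move=> x|move=> x|exact: va].
- congr Num.sqrt; set z := x - y.
  pose A := t / k t; pose B := t ^+ 2 / 2 / k t.
  have -> : g t x - g t y = z + (A *: cross w z + B *: cross w (cross w z)).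
    by rewrite /g /z -/A -/B; apply: rV3P; rewrite !coordE; ring.
  have -> : dot (z + (A *: cross w z + B *: cross w (cross w z))) (z + (A *: cross w z + B *: cross w (cross w z)))
     = dot z z + (A ^+ 2 - 2 * B + B ^+ 2 * s) * dot (cross w z) (cross w z).
    by rewrite /s !dotE !coordE; ring.
  have -> : A ^+ 2 - 2 * B + B ^+ 2 * s = 0; last by rewrite mul0r addr0.
  rewrite /A /B; have := k0 t; rewrite /k; set kk := 1 + _ => kn.
  have Es : t ^+ 2 * s = 4 * (kk - 1) by rewrite /kk; field.
  have -> : (t / kk) ^+ 2 - 2 * (t ^+ 2 / 2 / kk) + (t ^+ 2 / 2 / kk) ^+ 2 * s =
    t ^+ 2 / kk ^+ 2 - t ^+ 2 / kk + t ^+ 2 * (t ^+ 2 * s) / (4 * kk ^+ 2) by field.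
  by rewrite Es; field.
- by rewrite /g mul0r expr0n /= !mul0r !scale0r !addr0.
- apply/is_derive0P.
  have lim : (fun h : R => (k h)^-1 *: cross w x + (h / 2 / k h) *: cross w (cross w x) + a.2) @ 0^'
      --> killing a x.
    have kc : k h @[h --> (0:R)^'] --> (1 : R).
      apply: cvg_trans (_ : k @ (0 : R) --> _); first by apply: cvg_app; exact: cvg_within.
      have -> : (1 : R) = k 0 by rewrite /k expr0n /= !mul0r addr0.
      apply: cvgD; first exact: cvg_cst.
      apply: cvgM; last exact: cvg_cst.
      by apply: cvgM; [exact: exprn_continuous|exact: cvg_cst].
    have kV : (k h)^-1 @[h --> (0:R)^'] --> (1 : R).
      by rewrite -[X in _ --> X]invr1; apply: cvgV => //; exact: oner_neq0.
    have -> : killing a x = 1 *: cross w x + (0 / 2 * 1) *: cross w (cross w x) + a.2.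
      by rewrite /killing scale1r !mul0r scale0r addr0.
    apply: cvgD; last exact: cvg_cst.
    apply: cvgD; first by apply: cvgZ => //; exact: cvg_cst.
    apply: cvgZ; last exact: cvg_cst.
    apply: cvgM => //; apply: cvgM; last exact: cvg_cst.
    by apply: cvg_trans (_ : id @ (0 : R) --> _); [apply: cvg_app; exact: cvg_within|exact: cvg_id].
  apply: cvg_trans lim; apply: near_eq_cvg; near=> h.
  have h0 : h != 0 by near: h; exact: nbhs_dnbhs_neq.
  rewrite /g mul0r expr0n /= !mul0r !scale0r !addr0.
  apply: rV3P; rewrite !coordE; have := k0 h; move: (k h) => kh khn; field; by rewrite h0 khn.
Unshelve. all: by end_near. Qed.

Lemma trivial_dot n (p v : 'I_n -> X) : trivial_flex p v ->
  forall i j, dot (p i - p j) (v i - v j) = 0.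
Proof.
move=> [g [Y [gc g0 gD vY]]] i j; rewrite !vY.
pose d t := g t (p i) - g t (p j).
have dd t : dot (d t) (d t) = dot (p i - p j) (p i - p j).
  by rewrite -!edist2 gc.
have L : (fun h : R => h^-1 *: (d h - d 0)) @ 0^' --> Y (p i) - Y (p j).
  have E : (fun h : R => h^-1 *: (d h - d 0)) = (fun h : R => h^-1 *: (g h (p i) - g 0 (p i)) - h^-1 *: (g h (p j) - g 0 (p j))).
    by apply/funext => h; rewrite -scalerBr; congr (_ *: _); rewrite /d; apply: rV3P; rewrite !coordE; ring.
  by rewrite E; apply: cvgB; apply/is_derive0P; exact: gD.
have L0 : (fun h : R => d h - d 0) @ 0^' --> (0 : X).
  rewrite -(scale0r (Y (p i) - Y (p j))).
  have : (fun h : R => h *: (h^-1 *: (d h - d 0))) @ 0^' --> (0 : R) *: (Y (p i) - Y (p j)).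
    apply: cvgZ => //.
    by apply: cvg_trans (_ : id @ (0 : R) --> _); [apply: cvg_app; exact: cvg_within|exact: cvg_id].
  apply: cvg_trans; apply: near_eq_cvg; near=> h.
  by rewrite scalerA mulfV ?scale1r //; near: h; exact: nbhs_dnbhs_neq.
have L1 : (fun h : R => dot (h^-1 *: (d h - d 0)) ((d h - d 0) + 2 *: d 0)) @ 0^' -->
   dot (Y (p i) - Y (p j)) (0 + 2 *: d 0).
  have L2 : (fun h : R => (d h - d 0) + 2 *: d 0) @ 0^' --> 0 + 2 *: d 0.
    by apply: cvgD; [exact: L0|exact: cvg_cst].
  exact: (@dot_cvg R _ _ _ (fun h : R => h^-1 *: (d h - d 0)) (fun h : R => (d h - d 0) + 2 *: d 0)
    _ _ L L2).
have Z : dot (Y (p i) - Y (p j)) (0 + 2 *: d 0) = 0.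
  rewrite -(cvg_lim _ L1) //; have -> : (fun h : R => dot (h^-1 *: (d h - d 0)) ((d h - d 0) + 2 *: d 0)) = cst 0.
    apply/funext => h /=; rewrite dotZl.
    have -> : dot (d h - d 0) (d h - d 0 + 2 *: d 0) = dot (d h) (d h) - dot (d 0) (d 0).
      by rewrite !dotE !coordE; ring.
    by rewrite !dd subrr mulr0.
  by apply: cvg_lim => //; exact: cvg_cst.
move: Z; rewrite add0r dotZr dotC /d !g0 => /eqP.
by rewrite mulf_eq0 pnatr_eq0 /= => /eqP.
Unshelve. all: by end_near. Qed.

End Killing.

(** * Variation of a dihedral angle *)

Section Derivatives.
Context (R : realType).
Implicit Types (f g : R -> R) (t : R).

Lemma is_derive_val f t df dg : is_derive t 1 f df -> df = dg -> is_derive t 1 f dg.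
Proof. by move=> + <-. Qed.

Lemma is_derive_mul f g t df dg : is_derive t 1 f df -> is_derive t 1 g dg ->
  is_derive t 1 (fun x => f x * g x) (df * g t + f t * dg).
Proof.
move=> Hf Hg; apply: (is_derive_val (is_deriveM Hf Hg)).
by rewrite /GRing.scale /=; ring.
Qed.

Lemma is_derive_add f g t df dg : is_derive t 1 f df -> is_derive t 1 g dg ->
  is_derive t 1 (fun x => f x + g x) (df + dg).
Proof. by move=> Hf Hg; exact: (is_deriveD Hf Hg). Qed.

Lemma is_derive_sub f g t df dg : is_derive t 1 f df -> is_derive t 1 g dg ->
  is_derive t 1 (fun x => f x - g x) (df - dg).
Proof. by move=> Hf Hg; exact: (is_deriveB Hf Hg). Qed.

Lemma is_derive_inv f t df : f t != 0 -> is_derive t 1 f df ->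
  is_derive t 1 (fun x => (f x)^-1) (- df / f t ^+ 2).
Proof.
move=> f0 Hf; apply: (is_derive_val (is_deriveV f0 Hf)).
by rewrite /GRing.scale /= !mulNr mulrC.
Qed.

Lemma is_derive_div f g t df dg : g t != 0 -> is_derive t 1 f df -> is_derive t 1 g dg ->
  is_derive t 1 (fun x => f x / g x) (df / g t - f t * dg / g t ^+ 2).
Proof.
move=> g0 Hf Hg; apply: (is_derive_val (is_derive_mul Hf (is_derive_inv g0 Hg))).
by ring.
Qed.

Lemma is_derive_sqrt f t df : 0 < f t -> is_derive t 1 f df ->
  is_derive t 1 (fun x => Num.sqrt (f x)) (df / (2 * Num.sqrt (f t))).
Proof.
move=> f0 Hf; apply: (is_derive_val (is_derive1_comp (is_derive1_sqrt f0) Hf)).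
by rewrite mulrC.
Qed.

Lemma is_derive_acos f t df : -1 < f t < 1 -> is_derive t 1 f df ->
  is_derive t 1 (fun x => acos (f x)) (- df / Num.sqrt (1 - f t ^+ 2)).
Proof.
move=> f1 Hf; apply: (is_derive_val (is_derive1_comp (is_derive1_acos f1) Hf)).
by rewrite mulNr mulrC mulNr.
Qed.

End Derivatives.

Section Dihedral.
Context (R : realType).
Notation X := 'rV[R]_3.

(** Inner product of two edges at a vertex, from squared lengths: law of
    cosines. *)
Definition gram (a b c : R) : R := (a + b - c) / 2.

(** For a tetrahedron with squared lengths [a] of the edge under consideration,
    [b], [b'] and [c], [c'] of the edges from its end points to the third and
    fourth vertex, and [d] of the opposite edge: squared altitudes over the edge,
    and inner product of the two altitude vectors. *)
Definition alt2 (a b b' : R) : R := b - gram a b b' ^+ 2 / a.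
Definition alt_dot (a b b' c c' d : R) : R :=
  gram b c d - gram a b b' * gram a c c' / a.

Definition dihfun (a b b' c c' d : R) : R :=
  acos (alt_dot a b b' c c' d / (Num.sqrt (alt2 a b b') * Num.sqrt (alt2 a c c'))).

Lemma dihedralE (x y z w : X) : x != y ->
  dihedral x y z w = dihfun (edist x y ^+ 2) (edist x z ^+ 2) (edist y z ^+ 2)
    (edist x w ^+ 2) (edist y w ^+ 2) (edist z w ^+ 2).
Proof.
move=> xy; have a0 : dot (y - x) (y - x) != 0 by rewrite dot_eq0 subr_eq0 eq_sym.
rewrite !edist2 /dihedral /angle /dihfun /enorm.
have sym (u v : X) : dot (u - v) (u - v) = dot (v - u) (v - u) by rewrite !dotE !coordE; ring.
rewrite ![dot (x - _) _]sym.
have g (u : X) : gram (dot (y - x) (y - x)) (dot (u - x) (u - x)) (dot (y - u) (y - u)) = dot (u - x) (y - x).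
  by rewrite /gram !dotE !coordE; field.
have gg : gram (dot (z - x) (z - x)) (dot (w - x) (w - x)) (dot (z - w) (z - w)) = dot (z - x) (w - x).
  by rewrite /gram !dotE !coordE; field.
have od (u v : X) : dot (orth_part (y - x) u) (orth_part (y - x) v) =
    dot u v - dot u (y - x) * dot v (y - x) / dot (y - x) (y - x).
  move: (y - x) a0 => U U0.
  by rewrite /orth_part !(dotBl, dotBr, dotZl, dotZr) (dotC U v); field.
congr acos; congr (_ / (Num.sqrt _ * Num.sqrt _)); rewrite od.
- by rewrite /alt_dot !g gg.
- by rewrite /alt2 !g expr2.
- by rewrite /alt2 !g expr2.
Qed.

Definition dgram (da db dc : R) : R := (da + db - dc) / 2.
Definition dalt2 (a b b' da db db' : R) : R :=
  db - 2 * gram a b b' * dgram da db db' / a + gram a b b' ^+ 2 * da / a ^+ 2.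
Definition dalt_dot (a b b' c c' d da db db' dc dc' dd : R) : R :=
  dgram db dc dd - (dgram da db db' * gram a c c' + gram a b b' * dgram da dc dc') / a
  + gram a b b' * gram a c c' * da / a ^+ 2.

(** Derivative of [dihfun]: the radicals of its denominator combine with those
    of the derivative of the arc cosine into one square root. *)
Definition ddihfun (a b b' c c' d da db db' dc dc' dd : R) : R :=
  - (dalt_dot a b b' c c' d da db db' dc dc' dd
     - alt_dot a b b' c c' d * (dalt2 a b b' da db db' / (2 * alt2 a b b')
                                + dalt2 a c c' da dc dc' / (2 * alt2 a c c')))
  / Num.sqrt (alt2 a b b' * alt2 a c c' - alt_dot a b b' c c' d ^+ 2).

Lemma dihfun_derive (A B B' C C' D : R -> R) (t da db db' dc dc' dd : R) :
  A t != 0 -> 0 < alt2 (A t) (B t) (B' t) -> 0 < alt2 (A t) (C t) (C' t) ->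
  alt_dot (A t) (B t) (B' t) (C t) (C' t) (D t) ^+ 2
    < alt2 (A t) (B t) (B' t) * alt2 (A t) (C t) (C' t) ->
  is_derive t 1 A da -> is_derive t 1 B db -> is_derive t 1 B' db' ->
  is_derive t 1 C dc -> is_derive t 1 C' dc' -> is_derive t 1 D dd ->
  is_derive t 1 (fun x => dihfun (A x) (B x) (B' x) (C x) (C' x) (D x))
    (ddihfun (A t) (B t) (B' t) (C t) (C' t) (D t) da db db' dc dc' dd).
Proof.
move=> A0 Wk Wl NW HA HB HB' HC HC' HD.
have Hg (f g h : R -> R) df dg dh : is_derive t 1 f df -> is_derive t 1 g dg ->
    is_derive t 1 h dh -> is_derive t 1 (fun x => gram (f x) (g x) (h x)) (dgram df dg dh).
  move=> Hf Hg Hh; have H := is_derive_mul (is_derive_sub (is_derive_add Hf Hg) Hh) (is_derive_cst (2^-1 : R) t 1).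
  by apply: (is_derive_val H); rewrite mulr0 addr0.
have Ha (f g : R -> R) df dg : is_derive t 1 f df -> is_derive t 1 g dg ->
    is_derive t 1 (fun x => alt2 (A x) (f x) (g x)) (dalt2 (A t) (f t) (g t) da df dg).
  move=> Hf Hg'; have G := Hg _ _ _ _ _ _ HA Hf Hg'.
  have H := is_derive_sub Hf (is_derive_div A0 (is_derive_mul G G) HA).
  apply: (is_derive_val H).
  by rewrite /dalt2; field.
have HN : is_derive t 1 (fun x => alt_dot (A x) (B x) (B' x) (C x) (C' x) (D x))
    (dalt_dot (A t) (B t) (B' t) (C t) (C' t) (D t) da db db' dc dc' dd).
  have H := is_derive_sub (Hg _ _ _ _ _ _ HB HC HD)
    (is_derive_div A0 (is_derive_mul (Hg _ _ _ _ _ _ HA HB HB') (Hg _ _ _ _ _ _ HA HC HC')) HA).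
  apply: (is_derive_val H).
  by rewrite /dalt_dot; field.
have HWk := Ha _ _ _ _ HB HB'; have HWl := Ha _ _ _ _ HC HC'.
have sk := is_derive_sqrt (f := fun x => alt2 (A x) (B x) (B' x)) Wk HWk; have sl := is_derive_sqrt (f := fun x => alt2 (A x) (C x) (C' x)) Wl HWl.
have sk0 : 0 < Num.sqrt (alt2 (A t) (B t) (B' t)) by rewrite sqrtr_gt0.
have sl0 : 0 < Num.sqrt (alt2 (A t) (C t) (C' t)) by rewrite sqrtr_gt0.
have skl0 : Num.sqrt (alt2 (A t) (B t) (B' t)) * Num.sqrt (alt2 (A t) (C t) (C' t)) != 0.
  by rewrite gt_eqF // mulr_gt0.
have HQ := is_derive_div (g := fun x => Num.sqrt (alt2 (A x) (B x) (B' x)) * Num.sqrt (alt2 (A x) (C x) (C' x))) skl0 HN (is_derive_mul sk sl).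
rewrite /ddihfun.
move: Wk Wl NW sk0 sl0 skl0 HQ; clear.
set N := alt_dot _ _ _ _ _ _; set Wk := alt2 _ _ _; set Wl := alt2 _ _ _.
set dN := dalt_dot _ _ _ _ _ _ _ _ _ _ _ _; set dk := dalt2 _ _ _ _ _ _; set dl := dalt2 _ _ _ _ _ _.
move=> k0 l0 NW sk0 sl0 skl0 HQ.
have ek : Num.sqrt Wk ^+ 2 = Wk by rewrite sqr_sqrtr // ltW.
have el : Num.sqrt Wl ^+ 2 = Wl by rewrite sqr_sqrtr // ltW.
have Q2 : 1 - (N / (Num.sqrt Wk * Num.sqrt Wl)) ^+ 2 = (Wk * Wl - N ^+ 2) / (Num.sqrt Wk * Num.sqrt Wl) ^+ 2.
  by rewrite exprMn exprVn exprMn ek el; field; rewrite !gt_eqF.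
have Q1 : -1 < N / (Num.sqrt Wk * Num.sqrt Wl) < 1.
  rewrite -ltr_norml -(@ltr_pXn2r _ 2) ?nnegrE ?normr_ge0 // expr1n real_normK ?num_real //.
  by rewrite -subr_gt0 Q2 divr_gt0 ?subr_gt0 // exprn_gt0 // mulr_gt0.
have H := is_derive_acos (f := fun x => alt_dot (A x) (B x) (B' x) (C x) (C' x) (D x) / (Num.sqrt (alt2 (A x) (B x) (B' x)) * Num.sqrt (alt2 (A x) (C x) (C' x)))) Q1 HQ.
apply: (is_derive_val H).
rewrite Q2 sqrtrM ?subr_ge0 ?ltW // sqrtrV ?exprn_ge0 ?mulr_ge0 ?ltW //.
rewrite sqrtr_sqr ger0_norm ?mulr_ge0 ?ltW //.
have D0 : Num.sqrt (Wk * Wl - N ^+ 2) != 0 by rewrite gt_eqF // sqrtr_gt0 subr_gt0.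
rewrite -/N -/Wk -/Wl; move: D0; set z := Num.sqrt (_ - _) => z0.
have -> : dk / (2 * Wk) = dk / (2 * Num.sqrt Wk ^+ 2) by rewrite ek.
have -> : dl / (2 * Wl) = dl / (2 * Num.sqrt Wl ^+ 2) by rewrite el.
by field; rewrite z0 !gt_eqF.
Qed.

Lemma ddihfunD (a b b' c c' d da db db' dc dc' dd ea eb eb' ec ec' ed : R) :
  ddihfun a b b' c c' d (da + ea) (db + eb) (db' + eb') (dc + ec) (dc' + ec') (dd + ed) =
  ddihfun a b b' c c' d da db db' dc dc' dd + ddihfun a b b' c c' d ea eb eb' ec ec' ed.
Proof. by rewrite /ddihfun /dalt_dot /dalt2 /dgram; ring. Qed.

Lemma ddihfunZ (x a b b' c c' d da db db' dc dc' dd : R) :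
  ddihfun a b b' c c' d (x * da) (x * db) (x * db') (x * dc) (x * dc') (x * dd) =
  x * ddihfun a b b' c c' d da db db' dc dc' dd.
Proof. by rewrite /ddihfun /dalt_dot /dalt2 /dgram; ring. Qed.

(** The opposite edge enters only through the inner product of the altitudes,
    and with a nonzero coefficient. *)
Lemma ddihfun_inj (a b b' c c' d da db db' dc dc' dd dd2 : R) :
  0 < alt2 a b b' * alt2 a c c' - alt_dot a b b' c c' d ^+ 2 ->
  ddihfun a b b' c c' d da db db' dc dc' dd = ddihfun a b b' c c' d da db db' dc dc' dd2 ->
  dd = dd2.
Proof.
move=> D0; have z0 : Num.sqrt (alt2 a b b' * alt2 a c c' - alt_dot a b b' c c' d ^+ 2) != 0.
  by rewrite gt_eqF // sqrtr_gt0.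
rewrite /ddihfun => /(mulIf (invr_neq0 z0)) /oppr_inj /addIr.
by rewrite /dalt_dot => /addIr /addIr; rewrite /dgram; lra.
Qed.

Definition sqd (x y : X) : R := dot (x - y) (x - y).
Definition dsqd (x y x' y' : X) : R := 2 * dot (x - y) (x' - y').

(** Rate of rotation about the edge [xy] of the half-plane through [z], for
    velocities [x'], [y'], [z']: the part normal to the half-plane of the velocity
    of [z] relative to its projection on the moving edge, divided by the distance
    to the edge. *)
Definition turning (x y z x' y' z' : X) : R :=
  det3 (y - x) (z - x) (z' - x' - (dot (z - x) (y - x) / dot (y - x) (y - x)) *: (y' - x'))
  / (Num.sqrt (sqd x y) * alt2 (sqd x y) (sqd x z) (sqd y z)).

Section Tetrahedron.
Context (x y z w : X).
Hypothesis D0 : det3 (y - x) (z - x) (w - x) != 0.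
Notation a := (sqd x y).
Notation b := (sqd x z).
Notation b' := (sqd y z).
Notation c := (sqd x w).
Notation c' := (sqd y w).
Notation d := (sqd z w).

Lemma sqdE (u v o : X) : sqd u v = dot (v - u) (v - u) /\ gram (sqd o u) (sqd o v) (sqd u v) = dot (u - o) (v - o).
Proof. by split; rewrite /gram /sqd !dotE !coordE; field. Qed.

Lemma edge_gt0 : 0 < a.
Proof.
rewrite /sqd dot_gt0 subr_eq0; apply: contraNneq D0 => ->.
by rewrite det3E !coordE; apply/eqP; ring.
Qed.

Lemma alt2_gt0 : 0 < alt2 a b b' /\ 0 < alt2 a c c'.
Proof.
have a0 := edge_gt0.
have A (u : X) : alt2 a (sqd x u) (sqd y u) = dot (cross (y - x) (u - x)) (cross (y - x) (u - x)) / a.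
  rewrite /alt2; have -> : gram a (sqd x u) (sqd y u) = dot (y - x) (u - x) by rewrite (sqdE _ _ _).2.
  have -> : dot (cross (y - x) (u - x)) (cross (y - x) (u - x)) = a * sqd x u - dot (y - x) (u - x) ^+ 2.
    by rewrite /sqd !dotE !coordE; ring.
  by field; rewrite gt_eqF.
rewrite !A; split; rewrite divr_gt0 // dot_gt0; apply: contraNneq D0 => E.
  have -> : det3 (y - x) (z - x) (w - x) = dot (w - x) (cross (y - x) (z - x)).
    by rewrite det3E !dotE !coordE; ring.
  by rewrite E dot0r.
have -> : det3 (y - x) (z - x) (w - x) = - dot (z - x) (cross (y - x) (w - x)).
  by rewrite det3E !dotE !coordE; ring.
by rewrite E dot0r oppr0.
Qed.

Lemma alt_detE : alt2 a b b' * alt2 a c c' - alt_dot a b b' c c' d ^+ 2 =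
  det3 (y - x) (z - x) (w - x) ^+ 2 / a.
Proof.
have a0 : a != 0 by rewrite gt_eqF // edge_gt0.
rewrite [det3 _ _ _ ^+ 2]expr2 gram_det3 /alt2 /alt_dot !(sqdE _ _ _).2.
have -> : sqd x z = dot (z - x) (z - x) by rewrite (sqdE _ _ 0).1.
have -> : sqd x w = dot (w - x) (w - x) by rewrite (sqdE _ _ 0).1.
move: a0; have -> : sqd x y = dot (y - x) (y - x) by rewrite (sqdE _ _ 0).1.
rewrite (dotC (z - x) (y - x)) (dotC (w - x) (y - x)) (dotC (w - x) (z - x)).
by move=> a0; field.
Qed.

Lemma alt_det_gt0 : 0 < alt2 a b b' * alt2 a c c' - alt_dot a b b' c c' d ^+ 2.
Proof. by rewrite alt_detE divr_gt0 ?edge_gt0 // exprn_even_gt0. Qed.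

(** The dihedral angle varies at the difference of the rates of rotation of its
    two sides.  Multiplied by the determinant, each rate becomes a Gram
    determinant, and what remains is an identity between inner products. *)
Lemma ddihfun_turning (x' y' z' w' : X) :
  ddihfun a b b' c c' d (dsqd x y x' y') (dsqd x z x' z') (dsqd y z y' z')
    (dsqd x w x' w') (dsqd y w y' w') (dsqd z w z' w') =
  Num.sg (det3 (y - x) (z - x) (w - x)) * (turning x y w x' y' w' - turning x y z x' y' z').
Proof.
have a0 := edge_gt0; have [k0 l0] := alt2_gt0.
have sa0 : 0 < Num.sqrt a by rewrite sqrtr_gt0.
have saE : Num.sqrt a ^+ 2 = a by rewrite sqr_sqrtr // ltW.
rewrite /ddihfun alt_detE sqrtrM ?sqr_ge0 // sqrtr_sqr sqrtrV ?ltW //.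
rewrite /turning.
set V := det3 (y - x) (z - x) (w - x).
set tz := z' - x' - _; set tw := w' - x' - _.
set M := _ - _ * (_ + _).
suff main : - M * a = V * det3 (y - x) (w - x) tw / alt2 a c c' - V * det3 (y - x) (z - x) tz / alt2 a b b'.
  have V0 : `|V| != 0 by rewrite normr_eq0.
  have sV : Num.sg V = V / `|V| by apply: (mulIf V0); rewrite divfK // -numEsg.
  rewrite sV.
  have -> : - M / (`|V| / Num.sqrt a) = (- M * a) / (`|V| * Num.sqrt a).
    by rewrite -{2}saE; field; rewrite V0 gt_eqF.
  by rewrite main; field; rewrite V0 !gt_eqF.
have dE (o u o' u' : X) : dsqd o u o' u' = 2 * dot (u - o) (u' - o').
  by rewrite /dsqd !dotE !coordE; ring.
have dgE (o u v o' u' v' : X) : dgram (dsqd o u o' u') (dsqd o v o' v') (dsqd u v u' v')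
    = dot (u - o) (v' - o') + dot (v - o) (u' - o').
  by rewrite /dgram /dsqd !dotE !coordE; field.
have sE (o u : X) : sqd o u = dot (u - o) (u - o) by rewrite (sqdE _ _ 0).1.
rewrite /V !gram_det3 /M /tz /tw; move: a0 k0 l0.
rewrite /alt2 /alt_dot /dalt_dot /dalt2 !dgE !(sqdE _ _ _).2 !dE !sE.
move: (y - x) (z - x) (w - x) (y' - x') (z' - x') (w' - x') => U K L U' K' L'.
rewrite (dotC K U) (dotC L U) (dotC L K) => a0 k0 l0.
rewrite !(dotBr, dotZr); field.
have clear_den (g h : R) : 0 < g - h ^+ 2 / dot U U -> g * dot U U - h ^+ 2 != 0.
  move=> gh; have -> : g * dot U U - h ^+ 2 = (g - h ^+ 2 / dot U U) * dot U U.
    by field; rewrite gt_eqF.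
  by rewrite mulf_neq0 // gt_eqF.
by rewrite gt_eqF // !clear_den.
Qed.

End Tetrahedron.

End Dihedral.

(** * The Jacobian matrix *)

Section Realization.
Context (R : realType).
Notation X := 'rV[R]_3.

(** Positivity of the leading minors of the Gram matrix at a vertex, up to
    factors. *)
Definition nondegenerate (a b b' c c' d : R) : Prop :=
  [/\ 0 < a, 0 < alt2 a b b', 0 < alt2 a c c' &
      0 < alt2 a b b' * alt2 a c c' - alt_dot a b b' c c' d ^+ 2].

Definition vec3 (a b c : R) : X := \row_k (if k == 0 then a else if k == 1 then b else c).

Lemma vec3E a b c : [/\ vec3 a b c 0 0 = a, vec3 a b c 0 1 = b & vec3 a b c 0 2 = c].
Proof. by split; rewrite mxE. Qed.

(** Cholesky decomposition of the Gram matrix. *)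
Lemma tetrahedron_exists (a b b' c c' d : R) : nondegenerate a b b' c c' d ->
  exists x y z w : X, det3 (y - x) (z - x) (w - x) != 0 /\
   ([/\ sqd x y = a, sqd x z = b & sqd y z = b'] /\
    [/\ sqd x w = c, sqd y w = c' & sqd z w = d]).
Proof.
move=> [a0 k0 l0 D0].
set g := gram a b b'; set h := gram a c c'; set N := alt_dot a b b' c c' d.
have [k0' l0'] : alt2 a b b' = b - g ^+ 2 / a /\ alt2 a c c' = c - h ^+ 2 / a by [].
set Wk := alt2 a b b' in k0 k0' D0 *; set Wl := alt2 a c c' in l0 l0' D0 *.
have r0 : 0 < Wl - N ^+ 2 / Wk.
  have -> : Wl - N ^+ 2 / Wk = (Wk * Wl - N ^+ 2) / Wk by field; rewrite gt_eqF.
  by rewrite divr_gt0.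
pose s := Num.sqrt a; pose u := Num.sqrt Wk; pose v := Num.sqrt (Wl - N ^+ 2 / Wk).
have s0 : s != 0 by rewrite gt_eqF // sqrtr_gt0.
have u0 : u != 0 by rewrite gt_eqF // sqrtr_gt0.
have v0 : v != 0 by rewrite gt_eqF // sqrtr_gt0.
have s2 : s * s = a by rewrite -expr2 sqr_sqrtr // ltW.
have u2 : u * u = Wk by rewrite -expr2 sqr_sqrtr // ltW.
have v2 : v * v = Wl - N ^+ 2 / Wk by rewrite -expr2 sqr_sqrtr // ltW.
exists 0, (vec3 s 0 0), (vec3 (g / s) u 0), (vec3 (h / s) (N / u) v).
have [y0 y1 y2] := vec3E s 0 0; have [z0 z1 z2] := vec3E (g / s) u 0.
have [w0 w1 w2] := vec3E (h / s) (N / u) v.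
have E (p q : X) : sqd p q = (p 0 0 - q 0 0) * (p 0 0 - q 0 0) + (p 0 1 - q 0 1) * (p 0 1 - q 0 1)
   + (p 0 2 - q 0 2) * (p 0 2 - q 0 2) by rewrite /sqd dotE !coordE.
rewrite det3E !E !coordE y0 y1 y2 z0 z1 z2 w0 w1 w2.
have Ek : u * u = b - g ^+ 2 / (s * s) by rewrite u2 k0' s2.
have El : v * v = c - h ^+ 2 / (s * s) - N ^+ 2 / (u * u) by rewrite v2 l0' s2 u2.
have EN : N = (b + c - d) / 2 - g * h / (s * s) by rewrite s2.
have Eg : b' = s * s + b - 2 * g by rewrite s2 /g /gram; field.
have Eh : c' = s * s + c - 2 * h by rewrite s2 /h /gram; field.
have Ed : d = b + c - 2 * (N + g * h / (s * s)) by rewrite EN; field.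
have b_ : b = u * u + g ^+ 2 / (s * s) by rewrite Ek subrK.
have c_ : c = v * v + h ^+ 2 / (s * s) + N ^+ 2 / (u * u) by rewrite El; ring.
split.
  by rewrite [X in X != 0](_ : _ = s * u * v); [rewrite !mulf_neq0|ring].
split; split.
- by rewrite -s2; ring.
- by rewrite b_; field.
- by rewrite Eg b_; field.
- by rewrite c_; field; rewrite s0 u0.
- by rewrite Eh c_; field; rewrite s0 u0.
- by rewrite Ed c_ b_; field; rewrite s0 u0.
Qed.

Lemma nondegenerate_near (A B B' C C' D : R -> R) :
  (forall f, [\/ f = A, f = B | f = B'] \/ [\/ f = C, f = C' | f = D] -> f @ (0:R) --> f 0) ->
  nondegenerate (A 0) (B 0) (B' 0) (C 0) (C' 0) (D 0) ->
  \forall t \near (0 : R), nondegenerate (A t) (B t) (B' t) (C t) (C' t) (D t).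
Proof.
move=> cv [a0 k0 l0 D0].
have cA : A @ (0:R) --> A 0 by apply: cv; left; constructor 1.
have cB : B @ (0:R) --> B 0 by apply: cv; left; constructor 2.
have cB' : B' @ (0:R) --> B' 0 by apply: cv; left; constructor 3.
have cC : C @ (0:R) --> C 0 by apply: cv; right; constructor 1.
have cC' : C' @ (0:R) --> C' 0 by apply: cv; right; constructor 2.
have cD : D @ (0:R) --> D 0 by apply: cv; right; constructor 3.
have cg (f g h : R -> R) : f @ (0:R) --> f 0 -> g @ (0:R) --> g 0 -> h @ (0:R) --> h 0 ->
    (fun t => gram (f t) (g t) (h t)) @ (0:R) --> gram (f 0) (g 0) (h 0).
  by move=> cf cg ch; apply: cvgM; [apply: cvgB => //; apply: cvgD|exact: cvg_cst].
have A0 : A 0 != 0 by rewrite gt_eqF.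
have ca (f g : R -> R) : f @ (0:R) --> f 0 -> g @ (0:R) --> g 0 ->
    (fun t => alt2 (A t) (f t) (g t)) @ (0:R) --> alt2 (A 0) (f 0) (g 0).
  move=> cf cg'; apply: cvgB => //; apply: cvgM; last exact: cvgV.
  by apply: cvgM; exact: cg.
have cN : (fun t => alt_dot (A t) (B t) (B' t) (C t) (C' t) (D t)) @ (0:R) -->
     alt_dot (A 0) (B 0) (B' 0) (C 0) (C' 0) (D 0).
  apply: cvgB; first exact: cg.
  by apply: cvgM; [apply: cvgM; exact: cg|exact: cvgV].
have ck := ca _ _ cB cB'; have cl := ca _ _ cC cC'.
have cdet : (fun t => alt2 (A t) (B t) (B' t) * alt2 (A t) (C t) (C' t)
     - alt_dot (A t) (B t) (B' t) (C t) (C' t) (D t) ^+ 2) @ (0:R) -->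
   alt2 (A 0) (B 0) (B' 0) * alt2 (A 0) (C 0) (C' 0)
     - alt_dot (A 0) (B 0) (B' 0) (C 0) (C' 0) (D 0) ^+ 2.
  by apply: cvgB; [exact: cvgM|apply: cvgM].
near=> t; split; near: t.
- exact: (cA _ (lt_nbhsr a0)).
- exact: (ck _ (lt_nbhsr k0)).
- exact: (cl _ (lt_nbhsr l0)).
- exact: (cdet _ (lt_nbhsr D0)).
Unshelve. all: by end_near. Qed.

Lemma is_derive_bigsum (I : Type) (r : seq I) (Q : pred I) (F : I -> R -> R) (dF : I -> R) (t : R) :
  (forall i, Q i -> is_derive t 1 (F i) (dF i)) ->
  is_derive t 1 (fun x => \sum_(i <- r | Q i) F i x) (\sum_(i <- r | Q i) dF i).
Proof.
move=> H; elim: r => [|i r IH].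
  rewrite big_nil; have -> : (fun x => \sum_(i <- [::] | Q i) F i x) = cst 0.
    by apply/funext => x; rewrite big_nil.
  exact: is_derive_cst.
rewrite big_cons; under eq_fun do rewrite big_cons.
by case: ifP => // Qi; apply: is_derive_add => //; exact: H.
Qed.

End Realization.

Section Lengths.
Context (R : realType) (n : nat).
Notation X := 'rV[R]_3.
Implicit Types (p q : 'I_n -> X) (S e : {set 'I_n}).

Lemma edistC (x y : X) : edist x y = edist y x.
Proof. by rewrite /edist /enorm; congr Num.sqrt; rewrite !dotE !coordE; ring. Qed.

Lemma edge_length2 q i j : i != j -> edge_length q [set i; j]%SET = edist (q i) (q j).
Proof.
move=> ij; rewrite /edge_length.
have := enum_uniq [set i; j]%SET; have := mem_enum [set i; j]%SET.
have : size (enum [set i; j]%SET) = 2%N by rewrite -cardE cards2 ij.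
case: (enum _) => [|a [|b []]] // _ E /=; rewrite inE andbT => ab.
have : a \in [:: a; b] by rewrite mem_head. have : b \in [:: a; b] by rewrite !inE eqxx orbT.
rewrite !E !inE => /orP[] /eqP Eb /orP[] /eqP Ea; rewrite Ea Eb //.
- by rewrite Ea Eb eqxx in ab.
- exact: edistC.
- by rewrite Ea Eb eqxx in ab.
Qed.

Lemma edge_length_sqr q i j : i != j -> edge_length q [set i; j]%SET ^+ 2 = sqd (q i) (q j).
Proof. by move=> ij; rewrite edge_length2 // edist2. Qed.

Lemma quad_pairs S i j k l (Pr : 'I_n -> 'I_n -> Prop) : quad S i j k l ->
  (forall a b, Pr a b -> Pr b a) -> Pr i j -> Pr i k -> Pr i l -> Pr j k -> Pr j l -> Pr k l ->
  forall a b, a \in S -> b \in S -> a != b -> Pr a b.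
Proof.
move=> [_ E] sym ij ik il jk jl kl a b; rewrite !E !inE.
move=> /or4P[] /eqP -> /or4P[] /eqP ->; rewrite ?eqxx // => _; try by [].
all: by apply: sym.
Qed.

Lemma quad_affinely_independent q S i j k l : quad S i j k l ->
  det3 (q j - q i) (q k - q i) (q l - q i) != 0 -> affinely_independent q S.
Proof.
move=> qS D0 a; rewrite !(sum_quad _ qS) => a0 E.
have E0 : a j *: (q j - q i) + a k *: (q k - q i) + a l *: (q l - q i) = 0.
  rewrite -[RHS]E; have -> : a i = - (a j + a k + a l).
    by apply/eqP; rewrite -subr_eq0 opprK -a0; apply/eqP; ring.
  by apply: rV3P; rewrite !coordE; ring.
have aj : a j = 0.
  apply: (mulIf D0); rewrite mul0r.
  transitivity (det3 (a j *: (q j - q i) + a k *: (q k - q i) + a l *: (q l - q i)) (q k - q i) (q l - q i)).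
    by rewrite !det3E !coordE; ring.
  by rewrite E0 det3E !coordE; ring.
have ak : a k = 0.
  apply: (mulIf D0); rewrite mul0r.
  transitivity (det3 (q j - q i) (a j *: (q j - q i) + a k *: (q k - q i) + a l *: (q l - q i)) (q l - q i)).
    by rewrite !det3E !coordE; ring.
  by rewrite E0 det3E !coordE; ring.
have al : a l = 0.
  apply: (mulIf D0); rewrite mul0r.
  transitivity (det3 (q j - q i) (q k - q i) (a j *: (q j - q i) + a k *: (q k - q i) + a l *: (q l - q i))).
    by rewrite !det3E !coordE; ring.
  by rewrite E0 det3E !coordE; ring.
move=> m; have [_ Em] := qS; rewrite Em !inE => /or4P[] /eqP -> //.
by move: a0; rewrite aj ak al !addr0.
Qed.

Lemma enum_edge S e : #|S| = 4%N -> #|e| = 2%N -> e \subset S ->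
  exists i j k l, [/\ enum e = [:: i; j], enum (S :\: e) = [:: k; l], quad S i j k l & e = [set i; j]%SET].
Proof.
move=> S4 e2 eS; have d2 : #|S :\: e| = 2%N by rewrite cardsD (finset.setIidPr eS) S4 e2.
rewrite !cardE in e2 d2.
have ue := enum_uniq e; have ud := enum_uniq (S :\: e).
have me := mem_enum e; have md := mem_enum (S :\: e).
case: (enum e) e2 ue me => [|i [|j []]] // _ ue me.
case: (enum (S :\: e)) d2 ud md => [|k [|l []]] // _ ud md.
exists i, j, k, l.
have E : e = [set i; j]%SET by apply/setP => m; rewrite -me !inE.
split=> //; split; last first.
  move=> m; have -> : (m \in S) = (m \in e) || (m \in S :\: e).
    by rewrite inE; have := fintype.subsetP eS m; case: (m \in e) => // /(_ isT).
  by rewrite -me -md !inE -orbA.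
rewrite -[[:: i; j; k; l]]/([:: i; j] ++ [:: k; l]) cat_uniq ue ud andbT andTb.
apply/hasPn => m; rewrite md inE me => /andP[]; by [].
Qed.

End Lengths.

Section Jacobian.
Context (R : realType) (n : nat).
Notation X := 'rV[R]_3.
Context (P : set X) (p : 'I_n -> X) (T : {set {set 'I_n}}).
Hypothesis decP : simplicial_decomposition P p T.
Implicit Types (S e : {set 'I_n}).
Local Notation r := (nb_interior_edges P p T).
Implicit Types (x : 'rV[R]_r).

(** The edges of the boundary keep their lengths. *)
Definition rate x e : R :=
  if [pick i | interior_edge (P := P) (p := p) (T := T) i == e] is Some i then x 0 i else 0.

Lemma prescribedE x t e :
  prescribed_length (actual_lengths P p T + t *: x) e = edge_length p e + t * rate x e.
Proof.
rewrite /prescribed_length /rate; case: pickP => [i /eqP <-|_]; last by rewrite mulr0 addr0.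
by rewrite !mxE.
Qed.

Lemma rateD x y e : rate (x + y) e = rate x e + rate y e.
Proof. by rewrite /rate; case: pickP => [i _|_]; rewrite ?mxE ?addr0. Qed.

Lemma rateZ (a : R) x e : rate (a *: x) e = a * rate x e.
Proof. by rewrite /rate; case: pickP => [i _|_]; rewrite ?mxE ?mulr0. Qed.

Definition len2 x t i j : R := (edge_length p [set i; j]%SET + t * rate x [set i; j]%SET) ^+ 2.
Definition dlen2 x i j : R := 2 * edge_length p [set i; j]%SET * rate x [set i; j]%SET.

Lemma dlen2D x y i j : dlen2 (x + y) i j = dlen2 x i j + dlen2 y i j.
Proof. by rewrite /dlen2 rateD mulrDr. Qed.

Lemma dlen2Z (a : R) x i j : dlen2 (a *: x) i j = a * dlen2 x i j.
Proof. by rewrite /dlen2 rateZ mulrCA. Qed.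

Definition angle_rate x S e : R :=
  if (enum e, enum (S :\: e)) is ([:: i; j], [:: k; l])
  then ddihfun (sqd (p i) (p j)) (sqd (p i) (p k)) (sqd (p j) (p k))
         (sqd (p i) (p l)) (sqd (p j) (p l)) (sqd (p k) (p l))
         (dlen2 x i j) (dlen2 x i k) (dlen2 x j k) (dlen2 x i l) (dlen2 x j l) (dlen2 x k l)
  else 0.

Lemma angle_rateD x y S e : angle_rate (x + y) S e = angle_rate x S e + angle_rate y S e.
Proof.
rewrite /angle_rate; case: (enum e) => [|i [|j []]]; rewrite ?addr0 //.
case: (enum _) => [|k [|l []]]; rewrite ?addr0 //.
by rewrite !dlen2D ddihfunD.
Qed.

Lemma angle_rateZ (a : R) x S e : angle_rate (a *: x) S e = a * angle_rate x S e.
Proof.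
rewrite /angle_rate; case: (enum e) => [|i [|j []]]; rewrite ?mulr0 //.
case: (enum _) => [|k [|l []]]; rewrite ?mulr0 //.
by rewrite !dlen2Z ddihfunZ.
Qed.

Lemma len2_cvg x i j : (fun t : R => len2 x t i j) @ (0 : R) --> len2 x 0 i j.
Proof.
have H : (fun t : R => edge_length p [set i; j]%SET + t * rate x [set i; j]%SET) @ (0 : R) -->
    edge_length p [set i; j]%SET + 0 * rate x [set i; j]%SET.
  by apply: cvgD; [exact: cvg_cst|apply: cvgM; [exact: cvg_id|exact: cvg_cst]].
by rewrite /len2; under eq_fun do rewrite expr2; rewrite expr2; apply: cvgM.
Qed.

Lemma len2_0 x i j : i != j -> len2 x 0 i j = sqd (p i) (p j).
Proof. by move=> ij; rewrite /len2 mul0r addr0 edge_length_sqr. Qed.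

Lemma len2_derive x i j : is_derive (0 : R) 1 (fun t => len2 x t i j) (dlen2 x i j).
Proof.
set c := edge_length p [set i; j]%SET; set d := rate x [set i; j]%SET.
have H : is_derive (0 : R) 1 (fun t => c + t * d) d.
  have Hc (a : R) : is_derive (0 : R) 1 (fun _ : R => a) 0 by exact: is_derive_cst.
  have Hi : is_derive (0 : R) 1 (fun t : R => t) 1 by exact: is_derive_id.
  have H := is_derive_add (Hc c) (is_derive_mul Hi (Hc d)).
  by apply: (is_derive_val H); rewrite mulr0 addr0 add0r mul1r.
have -> : (fun t => len2 x t i j) = (fun t => (c + t * d) * (c + t * d)).
  by apply/funext => t; rewrite /len2 expr2.
apply: (is_derive_val (is_derive_mul H H)).
by rewrite /dlen2 -/c -/d; ring.
Qed.

Lemma simplex_nondegenerate S i j k l : S \in T -> quad S i j k l ->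
  nondegenerate (sqd (p i) (p j)) (sqd (p i) (p k)) (sqd (p j) (p k))
    (sqd (p i) (p l)) (sqd (p j) (p l)) (sqd (p k) (p l)).
Proof.
move=> ST q; have D0 := vol_neq0 decP ST q.
have [k0 l0] := alt2_gt0 D0.
by split; [exact: edge_gt0 D0|exact: k0|exact: l0|exact: alt_det_gt0].
Qed.

Lemma len2_nondegenerate_near x S i j k l : S \in T -> quad S i j k l ->
  \forall t \near (0 : R), nondegenerate (len2 x t i j) (len2 x t i k) (len2 x t j k)
    (len2 x t i l) (len2 x t j l) (len2 x t k l).
Proof.
move=> ST q; have [[ij ik il] [jk jl kl]] := quad_neq q.
apply: nondegenerate_near.
  by move=> f [] [] ->; exact: len2_cvg.
by rewrite !len2_0 //; exact: simplex_nondegenerate ST q.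
Qed.

Lemma edge_length_gt0 S i j : S \in T -> i \in S -> j \in S -> i != j ->
  0 < edge_length p [set i; j]%SET.
Proof.
move=> ST iS jS ij; have [k [l q]] := quad_of2 decP ST ij iS jS.
have := edge_gt0 (vol_neq0 decP ST q); rewrite edge_length2 // /edist /enorm.
by rewrite sqrtr_gt0.
Qed.

(** The Gram matrix stays positive definite for nearby lengths, so they are
    realized; the prescribed lengths must moreover be positive, because they
    are square roots in the realization. *)
Lemma near_realizes x S : S \in T ->
  \forall t \near (0 : R), exists q, realizes (actual_lengths P p T + t *: x) S q.
Proof.
move=> ST; have [i [j [k [l qS]]]] := card_quad (dec_card decP ST).
have pos a b : a \in S -> b \in S -> a != b ->
    \forall t \near (0 : R), 0 < edge_length p [set a; b]%SET + t * rate x [set a; b]%SET.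
  move=> aS bS ab; have e0 := edge_length_gt0 ST aS bS ab.
  have H : (fun t : R => edge_length p [set a; b]%SET + t * rate x [set a; b]%SET) @ (0 : R) -->
      edge_length p [set a; b]%SET + 0 * rate x [set a; b]%SET.
    by apply: cvgD; [exact: cvg_cst|apply: cvgM; [exact: cvg_id|exact: cvg_cst]].
  have e0' : 0 < edge_length p [set a; b]%SET + 0 * rate x [set a; b]%SET by rewrite mul0r addr0.
  exact: (H _ (lt_nbhsr e0')).
have posall : \forall t \near (0 : R), forall a b, a \in S -> b \in S -> a != b ->
    0 < edge_length p [set a; b]%SET + t * rate x [set a; b]%SET.
  suff H a b : \forall t \near (0 : R), a \in S -> b \in S -> a != b ->
      0 < edge_length p [set a; b]%SET + t * rate x [set a; b]%SET.
    exact: (filter_forall _ (fun a => filter_forall _ (H a))).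
  have [aS|/negP naS] := boolP (a \in S); last by near=> t.
  have [bS|/negP nbS] := boolP (b \in S); last by near=> t.
  have [ab|/negP nab] := boolP (a != b); last by near=> t.
  by apply: filterS (pos a b aS bS ab) => t ? _ _ _.
near=> t.
have nd : nondegenerate (len2 x t i j) (len2 x t i k) (len2 x t j k)
    (len2 x t i l) (len2 x t j l) (len2 x t k l).
  by near: t; exact: (len2_nondegenerate_near x ST qS).
have pt : forall a b, a \in S -> b \in S -> a != b ->
    0 < edge_length p [set a; b]%SET + t * rate x [set a; b]%SET.
  by near: t; exact: posall.
have [X0 [Y0 [Z0 [W0 [D0 [[e1 e2 e3] [e4 e5 e6]]]]]]] := tetrahedron_exists nd.
have [[ij ik il] [jk jl kl]] := quad_neq qS.
pose q m := if m == i then X0 else if m == j then Y0 else if m == k then Z0 else W0.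
have qi : q i = X0 by rewrite /q eqxx.
have qj : q j = Y0 by rewrite /q eq_sym (negbTE ij) eqxx.
have qk : q k = Z0 by rewrite /q eq_sym (negbTE ik) eq_sym (negbTE jk) eqxx.
have ql : q l = W0 by rewrite /q eq_sym (negbTE il) eq_sym (negbTE jl) eq_sym (negbTE kl).
exists q; split.
  by apply: (quad_affinely_independent qS); rewrite qi qj qk ql.
move=> e /eqP/cards2P[a [b [ab ->]]]; rewrite set2_sub => /andP[aS bS].
rewrite prescribedE edge_length2 // /edist /enorm.
have -> : dot (q a - q b) (q a - q b) = len2 x t a b.
  pose Pr a b := sqd (q a) (q b) = len2 x t a b.
  apply: (quad_pairs (Pr := Pr) qS _ _ _ _ _ _ _ aS bS ab); rewrite /Pr ?qi ?qj ?qk ?ql //.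
  move=> c d; rewrite /sqd /len2 [[set d; c]%SET]finset.setUC => <-.
  by rewrite !dotE !coordE; ring.
by rewrite /len2 sqrtr_sqr gtr0_norm //; exact: pt.
Unshelve. all: by end_near. Qed.

Lemma dihedral_at_realizes x t S q i j k l : S \in T -> quad S i j k l ->
  enum [set i; j]%SET = [:: i; j] -> enum (S :\: [set i; j]%SET) = [:: k; l] ->
  realizes (actual_lengths P p T + t *: x) S q ->
  dihedral_at q S [set i; j]%SET = dihfun (len2 x t i j) (len2 x t i k) (len2 x t j k)
    (len2 x t i l) (len2 x t j l) (len2 x t k l).
Proof.
move=> ST qS e1 e2 [ai re]; rewrite /dihedral_at e1 e2.
have [[ij ik il] [jk jl kl]] := quad_neq qS; have [iS jS kS lS] := quad_mem qS.
have H a b : a \in S -> b \in S -> a != b -> edist (q a) (q b) ^+ 2 = len2 x t a b.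
  move=> aS bS ab; rewrite -edge_length2 // re ?prescribedE //.
    by rewrite cards2 ab.
  by rewrite set2_sub aS bS.
rewrite dihedralE; first by rewrite !H.
have := edge_gt0 (quad_indep qS ai); rewrite /sqd dot_gt0 subr_eq0; exact.
Qed.

Lemma interior_edge_card i : #|interior_edge (P := P) (p := p) (T := T) i| = 2%N.
Proof. by have := enum_valP i; rewrite inE => /andP[]; rewrite inE => /andP[/eqP]. Qed.

(** Near the actual lengths every simplex is realized, so [phi] is there the sum
    of the explicit functions [dihfun] of the lengths. *)
Lemma phi_derive x i : is_derive (0 : R) 1 (fun t => phi (actual_lengths P p T + t *: x) 0 i)
  (\sum_(S in T | interior_edge i \subset S) angle_rate x S (interior_edge i)).
Proof.
set e := interior_edge i.
pose F S (t : R) : R := if (enum e, enum (S :\: e)) is ([:: i; j], [:: k; l])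
  then dihfun (len2 x t i j) (len2 x t i k) (len2 x t j k) (len2 x t i l) (len2 x t j l) (len2 x t k l)
  else 0.
apply: (@near_eq_is_derive _ _ _ (fun t => \sum_(S in T | e \subset S) F S t)).
  near=> t; rewrite /phi mxE; apply: eq_bigr => S /andP[ST eS].
  have [a [b [k [l [e1 e2 qS eE]]]]] := enum_edge (dec_card decP ST) (interior_edge_card i) eS.
  have [q rq] : exists q, realizes (actual_lengths P p T + t *: x) S q.
    move: S ST {eS qS e2}; near: t; apply: filter_forall => S.
    have [ST|/negP nST] := boolP (S \in T); last by near=> t.
    by apply: filterS (near_realizes x ST) => t ? _.
  have := xgetPex p (ex_intro _ q rq); set q' := xget _ _ => rq'.
  have eE' : e = [set a; b]%SET := eE.
  rewrite -/e /F e1 e2 eE'; rewrite -/e eE' in e1 e2.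
  by rewrite (dihedral_at_realizes ST qS e1 e2 rq').
apply: is_derive_bigsum => S /andP[ST eS].
have [a [b [k [l [e1 e2 qS _]]]]] := enum_edge (dec_card decP ST) (interior_edge_card i) eS.
rewrite /F /angle_rate e1 e2.
have [[ij ik il] [jk jl kl]] := quad_neq qS.
have [a0 k0 l0 D0] := simplex_nondegenerate ST qS.
rewrite -!(len2_0 x) // in a0 k0 l0 D0 *.
have N0 : len2 x 0 a b != 0 by rewrite gt_eqF.
rewrite subr_gt0 in D0.
exact: (@dihfun_derive R (fun t => len2 x t a b) (fun t => len2 x t a k) (fun t => len2 x t b k)
  (fun t => len2 x t a l) (fun t => len2 x t b l) (fun t => len2 x t k l) 0 _ _ _ _ _ _
  N0 k0 l0 D0 (len2_derive x a b) (len2_derive x a k) (len2_derive x b k)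
  (len2_derive x a l) (len2_derive x b l) (len2_derive x k l)).
Unshelve. all: by end_near. Qed.

Lemma Lambda_mul x i : (Lambda P p T *m x^T) i 0 =
  \sum_(S in T | interior_edge i \subset S) angle_rate x S (interior_edge i).
Proof.
rewrite mxE.
have -> : \sum_(S in T | interior_edge i \subset S) angle_rate x S (interior_edge i) =
   \sum_(S in T | interior_edge i \subset S) \sum_j x 0 j * angle_rate (delta_mx 0 j) S (interior_edge i).
  apply: eq_bigr => S _; rewrite {1}(row_sum_delta x).
  rewrite (big_morph (fun y => angle_rate y S (interior_edge i)) (id1 := 0) (op1 := +%R)).
  - by apply: eq_bigr => j _; rewrite angle_rateZ.
  - by move=> y z; exact: angle_rateD.
  - by rewrite -(scale0r (0 : 'rV[R]_r)) angle_rateZ mul0r.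
rewrite exchange_big /=; apply: eq_bigr => j _.
rewrite !mxE -mulr_sumr mulrC; congr (_ * _).
by rewrite derive1E; apply: derive_val; exact: phi_derive.
Qed.

End Jacobian.

(** * Motions around an edge *)

(** The Fredholm alternative. *)
Lemma linear_system_solvable (K : fieldType) (I J : finType) (M : I -> J -> K) (b : J -> K) :
  (forall z : J -> K, (forall i, \sum_j M i j * z j = 0) -> \sum_j b j * z j = 0) ->
  exists w : I -> K, forall j, \sum_i w i * M i j = b j.
Proof.
move=> H; pose A := \matrix_(i < #|I|, j < #|J|) M (enum_val i) (enum_val j).
pose c := \row_(j < #|J|) b (enum_val j).
have reJ (F : J -> K) : \sum_j F j = \sum_(j < #|J|) F (enum_val j).
  by rewrite (reindex (@enum_val _ J)) //=; apply: onW_bij; exact: enum_val_bij.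
have reI (F : I -> K) : \sum_i F i = \sum_(i < #|I|) F (enum_val i).
  by rewrite (reindex (@enum_val _ I)) //=; apply: onW_bij; exact: enum_val_bij.
have /submxP[D cD] : (c <= A)%MS.
  rewrite submxE; apply/eqP/rowP => q; rewrite [LHS]mxE [RHS]mxE.
  have := H (fun j => cokermx A (enum_rank j) q) _.
  rewrite reJ => E; rewrite -[RHS]E.
    by apply: eq_bigr => j _; rewrite [c _ _]mxE enum_valK.
  move=> i; rewrite reJ; have := congr1 (fun B : 'M[K]_(#|I|, #|J|) => B (enum_rank i) q) (mulmx_coker A).
  rewrite /= [LHS]mxE [RHS]mxE => E'; rewrite -[RHS]E'.
  by apply: eq_bigr => j _; rewrite [A _ _]mxE enum_rankK enum_valK.
exists (fun i => D 0 (enum_rank i)) => j.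
rewrite reI; have := congr1 (fun B : 'rV[K]_#|J| => B 0 (enum_rank j)) cD; rewrite /= [LHS]mxE [RHS]mxE enum_rankK => ->.
by apply: eq_bigr => i _; rewrite [A _ _]mxE enum_valK enum_rankK.
Qed.

Section Links.
Context (R : realType) (n : nat).
Notation X := 'rV[R]_3.
Context (P : set X) (p : 'I_n -> X) (T : {set {set 'I_n}}).
Hypothesis decP : simplicial_decomposition P p T.
Hypothesis ballP : homeomorphic P (@closed_unit_ball R).
Implicit Types (S e : {set 'I_n}).
Local Notation r := (nb_interior_edges P p T).

(** The orientation of the triangle on [ij] and [k] in [S], as the sign with
    which the rate of rotation of this triangle enters the variation of the
    dihedral angle of [S] at [ij]. *)
Definition side i j S k : R := \sum_(l in S :\: [set i; j]%SET) Num.sg (vol p i j l k).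

Lemma volC i j k l : vol p i j l k = - vol p i j k l.
Proof. by rewrite /vol !det3E; ring. Qed.

Lemma link_quad S i j k l : quad S i j k l -> uniq [:: k; l] /\ S :\: [set i; j]%SET =i [:: k; l].
Proof.
move=> q; have [[ij ik il] [jk jl kl]] := quad_neq q; have [_ E] := q.
split; first by rewrite /= inE kl.
move=> m; rewrite !inE E !inE negb_or.
have [->|mi] := eqVneq m i; first by rewrite (negbTE ik) (negbTE il).
by have [->|mj] := eqVneq m j; first by rewrite (negbTE jk) (negbTE jl).
Qed.

Lemma sum_link (V : nmodType) S i j k l (F : 'I_n -> V) : quad S i j k l ->
  \sum_(m in S :\: [set i; j]%SET) F m = F k + F l.
Proof. by move=> /link_quad[u E]; rewrite (sum_seq_set F u E) !big_cons big_nil addr0. Qed.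

Lemma side_quad S i j k l : quad S i j k l -> side i j S k = - Num.sg (vol p i j k l).
Proof.
move=> q; rewrite /side (sum_link _ q) (volC i j k l) sgrN.
have -> : vol p i j k k = 0 by rewrite /vol det3E; ring.
by rewrite sgr0 add0r.
Qed.

Lemma quad_link S i j k : S \in T -> i != j -> [set i; j]%SET \subset S ->
  k \in S :\: [set i; j]%SET -> exists l, quad S i j k l.
Proof.
move=> ST ij; rewrite set2_sub !inE negb_or => /andP[iS jS] /andP[/andP[ki kj] kS].
by apply: (quad_of3 decP ST ij); rewrite // eq_sym.
Qed.

Lemma side_neq0 S i j k : S \in T -> i != j -> [set i; j]%SET \subset S ->
  k \in S :\: [set i; j]%SET -> side i j S k != 0.
Proof.
move=> ST ij eS kS; have [l q] := quad_link ST ij eS kS.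
by rewrite (side_quad q) oppr_eq0 sgr_eq0 (vol_neq0 decP ST q).
Qed.

Lemma side_opp S S' i j k : S \in T -> S' \in T -> i != j ->
  [set i; j]%SET \subset S -> [set i; j]%SET \subset S' ->
  k \in S :\: [set i; j]%SET -> k \in S' :\: [set i; j]%SET -> S != S' ->
  side i j S' k = - side i j S k.
Proof.
move=> ST S'T ij eS eS' kS kS' SS'.
have [l q] := quad_link ST ij eS kS; have [l' q'] := quad_link S'T ij eS' kS'.
rewrite (side_quad q) (side_quad q') opprK.
have := opposite_sides decP ST S'T q q' SS'.
have [v0|v0|->] := ltgtP (vol p i j k l) 0; last by rewrite mul0r ltxx.
- by rewrite nmulr_rlt0 // => v1; rewrite (ltr0_sg v0) gtr0_sg.
- by rewrite pmulr_rlt0 // => v1; rewrite (gtr0_sg v0) ltr0_sg // opprK.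
Qed.

(** Three simplices with a common triangle would lie pairwise on opposite sides
    of it. *)
Lemma sum_triangle2 S S' i j k (F : {set 'I_n} -> R) : S \in T -> S' \in T -> i != j ->
  [set i; j]%SET \subset S -> [set i; j]%SET \subset S' ->
  k \in S :\: [set i; j]%SET -> k \in S' :\: [set i; j]%SET -> S != S' ->
  \sum_(U in T | ([set i; j]%SET \subset U) && (k \in U :\: [set i; j]%SET)) F U = F S + F S'.
Proof.
move=> ST S'T ij eS eS' kS kS' SS'.
rewrite (bigD1 S) /=; last by rewrite ST eS kS.
rewrite (bigD1 S') /=; last by rewrite S'T eS' kS' eq_sym SS'.
rewrite big1 ?addr0 // => U /andP[/andP[/and3P[UT eU kU] US] US'].
have o1 := side_opp ST S'T ij eS eS' kS kS' SS'.
have o2 := side_opp UT ST ij eU eS kU kS US.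
have o3 := side_opp UT S'T ij eU eS' kU kS' US'.
have := side_neq0 UT ij eU kU; move: o3; rewrite o1 o2 opprK => /eqP.
by rewrite -subr_eq0 opprK -mulr2n mulrn_eq0 /= => /eqP ->; rewrite eqxx.
Qed.

Lemma interior_edge_balance i j k : i != j ->
  (open_edge p [set i; j]%SET `<=` interior P)%classic ->
  \sum_(S in T | ([set i; j]%SET \subset S) && (k \in S :\: [set i; j]%SET)) side i j S k = 0.
Proof.
move=> ij eI; have [[S [ST eS kS]]|no] :=
    pselect (exists S, [/\ S \in T, [set i; j]%SET \subset S & k \in S :\: [set i; j]%SET]); last first.
  by rewrite big1 // => S /and3P[ST eS kS]; case: no; exists S.
have [l q] := quad_link ST ij eS kS.
have [S' S'T [S'S [iS' jS' kS']]] := other_side decP ST q eI.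
have eS' : [set i; j]%SET \subset S' by rewrite set2_sub iS' jS'.
have kS'' : k \in S' :\: [set i; j]%SET by move: kS; rewrite !inE kS' andbT => /andP[].
have SS' : S != S' by rewrite eq_sym.
by rewrite (sum_triangle2 _ ST S'T) // (side_opp ST S'T) // subrr.
Qed.

Definition has_rates (x : 'rV[R]_r) S (v : 'I_n -> X) :=
  forall a b, a \in S -> b \in S -> a != b ->
  dsqd (p a) (p b) (v a) (v b) = dlen2 x a b.

Lemma dsqdC (y z y' z' : X) : dsqd y z y' z' = dsqd z y z' y'.
Proof. by rewrite /dsqd !dotE !coordE; ring. Qed.

Lemma dlen2C (x : 'rV[R]_r) a b : dlen2 x a b = dlen2 x b a.
Proof. by rewrite /dlen2 [[set a; b]%SET]finset.setUC. Qed.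

Definition turn (v : 'I_n -> X) i j k : R := turning (p i) (p j) (p k) (v i) (v j) (v k).

Lemma turn_sum v S i j k l : quad S i j k l ->
  \sum_(m in S :\: [set i; j]%SET) side i j S m * turn v i j m =
  Num.sg (vol p i j k l) * (turn v i j l - turn v i j k).
Proof.
move=> q; rewrite (sum_link _ q) (side_quad q) (side_quad (quadC q)) (volC i j k l) sgrN.
by ring.
Qed.

Lemma angle_rate_quad (x : 'rV[R]_r) S i j : S \in T -> enum [set i; j]%SET = [:: i; j] ->
  i != j -> [set i; j]%SET \subset S ->
  exists k l, quad S i j k l /\ angle_rate x S [set i; j]%SET =
    ddihfun (sqd (p i) (p j)) (sqd (p i) (p k)) (sqd (p j) (p k))
         (sqd (p i) (p l)) (sqd (p j) (p l)) (sqd (p k) (p l))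
         (dlen2 x i j) (dlen2 x i k) (dlen2 x j k) (dlen2 x i l) (dlen2 x j l) (dlen2 x k l).
Proof.
move=> ST eE ij eS; have e2 : #|[set i; j]%SET| = 2%N by rewrite cards2 ij.
have [a [b [k [l [e1 e2' q _]]]]] := enum_edge (dec_card decP ST) e2 eS.
move: (e1); rewrite eE => -[ai bj]; rewrite -ai -bj in q.
by exists k, l; rewrite /angle_rate eE e2'.
Qed.

Lemma angle_rate_turn (x : 'rV[R]_r) S v i j : S \in T -> enum [set i; j]%SET = [:: i; j] ->
  i != j -> [set i; j]%SET \subset S -> has_rates x S v ->
  angle_rate x S [set i; j]%SET = \sum_(m in S :\: [set i; j]%SET) side i j S m * turn v i j m.
Proof.
move=> ST eE ij eS hr; have [k [l [q ->]]] := angle_rate_quad x ST eE ij eS.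
rewrite (turn_sum _ q) /turn -(ddihfun_turning (vol_neq0 decP ST q)).
have [[_ ik il] [jk jl kl]] := quad_neq q; have [iS jS kS lS] := quad_mem q.
by rewrite !hr.
Qed.

(** In the sum of the variations of the dihedral angles at an interior edge, each
    triangle on the edge turns once forward and once backward. *)
Lemma Lambda_flex (x : 'rV[R]_r) v : (forall S, S \in T -> has_rates x S v) ->
  Lambda P p T *m x^T = 0.
Proof.
move=> hr; apply/colP => m; rewrite (Lambda_mul decP) [RHS]mxE.
have := enum_valP m; rewrite -/(interior_edge m) inE => /andP[eT /asboolP eI].
have e2 := interior_edge_card m.
have [i [j [eE eEE]]] : exists i j, enum (interior_edge m) = [:: i; j] /\ interior_edge m = [set i; j]%SET.
  have [S ST eS] : exists2 S, S \in T & interior_edge m \subset S.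
    by move: eT; rewrite inE => /andP[_ /existsP[S /andP[? ?]]]; exists S.
  by have [i [j [k [l [? _ _ ?]]]]] := enum_edge (dec_card decP ST) e2 eS; exists i, j.
rewrite eEE in eE eI e2 *; have ij : i != j by move: e2; rewrite cards2; case: (i != j).
under eq_bigr => S /andP[ST eS] do rewrite (angle_rate_turn ST eE ij eS (hr S ST)).
rewrite (exchange_big_dep predT) //=.
rewrite big1 // => k _.
transitivity ((\sum_(S in T | ([set i; j]%SET \subset S) && (k \in S :\: [set i; j]%SET)) side i j S k)
   * turn v i j k).
  by rewrite mulr_suml; apply: eq_bigl => S; rewrite andbA.
by rewrite interior_edge_balance // mul0r.
Qed.

(** By the Fredholm alternative, the only obstruction is the variation of the
    total angle, and only when the edge is interior. *)
Lemma turns_exist (x : 'rV[R]_r) i j : Lambda P p T *m x^T = 0 ->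
  enum [set i; j]%SET = [:: i; j] -> i != j -> (exists2 S, S \in T & [set i; j]%SET \subset S) ->
  exists w : 'I_n -> R, forall S, S \in T -> [set i; j]%SET \subset S ->
    \sum_(k in S :\: [set i; j]%SET) side i j S k * w k = angle_rate x S [set i; j]%SET.
Proof.
move=> Lx eE ij [S0 S0T e0].
pose star S := (S \in T) && ([set i; j]%SET \subset S).
pose M (k : 'I_n) S : R := if star S && (k \in S :\: [set i; j]%SET) then side i j S k else 0.
pose b S : R := if star S then angle_rate x S [set i; j]%SET else 0.
have [z Mz|w wP] := @linear_system_solvable R _ _ M b; last first.
  exists w => S ST eS; have := wP S; rewrite /b /star ST eS /= => <-.
  rewrite big_mkcond /=; apply: eq_bigr => k _; rewrite /M /star ST eS /=.
  by case: ifP => _; rewrite ?mulr0 // mulrC.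
have Mz' k : \sum_(S in T | ([set i; j]%SET \subset S) && (k \in S :\: [set i; j]%SET)) side i j S k * z S = 0.
  rewrite -[RHS](Mz k) [RHS](bigID (fun S => star S && (k \in S :\: [set i; j]%SET))) /=.
  rewrite [X in _ = _ + X]big1 ?addr0; last by move=> S /negbTE; rewrite /M => ->; rewrite mul0r.
  apply: eq_big => [S|S]; first by rewrite /star andbA.
  by move=> H; rewrite /M /star -andbA H.
(* A solution [z] of the dual system is constant on the star of the edge: at a
   triangle shared by [S] and [S'] the two terms carry opposite signs. *)
have zc S S' : S \in T -> S' \in T -> [set i; j]%SET \subset S -> [set i; j]%SET \subset S' -> z S = z S'.
  apply: (edge_star_connected decP ballP ij) => {}S {}S' ST S'T eS eS' c3.
  have [->//|SS'] := eqVneq S S'.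
  have [k kSS'] : exists k, k \in (S :&: S') :\: [set i; j]%SET.
    apply/set0Pn; rewrite -card_gt0 cardsD subn_gt0.
    apply: leq_trans c3; rewrite ltnS; apply: leq_trans (subset_leq_card (finset.subsetIr _ _)) _.
    by rewrite cards2; case: (i != j).
  have kS : k \in S :\: [set i; j]%SET by move: kSS'; rewrite !inE => /andP[-> /andP[->]].
  have kS' : k \in S' :\: [set i; j]%SET by move: kSS'; rewrite !inE => /andP[-> /andP[_ ->]].
  have := Mz' k; rewrite (sum_triangle2 _ ST S'T) // (side_opp ST S'T) //.
  rewrite mulNr -mulrBr => /eqP; rewrite mulf_eq0 (negbTE (side_neq0 ST ij eS kS)) subr_eq0.
  by move/eqP.
have bz : \sum_S b S * z S = z S0 * \sum_(S in T | [set i; j]%SET \subset S) angle_rate x S [set i; j]%SET.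
  rewrite (bigID star) /= [X in _ + X]big1 ?addr0; last first.
    by move=> S /negbTE; rewrite /b => ->; rewrite mul0r.
  rewrite mulr_sumr; apply: eq_big => [S|S st]; first by rewrite /star.
  by rewrite /b st mulrC; move: st => /andP[ST eS]; rewrite (zc S S0).
rewrite bz.
have eT : [set i; j]%SET \in edges T.
  by rewrite inE cards2 ij /=; apply/existsP; exists S0; rewrite S0T.
have [eI|eI] := boolP ([set i; j]%SET \in interior_edges P p T).
  pose m : 'I_r := enum_rank_in eI [set i; j]%SET.
  have mE : interior_edge m = [set i; j]%SET by rewrite /interior_edge enum_rankK_in.
  have := congr1 (fun B : 'cV[R]_r => B m 0) Lx; rewrite /= (Lambda_mul decP) mE [RHS]mxE => ->.
  by rewrite mulr0.
(* Around an edge of the boundary some triangle belongs to one simplex only, so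
   that the equation of this triangle makes [z] vanish. *)
suff -> : z S0 = 0 by rewrite mul0r.
move: S0T e0 => /[dup] S0T; rewrite set2_sub => _ /andP[i0 j0].
apply: contrapT => z0; move/negP: eI; apply; rewrite inE eT /=; apply/asboolP.
apply: (edge_interior decP ij); first by exists S0.
move=> S k l ST q; have [iS jS kS lS] := quad_mem q.
have eS : [set i; j]%SET \subset S by rewrite set2_sub iS jS.
have kS' : k \in S :\: [set i; j]%SET.
  by have [[_ ik _] [jk _ _]] := quad_neq q; rewrite !inE negb_or kS ![k == _]eq_sym ik jk.
apply: contrapT => no; apply: z0.
have := Mz' k; rewrite (bigD1 S) /=; last by rewrite ST eS kS'.
rewrite big1 ?addr0; last first.
  move=> S' /andP[/and3P[S'T eS' kS'']] S'S; case: no; exists S' => //; split=> //.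
  by move: eS' kS''; rewrite set2_sub !inE => /andP[-> ->] /andP[_ ->].
move/eqP; rewrite mulf_eq0 (negbTE (side_neq0 ST ij eS kS')) /= => /eqP <-.
by apply: zc; rewrite ?set2_sub ?i0 ?j0 ?iS ?jS.
Qed.

(** The velocity of a vertex [k] around the edge is determined by the variations
    of its distances to [i] and [j] and by the rate of rotation of the triangle
    [ijk].  The length opposite to the edge in a simplex then varies as it
    should, because the dihedral angle does. *)
Lemma edge_motion (x : 'rV[R]_r) i j : Lambda P p T *m x^T = 0 ->
  enum [set i; j]%SET = [:: i; j] -> i != j -> (exists2 S, S \in T & [set i; j]%SET \subset S) ->
  exists v, forall S, S \in T -> [set i; j]%SET \subset S -> has_rates x S v.
Proof.
move=> Lx eE ij ex; have [w wP] := turns_exist Lx eE ij ex.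
set U := p j - p i.
have a0 : 0 < dot U U.
  have [S ST eS] := ex; have [k [l [q _]]] := angle_rate_quad x ST eE ij eS.
  by have := edge_gt0 (vol_neq0 decP ST q); rewrite (sqdE _ _ 0).1.
pose vj := (dlen2 x i j / (2 * dot U U)) *: U.
have vjU : dot U vj = dlen2 x i j / 2 by rewrite /vj dotZr; field; rewrite gt_eqF.
have ex_k k : exists vk : X, forall S l, S \in T -> quad S i j k l ->
    [/\ dsqd (p i) (p k) 0 vk = dlen2 x i k, dsqd (p j) (p k) vj vk = dlen2 x j k &
        turning (p i) (p j) (p k) 0 vj vk = w k].
  have [[S [l [ST q]]]|no] := pselect (exists S l, S \in T /\ quad S i j k l); last first.
    by exists 0 => S l ST q; case: no; exists S, l.
  have D0 := vol_neq0 decP ST q; set K := p k - p i.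
  have N0 : det3 K U (cross U K) != 0.
    have -> : det3 K U (cross U K) = - dot (cross U K) (cross U K).
      by rewrite det3E dotE !coordE; ring.
    rewrite oppr_eq0 dot_eq0; apply: contraNneq D0 => E.
    have -> : vol p i j k l = dot (p l - p i) (cross U K).
      by rewrite /vol /U /K det3E !dotE !coordE; ring.
    by rewrite E dot0r.
  have [k0 _] := alt2_gt0 D0.
  have sa0 : 0 < Num.sqrt (sqd (p i) (p j)) by rewrite sqrtr_gt0; exact: edge_gt0 D0.
  have t0 : Num.sqrt (sqd (p i) (p j)) * alt2 (sqd (p i) (p j)) (sqd (p i) (p k)) (sqd (p j) (p k)) != 0.
    by rewrite mulf_neq0 // gt_eqF.
  have [vk [vK vU vN]] := dual3 (dlen2 x i k / 2)
    (dot U vj - dot K vj + dlen2 x i k / 2 - dlen2 x j k / 2)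
    (w k * (Num.sqrt (sqd (p i) (p j)) * alt2 (sqd (p i) (p j)) (sqd (p i) (p k)) (sqd (p j) (p k)))) N0.
  exists vk => _ _ _ _; split.
  - have -> : dsqd (p i) (p k) 0 vk = 2 * dot vk K by rewrite /dsqd /K !dotE !coordE; ring.
    by rewrite vK; field.
  - have -> : dsqd (p j) (p k) vj vk = 2 * (dot U vj - dot vk U - dot K vj + dot vk K).
      by rewrite /dsqd /K /U !dotE !coordE; ring.
    by rewrite vU vK; field.
  - rewrite /turning -/U -/K.
    have -> : det3 U K (vk - 0 - (dot K U / dot U U) *: (vj - 0)) = dot vk (cross U K).
      by rewrite /vj !det3E !dotE !coordE; ring.
    by rewrite vN mulfK.
have [vk vkP] := choice ex_k.
exists (fun m => if m == i then 0 else if m == j then vj else vk m) => S ST eS.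
have [k [l [q aE]]] := angle_rate_quad x ST eE ij eS.
have [[_ ik il] [jk jl kl]] := quad_neq q.
set v := fun m => _.
have vi : v i = 0 by rewrite /v eqxx.
have vj' : v j = vj by rewrite /v eq_sym (negbTE ij) eqxx.
have vk' : v k = vk k by rewrite /v ![k == _]eq_sym (negbTE ik) (negbTE jk).
have vl' : v l = vk l by rewrite /v ![l == _]eq_sym (negbTE il) (negbTE jl).
have [ek ejk tk] := vkP k S l ST q.
have [el ejl tl] := vkP l S k ST (quadC q).
have eij : dsqd (p i) (p j) 0 vj = dlen2 x i j.
  have -> : dsqd (p i) (p j) 0 vj = 2 * dot U vj by rewrite /dsqd /U !dotE !coordE; ring.
  by rewrite vjU; field.
have ekl : dlen2 x k l = dsqd (p k) (p l) (vk k) (vk l).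
  have E : angle_rate x S [set i; j]%SET =
      ddihfun (sqd (p i) (p j)) (sqd (p i) (p k)) (sqd (p j) (p k))
         (sqd (p i) (p l)) (sqd (p j) (p l)) (sqd (p k) (p l))
         (dlen2 x i j) (dlen2 x i k) (dlen2 x j k) (dlen2 x i l) (dlen2 x j l)
         (dsqd (p k) (p l) (vk k) (vk l)).
    rewrite -eij -ek -ejk -el -ejl (ddihfun_turning (vol_neq0 decP ST q)) tk tl -wP //.
    rewrite (sum_link _ q) (side_quad q) (side_quad (quadC q)) (volC i j k l) sgrN /vol.
    by ring.
  exact: (ddihfun_inj (alt_det_gt0 (vol_neq0 decP ST q)) (etrans (esym aE) E)).
apply: (quad_pairs (Pr := fun a b => dsqd (p a) (p b) (v a) (v b) = dlen2 x a b) q).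
- by move=> a b; rewrite dsqdC dlen2C.
- by rewrite vi vj'.
- by rewrite vi vk'.
- by rewrite vi vl'.
- by rewrite vj' vk'.
- by rewrite vj' vl'.
- by rewrite vk' vl' ekl.
Qed.

End Links.

(** * Gluing *)

Lemma subr_trans (A : zmodType) (x y z : A) : y - x + (z - y) = z - x.
Proof. by rewrite [LHS]addrC addrA subrK. Qed.

Section Gluing.
Context (R : realType) (n : nat).
Notation X := 'rV[R]_3.
Context (P : set X) (p : 'I_n -> X) (T : {set {set 'I_n}}).
Hypothesis decP : simplicial_decomposition P p T.
Hypothesis ballP : homeomorphic P (@closed_unit_ball R).
Implicit Types (S e : {set 'I_n}).
Local Notation r := (nb_interior_edges P p T).

Lemma killing_simplex S (u v : 'I_n -> X) : S \in T ->
  (forall a b, a \in S -> b \in S -> a != b ->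
     dsqd (p a) (p b) (u a) (u b) = dsqd (p a) (p b) (v a) (v b)) ->
  exists k, forall m, m \in S -> killing k (p m) = u m - v m.
Proof.
move=> ST uv; have [i [j [k [l q]]]] := card_quad (dec_card decP ST).
have [[ij ik il] [jk jl kl]] := quad_neq q; have [iS jS kS lS] := quad_mem q.
have H a b : a \in S -> b \in S -> a != b -> dot (p a - p b) ((u a - v a) - (u b - v b)) = 0.
  move=> aS bS ab; have := uv a b aS bS ab; rewrite /dsqd => E.
  have -> : dot (p a - p b) ((u a - v a) - (u b - v b)) =
     (2 * dot (p a - p b) (u a - u b) - 2 * dot (p a - p b) (v a - v b)) / 2.
    by rewrite !dotE !coordE; field.
  by rewrite E subrr mul0r.
have [c [ci cj ck cl]] := killing_exists (vol_neq0 decP ST q)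
  (H j i jS iS ltac:(by rewrite eq_sym)) (H k i kS iS ltac:(by rewrite eq_sym))
  (H l i lS iS ltac:(by rewrite eq_sym)) (H j k jS kS jk) (H j l jS lS jl) (H k l kS lS kl).
by exists c => m; have [_ ->] := q; rewrite !inE => /or4P[] /eqP ->.
Qed.

Lemma killing_eq S S' (a b : X * X) : S \in T -> (3 <= #|S :&: S'|)%N ->
  (forall m, m \in S :&: S' -> killing a (p m) = killing b (p m)) -> a = b.
Proof.
move=> ST c3 H.
have [i [j [k [iS jS kS [ij ik jk]]]]] : exists i j k, [/\ i \in S :&: S', j \in S :&: S',
   k \in S :&: S' & [/\ i != j, i != k & j != k]].
  have : (2 < #|S :&: S'|)%N by [].
  move=> /card_gt2P[i [j [k [[iA jA kA] [ij jk ki]]]]]; exists i, j, k; split=> //.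
  by split=> //; rewrite eq_sym.
have inS m : m \in S :&: S' -> m \in S by rewrite inE => /andP[].
have [l q] := quad_of3 decP ST ij ik jk (inS _ iS) (inS _ jS) (inS _ kS).
have Z m : m \in S :&: S' -> killing (a - b) (p m) = 0.
  by move=> mS; rewrite killingB H // subrr.
apply/eqP; rewrite -subr_eq0; apply/eqP.
exact: (killing0 (vol_neq0 decP ST q) (Z _ iS) (Z _ jS) (Z _ kS)).
Qed.

(** The infinitesimal congruences of two simplices with a common triangle are
    equal, and the simplices are connected through triangles. *)
Lemma isometric_trivial (v : 'I_n -> X) :
  (forall S, S \in T -> forall a b, a \in S -> b \in S -> a != b ->
     dot (p a - p b) (v a - v b) = 0) -> trivial_flex p v.
Proof.
move=> H.
have ex S : exists k, S \in T -> forall m, m \in S -> killing k (p m) = v m.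
  have [ST|nST] := boolP (S \in T); last by exists 0.
  have [|k kP] := killing_simplex (u := v) (v := fun=> 0) ST.
    by move=> a b aS bS ab; rewrite /dsqd (H S) // subrr dot0r.
  by exists k => _ m mS; rewrite kP // subr0.
have [K KP] := choice ex.
have KK : forall S S', S \in T -> S' \in T -> K S = K S'.
  apply: (faces_connected decP ballP) => S S' ST S'T c3.
  apply: (killing_eq ST c3) => m; rewrite inE => /andP[mS mS'].
  by rewrite !KP.
have [[S0 S0T]|no] := pselect (exists S, S \in T); last first.
  apply: (@killing_trivial _ _ _ _ 0) => i.
  by have [S ST _] := dec_vertex decP i; case: no; exists S.
apply: (@killing_trivial _ _ _ _ (K S0)) => i.
have [S ST iS] := dec_vertex decP i.
by rewrite (KK S0 S) // KP.
Qed.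

Lemma common_edge w : P w -> not_vertex p w -> exists i j, i != j /\
  forall S, S \in T -> hull p S w -> [set i; j]%SET \subset S.
Proof.
move=> Pw nw; have [S ST Sw] := dec_cover decP Pw; have [b bP] := dec_bary decP ST.
have [i [j [iS jS ij bi bj]]] := bary_neq0_two ST bP nw.
exists i, j; split=> // S' S'T S'w; rewrite set2_sub.
by apply/andP; split; [exact: (carrier_sub decP ST S'T bP Sw S'w iS bi)|exact: (carrier_sub decP ST S'T bP Sw S'w jS bj)].
Qed.

Lemma hull_not_vertex_convex S : S \in T -> convexS (hull p S `&` [set x | not_vertex p x]).
Proof.
move=> ST x y t [Sx nx] [Sy ny] t01.
have Sz : hull p S (x + t *: (y - x)) by apply: hull_convex.
split=> //=; apply/negP => /codomP[m E].
have mS : m \in S by apply: (vertex_in_hull decP ST); rewrite -E.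
have sub : [set m]%SET \subset S by rewrite finset.sub1set.
have one z : hull p [set m]%SET z -> z = p m.
  by move=> [a [_]]; rewrite !big_set1 => -> ->; rewrite scale1r.
have nv z : not_vertex p z -> ~ hull p [set m]%SET z.
  by move=> nz /one zE; case/negP: nz; rewrite zE codom_f.
have [_ /=] := hullD_convex decP ST sub (conj Sx (nv _ nx)) (conj Sy (nv _ ny)) t01.
by apply; rewrite E; apply: hull_vertex; rewrite inE.
Qed.

(** Here [al e] labels the simplices around the edge [e], and the hypothesis says
    that the difference of the labels of two simplices does not depend on the
    edge that they share.  These differences define a cocycle on the polyhedron
    without its vertices: send two nearby points to the difference for simplices
    [sig] that contain them.  A primitive, corrected by the difference between
    [sig y] and [S], is constant on each simplex [S]; this constant is [b S]. *)
Lemma star_cocycle_trivial (A : zmodType) (al : {set 'I_n} -> {set 'I_n} -> A) :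
  (forall S S' e e', S \in T -> S' \in T -> #|e| = 2%N -> #|e'| = 2%N ->
     e \subset S :&: S' -> e' \subset S :&: S' -> al e S' - al e S = al e' S' - al e' S) ->
  exists b : {set 'I_n} -> A, forall S S' e, S \in T -> S' \in T -> #|e| = 2%N ->
     e \subset S :&: S' -> b S' - b S = al e S' - al e S.
Proof.
move=> wd.
pose cc S S' := if [pick e : {set 'I_n} | (#|e| == 2%N) && (e \subset S :&: S')] is Some e
  then al e S' - al e S else 0.
have ccE S S' e : S \in T -> S' \in T -> #|e| = 2%N -> e \subset S :&: S' ->
    cc S S' = al e S' - al e S.
  move=> ST S'T e2 eS; rewrite /cc; case: pickP => [e' /andP[/eqP e'2 e'S]|/(_ e)].
    exact: wd.
  by rewrite e2 eS.
have [sig sigP] : exists sig : X -> {set 'I_n}, forall y, P y -> sig y \in T /\ hull p (sig y) y.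
  have ex y : exists S, P y -> S \in T /\ hull p S y.
    have [Py|nPy] := pselect (P y); last by exists finset.set0.
    by have [S ST Sy] := dec_cover decP Py; exists S.
  by have [sig sigP] := choice ex; exists sig.
pose c y z := cc (sig y) (sig z).
have [_ H1] := homeomorphic_punctured (s := codom p) ballP
  ltac:(by move=> q /codomP[i ->]; exact: (P_vertex decP)).
have ccat i j S S' : i != j -> S \in T -> S' \in T -> [set i; j]%SET \subset S ->
    [set i; j]%SET \subset S' -> cc S S' = al [set i; j]%SET S' - al [set i; j]%SET S.
  by move=> ij ST S'T eS eS'; apply: ccE; rewrite ?cards2 ?ij // finset.subsetI eS eS'.
have cocyc : local_cocycle (P `&` [set x | x \notin codom p]) c.
  move=> w [Pw nw]; have [i [j [ij ijP]]] := common_edge Pw nw.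
  exists [set y | forall S, S \in T -> hull p S y -> hull p S w]; first exact: (near_star1 decP).
  have sE y : (forall S, S \in T -> hull p S y -> hull p S w) -> P y ->
      sig y \in T /\ [set i; j]%SET \subset sig y.
    by move=> Hy Py; have [sT sy] := sigP y Py; split=> //; apply: ijP => //; exact: Hy.
  move=> y z u [Hy [Py _]] [Hz [Pz _]] [Hu [Pu _]].
  have [yT ye] := sE _ Hy Py; have [zT ze] := sE _ Hz Pz; have [uT ue] := sE _ Hu Pu.
  by rewrite /c !(ccat i j) // subr_trans.
have [h hP] := H1 A c cocyc.
pose K S := hull p S `&` [set x | not_vertex p x].
pose H S y := h y + cc (sig y) S.
have KY S : S \in T -> K S `<=` P `&` [set x | x \notin codom p].
  by move=> ST y [Sy ny]; split=> //; exact: (dec_sub decP ST Sy).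
have Hc S : S \in T -> forall y z, K S y -> K S z -> H S y = H S z.
  move=> ST y z Ky Kz.
  have K0 : H0_trivial (K S) by apply: convex_H0_trivial; exact: hull_not_vertex_convex.
  apply: K0 Ky Kz => w Kw; have [U Uw hU] := hP _ (KY _ ST _ Kw).
  have [i [j [ij ijP]]] := common_edge (KY _ ST _ Kw).1 Kw.2.
  near=> v => Kv.
  have Hv : forall S, S \in T -> hull p S v -> hull p S w by near: v; exact: (near_star1 decP).
  have [wT sw] := sigP w (KY _ ST _ Kw).1; have [vT sv] := sigP v (KY _ ST _ Kv).1.
  have we := ijP _ wT sw; have ve := ijP _ vT (Hv _ vT sv).
  have Se := ijP _ ST Kw.1.
  have E : h v - h w = c w v.
    apply: hU; first by split; [exact: nbhs_singleton|exact: KY Kw].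
    by split; [near: v|exact: KY Kv].
  rewrite /H -[h v](subrK (h w)) E /c !(ccat i j) //.
  by rewrite [_ + h w]addrC -addrA subr_trans.
have ptP S : exists y, S \in T -> K S y.
  have [ST|nST] := boolP (S \in T); last by exists 0.
  have [i [j [ij]]] := two_of_card (ltac:(by rewrite (dec_card decP ST)) : (2 <= #|S|)%N).
  rewrite set2_sub => /andP[iS jS]; exists (on_edge p i j (1/2)) => _; split.
    by apply: on_edge_hull => //; lra.
  by apply: (on_edge_not_vertex decP _ ij); [exists S|lra].
have [pt ptK] := choice ptP.
exists (fun S => H S (pt S)) => S S' e ST S'T e2 eSS'.
have /cards2P[i [j [ij eE]]] : #|e| == 2%N by rewrite e2.
move: eSS'; rewrite eE finset.subsetI => /andP[eS eS'].
move: (eS) (eS'); rewrite !set2_sub => /andP[iS jS] /andP[iS' jS'].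
have n2 : 0 < (1/2 : R) < 1 by lra.
have n2' : 0 <= (1/2 : R) <= 1 by lra.
have nv : not_vertex p (on_edge p i j (1/2)) by apply: (on_edge_not_vertex decP _ ij) => //; exists S.
have KS : K S (on_edge p i j (1/2)) by split=> //; exact: on_edge_hull.
have KS' : K S' (on_edge p i j (1/2)) by split=> //; exact: on_edge_hull.
rewrite (Hc S ST _ _ (ptK S ST) KS) (Hc S' S'T _ _ (ptK S' S'T) KS') /H.
have [sT sy] := sigP _ (KY _ ST _ KS).1.
have se : [set i; j]%SET \subset sig (on_edge p i j (1/2)).
  rewrite set2_sub; apply: (on_edge_star decP _ ij n2 sT sy).
  by exists S.
by rewrite !(ccat i j) // opprD addrACA subrr add0r opprB addrC subr_trans.
Unshelve. all: by end_near. Qed.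

(** Let [V e] be a motion around the edge [e] and [vs S] a motion of the simplex
    [S], all with the length variations [x].  On a simplex around [e] they differ
    by an infinitesimal congruence [al (e, S)].  For two simplices sharing a
    triangle, or equal, the difference of these congruences is determined by
    the values of the [vs S] on the triangle, whatever the edge.  So these
    differences are a coboundary [b], and the corrected motions
    [vs S + killing (b S)] agree at a vertex for simplices that share an edge
    there, hence for all simplices at this vertex. *)
Lemma kernel_motion (x : 'rV[R]_r) : Lambda P p T *m x^T = 0 ->
  exists v, forall S, S \in T -> has_rates x S v.
Proof.
move=> Lx.
have [V VP] : exists V : {set 'I_n} -> 'I_n -> X, forall e, #|e| = 2%N ->
    forall S, S \in T -> e \subset S -> has_rates x S (V e).
  suff ex e : exists v, #|e| = 2%N -> forall S, S \in T -> e \subset S -> has_rates x S v.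
    by have [V VP] := choice ex; exists V.
  have [[[S ST eS] e2]|no] := pselect ((exists2 S, S \in T & e \subset S) /\ #|e| = 2%N); last first.
    by exists (fun=> 0) => e2 S ST eS; case: no; split=> //; exists S.
  have [i [j [_ [_ [eE _ _ eEE]]]]] := enum_edge (dec_card decP ST) e2 eS.
  have ij : i != j by move: e2; rewrite eEE cards2; case: (i != j).
  rewrite eEE in eE eS *.
  have [v vP] := edge_motion decP ballP Lx eE ij (ex_intro2 _ _ S ST eS).
  by exists v.
have [vs vsP] : exists vs : {set 'I_n} -> 'I_n -> X, forall S, S \in T -> has_rates x S (vs S).
  suff ex S : exists v, S \in T -> has_rates x S v by have [vs vsP] := choice ex; exists vs.
  have [ST|nST] := boolP (S \in T); last by exists (fun=> 0).
  have [i [j [ij eS]]] := two_of_card (ltac:(by rewrite (dec_card decP ST)) : (2 <= #|S|)%N).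
  by exists (V [set i; j]%SET) => _; apply: VP => //; rewrite cards2 ij.
have [al alP] : exists al : {set 'I_n} * {set 'I_n} -> X * X, forall eS : {set 'I_n} * {set 'I_n},
    #|eS.1| = 2%N -> eS.2 \in T -> eS.1 \subset eS.2 ->
    forall m, m \in eS.2 -> killing (al eS) (p m) = V eS.1 m - vs eS.2 m.
  suff ex (eS : {set 'I_n} * {set 'I_n}) : exists k : X * X,
      #|eS.1| = 2%N -> eS.2 \in T -> eS.1 \subset eS.2 ->
      forall m, m \in eS.2 -> killing k (p m) = V eS.1 m - vs eS.2 m.
    by have [al alP] := choice ex; exists al.
  case: eS => e S /=.
  have [[e2 ST eS]|no] := pselect [/\ #|e| = 2%N, S \in T & e \subset S]; last first.
    by exists 0 => e2 ST eS; case: no.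
  have [|k kP] := killing_simplex (u := V e) (v := vs S) ST; last by exists k.
  by move=> a b aS bS ab; rewrite (VP e e2 S) // (vsP S).
have diff e S S' m : #|e| = 2%N -> S \in T -> S' \in T -> e \subset S :&: S' -> m \in S :&: S' ->
    killing (al (e, S') - al (e, S)) (p m) = vs S m - vs S' m.
  move=> e2 ST S'T; rewrite finset.subsetI inE => /andP[eS eS'] /andP[mS mS'].
  rewrite killingB (alP (e, S')) // (alP (e, S)) //=.
  by rewrite opprB addrC addrA subrK.
have [b bP] := star_cocycle_trivial (al := fun e S => al (e, S)) ltac:(
  move=> S S' e e' ST S'T e2 e'2 eS e'S;
  have [->//|ee'] := eqVneq e e';
  apply: (killing_eq (S := S) (S' := S') ST);
   [ rewrite ltnNge; apply: contra ee' => c2; apply/eqP;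
     transitivity (S :&: S'); [|symmetry];
     apply/eqP; rewrite eqEcard ?eS ?e'S ?e2 ?e'2
   | by move=> m mSS; rewrite !diff ]; exact: c2).
pose u S m := vs S m + killing (b S) (p m).
have uu S S' i : S \in T -> S' \in T -> i \in S -> i \in S' -> (2 <= #|S :&: S'|)%N -> u S i = u S' i.
  move=> ST S'T iS iS' /two_of_card[j [k [jk eS]]].
  have e2 : #|[set j; k]%SET| = 2%N by rewrite cards2 jk.
  have E := bP S S' _ ST S'T e2 eS.
  have iSS : i \in S :&: S' by rewrite inE iS iS'.
  have := diff _ S S' i e2 ST S'T eS iSS; rewrite -E killingB => E'.
  rewrite /u; apply/eqP; rewrite -subr_eq0 opprD addrACA -E' addrC.
  by rewrite addrC addrA subrK subrr.
have uc S S' i : S \in T -> S' \in T -> i \in S -> i \in S' -> u S i = u S' i.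
  move=> ST S'T iS iS'.
  exact: (vertex_star_connected decP ballP (f := fun S => u S i) (i := i)
    (fun S S' ST S'T iS iS' c => uu S S' i ST S'T iS iS' c) ST S'T iS iS').
have [st stP] : exists st : 'I_n -> {set 'I_n}, forall i, st i \in T /\ i \in st i.
  suff ex i : exists S, S \in T /\ i \in S by have [st stP] := choice ex; exists st.
  by have [S ST iS] := dec_vertex decP i; exists S.
exists (fun i => u (st i) i) => S ST a c aS cS ac.
have [aT aa] := stP a; have [cT c_c] := stP c.
rewrite (uc _ S a) // (uc _ S c) // -(vsP S ST a c aS cS ac) /dsqd /u; congr (2 * _).
have -> : vs S a + killing (b S) (p a) - (vs S c + killing (b S) (p c)) =
   (vs S a - vs S c) + (killing (b S) (p a) - killing (b S) (p c)) by rewrite opprD addrACA.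
by rewrite dotDr dot_killing addr0.
Qed.

Lemma rate_interior (x : 'rV[R]_r) m : rate x (interior_edge m) = x 0 m.
Proof.
rewrite /rate; case: pickP => [k /eqP/enum_val_inj -> //|/(_ m)].
by rewrite eqxx.
Qed.

Lemma rate_boundary (x : 'rV[R]_r) e : e \notin interior_edges P p T -> rate x e = 0.
Proof.
rewrite /rate; case: pickP => // k /eqP <-.
by rewrite (enum_valP k).
Qed.

Lemma interior_edge_set2 (m : 'I_r) : exists i j, [/\ i != j, interior_edge m = [set i; j]%SET &
  exists S, [/\ S \in T, i \in S & j \in S]].
Proof.
have := enum_valP m; rewrite -/(interior_edge m) inE => /andP[+ _].
rewrite inE => /andP[/cards2P[i [j [ij E]]] /existsP[S /andP[ST eS]]].
exists i, j; split=> //; exists S; move: eS; rewrite E set2_sub => /andP[iS jS].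
by split.
Qed.

Lemma flex_rates (v : 'I_n -> X) : infinitesimal_flex P p T v ->
  exists x : 'rV[R]_r, forall S, S \in T -> has_rates x S v.
Proof.
move=> fl.
have ex (m : 'I_r) : exists y : R, forall a b, a != b -> interior_edge m = [set a; b]%SET ->
    dsqd (p a) (p b) (v a) (v b) = 2 * edge_length p (interior_edge m) * y.
  have [i [j [ij E [S [ST iS jS]]]]] := interior_edge_set2 m.
  have e0 := edge_length_gt0 decP ST iS jS ij.
  exists (dsqd (p i) (p j) (v i) (v j) / (2 * edge_length p [set i; j]%SET)) => a b ab; rewrite E => Eab.
  have -> : dsqd (p a) (p b) (v a) (v b) = dsqd (p i) (p j) (v i) (v j).
    have : a \in [set i; j]%SET by rewrite Eab set21.
    have : b \in [set i; j]%SET by rewrite Eab set22.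
    rewrite !inE => /orP[] /eqP Eb /orP[] /eqP Ea; rewrite Ea Eb //; try by rewrite Ea Eb eqxx in ab.
    exact: dsqdC.
  by field; rewrite gt_eqF.
have [y yP] := choice ex.
exists (\row_m y m) => S ST a b aS bS ab; rewrite /dlen2.
have eT : [set a; b]%SET \in edges T.
  by rewrite inE cards2 ab /=; apply/existsP; exists S; rewrite ST set2_sub aS bS.
have [eI|eI] := boolP ([set a; b]%SET \in interior_edges P p T); last first.
  by rewrite rate_boundary // mulr0 /dsqd fl // mulr0.
have mE : interior_edge (enum_rank_in eI [set a; b]%SET : 'I_r) = [set a; b]%SET.
  by rewrite /interior_edge enum_rankK_in.
by rewrite -{1 2}mE rate_interior mxE (yP _ a b ab mE) mE.
Qed.

End Gluing.

Theorem lemma5p3 (R : realType) (P : set 'rV[R]_3) (n : nat)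
    (p : 'I_n -> 'rV[R]_3) (T : {set {set 'I_n}})
    (polyP : polyhedron P)
    (decP : simplicial_decomposition P p T)
    (vertP : no_added_vertex P p) :
  infinitesimally_flexible P p T <-> Lambda P p T \notin unitmx.
Proof.
have [_ ballP] := polyP; split.
- apply: contra_notN => Lu v /flex_rates - /(_ decP)[x hr].
  have Lx := Lambda_flex decP hr.
  have x0 : x = 0.
    have := congr1 (mulmx (invmx (Lambda P p T))) Lx.
    by rewrite mulKmx // mulmx0 => /(congr1 trmx); rewrite trmxK trmx0.
  apply: (isometric_trivial decP ballP) => S ST a b aS bS ab.
  have := hr S ST a b aS bS ab; rewrite /dsqd /dlen2 x0.
  rewrite /rate; case: pickP => [m _|_]; rewrite ?mxE mulr0 => /eqP; by rewrite mulf_eq0 pnatr_eq0 /= => /eqP.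
- move=> Lu rigid.
  have [x x0 Lx] : exists2 x : 'rV_(nb_interior_edges P p T), x != 0 & Lambda P p T *m x^T = 0.
    move: Lu; rewrite unitmxE unitfE negbK -det_tr => /det0P[x x0 xL]; exists x => //.
    by rewrite -[LHS]trmxK trmx_mul trmxK xL trmx0.
  have [v vP] := kernel_motion decP ballP Lx.
  have fl : infinitesimal_flex P p T v.
    move=> i j ij; rewrite inE => /andP[_ /existsP[S /andP[ST]]]; rewrite set2_sub => /andP[iS jS] eI.
    have := vP S ST i j iS jS ij; rewrite /dsqd /dlen2 rate_boundary // mulr0 => /eqP.
    by rewrite mulf_eq0 pnatr_eq0 /= => /eqP.
  have tr := trivial_dot (rigid v fl).
  case/eqP: x0; apply/rowP => m; rewrite [RHS]mxE.
  have [i [j [ij E [S [ST iS jS]]]]] := interior_edge_set2 m.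
  have := vP S ST i j iS jS ij; rewrite /dsqd tr mulr0 /dlen2 -E rate_interior => /esym/eqP.
  rewrite !mulf_eq0 pnatr_eq0 /= E (gt_eqF (edge_length_gt0 decP ST iS jS ij)) /=.
  by move/eqP.
Qed.
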